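(* Let $n\ge1$ and $f,g\in L^2(\mathbb{H}^n)$. Suppose that $$\int_{\mathbb{H}^n}\int_{\mathbb{H}^n}|V_gf(Q,P)|\,e^{\pi(|Q|^2+|P|^2)}\,dQ\,dP<\infty$$ and $$\mathcal{F}(f)(X)=O(e^{-a|X|^2})$$ for some $a>\pi$. Then either $f=0$ or $g=0$.
   Context: $\mathbb{H}^n=\mathbb{R}^n\times\mathbb{R}^n\times\mathbb{R}\cong\mathbb{R}^{2n+1}$ is the Heisenberg group with group law $(p,q,t)\cdot(p',q',t')=\left(p+p',q+q',t+t'+\tfrac12(pq'-qp')\right)$, where $pq$ is the Euclidean dot product on $\mathbb{R}^n$. Its Haar measure is Lebesgue measure on $\mathbb{R}^{2n+1}$, so $L^2(\mathbb{H}^n)=L^2(\mathbb{R}^{2n+1})$. $\mathcal{F}$ is the Euclidean Fourier transform on $\mathbb{R}^{2n+1}$, $\mathcal{F}(h)(Q)=\int_{\mathbb{R}^{2n+1}}h(X)e^{-2\pi i\langle Q,X\rangle}\,dX$, extended to a unitary operator on $L^2(\mathbb{R}^{2n+1})$; here $\langle Q,X\rangle$ is the Euclidean inner product on $\mathbb{R}^{2n+1}$. The short-time Fourier transform of $f\in L^2(\mathbb{H}^n)$ with window $g\in L^2(\mathbb{H}^n)$ is $$V_gf(Q,P)=\int_{\mathbb{R}^{2n+1}}\mathcal{F}(f)(X)\,\overline{\mathcal{F}(g)(X\cdot P)}\,e^{-2\pi i\langle Q,X\rangle}\,dX,\qquad Q,P\in\mathbb{H}^n,$$ with $X\cdot P$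 the Heisenberg product. $|Q|$ denotes the Euclidean norm of $Q\in\mathbb{H}^n\cong\mathbb{R}^{2n+1}$. The condition $\mathcal{F}(f)(X)=O(e^{-a|X|^2})$ means that there is a constant $C>0$ with $|\mathcal{F}(f)(X)|\le Ce^{-a|X|^2}$ for almost every $X\in\mathbb{R}^{2n+1}$. *)

(* Defs.v *)
From HB Require Import structures.
From mathcomp Require Import all_boot all_order all_algebra.
From mathcomp Require Import all_classical all_reals all_analysis.
From mathcomp.real_closed Require Import complex.

Set Implicit Arguments.
Unset Strict Implicit.
Unset Printing Implicit Defensive.
Import Order.TTheory GRing.Theory Num.Theory.
Import numFieldNormedType.Exports.

Local Open Scope classical_set_scope.
Local Open Scope ring_scope.

(* An alias of [m1 \x m2]: on the latter, the canonical sigma-finite structure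
   found by unification is the one for subprobabilities. *)
Section sigma_product.
Local Open Scope ereal_scope.
Context d1 d2 (T1 : measurableType d1) (T2 : measurableType d2) (R : realType).
Variable m1 : {sigma_finite_measure set T1 -> \bar R}.
Variable m2 : {sigma_finite_measure set T2 -> \bar R}.

Definition sigma_product : set (T1 * T2) -> \bar R := m1 \x m2.

HB.instance Definition _ := Measure.on sigma_product.

Let sigma_product_sigma_finite : sigma_finite setT sigma_product.
Proof.
have /sigma_finiteP[F [TF ndF Foo]] := sigma_finiteT m1.
have /sigma_finiteP[G [TG ndG Goo]] := sigma_finiteT m2.
exists (fun n => F n `*` G n).
  rewrite -setXTT TF TG predeqE => -[x y]; split.
    move=> [/= [n _ Fnx] [k _ Gky]]; exists (maxn n k) => //; split.
    - by move: x Fnx; exact/subsetPset/ndF/leq_maxl.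
    - by move: y Gky; exact/subsetPset/ndG/leq_maxr.
  by move=> [n _ []/= ? ?]; split; exists n.
move=> k; have [? ?] := Foo k; have [? ?] := Goo k.
split; first exact: measurableX.
by rewrite /sigma_product product_measure1E// lte_mul_pinfty// ge0_fin_numE.
Qed.

HB.instance Definition _ := Measure_isSigmaFinite.Build _ _ _ sigma_product
  sigma_product_sigma_finite.

End sigma_product.

Section lebesgue_cons.
Context (R : realType) (n : nat).
Local Notation RT := (measurableTypeR R).

Definition cons_pair (x : RT * n.-tuple RT) : n.+1.-tuple RT :=
  [the n.+1.-tuple RT of x.1 :: x.2].

Definition uncons (x : n.+1.-tuple RT) : RT * n.-tuple RT :=
  (thead x, [tuple of behead x]).

Lemma cons_pairK : cancel cons_pair uncons.
Proof.
by move=> [a x]; congr pair; exact: val_inj.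
Qed.

Lemma measurable_cons_pair : measurable_fun setT cons_pair.
Proof. by apply: measurable_cons; [exact: measurable_fst|exact: measurable_snd]. Qed.

Lemma measurable_uncons : measurable_fun setT uncons.
Proof.
apply: measurable_fun_pair; first exact: measurable_tnth.
exact: measurable_behead.
Qed.

Variable mu : {sigma_finite_measure set (n.-tuple RT) -> \bar R}.

Definition lebesgue_cons : set (n.+1.-tuple RT) -> \bar R :=
  pushforward (sigma_product (@lebesgue_measure R) mu) cons_pair.

Let mpre A : measurable A -> measurable (cons_pair @^-1` A).
Proof. by move=> mA; rewrite -[X in measurable X]setTI; exact: measurable_cons_pair. Qed.

Let lebesgue_cons0 : lebesgue_cons set0 = 0%E.
Proof. by rewrite /lebesgue_cons /pushforward preimage_set0 measure0. Qed.

Let lebesgue_cons_ge0 A : (0 <= lebesgue_cons A)%E.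
Proof. by rewrite /lebesgue_cons /pushforward measure_ge0. Qed.

Let lebesgue_cons_sigma_additive : semi_sigma_additive lebesgue_cons.
Proof.
move=> F mF tF mUF; rewrite /lebesgue_cons /pushforward preimage_bigcup.
apply: measure_semi_sigma_additive.
- by move=> k; exact: mpre.
- apply/trivIsetP => /= i j _ _ ij; rewrite -preimage_setI.
  by move/trivIsetP : tF => /(_ _ _ _ _ ij) ->//; rewrite preimage_set0.
- by rewrite -preimage_bigcup; exact: mpre.
Qed.

HB.instance Definition _ := isMeasure.Build _ _ _ lebesgue_cons
  lebesgue_cons0 lebesgue_cons_ge0 lebesgue_cons_sigma_additive.

Let lebesgue_cons_sigma_finite : sigma_finite setT lebesgue_cons.
Proof.
have [F UF mF] := sigma_finiteT (sigma_product (@lebesgue_measure R) mu).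
exists (fun k => uncons @^-1` F k).
  by rewrite -preimage_bigcup -UF preimage_setT.
move=> k; have [mFk Fk] := mF k; split.
  by rewrite -[X in measurable X]setTI; exact: measurable_uncons.
rewrite /lebesgue_cons /pushforward (_ : _ @^-1` _ = F k)//.
by apply/seteqP; split => x /=; rewrite cons_pairK.
Qed.

HB.instance Definition _ := Measure_isSigmaFinite.Build _ _ _ lebesgue_cons
  lebesgue_cons_sigma_finite.

End lebesgue_cons.

(* Lebesgue measure on the Borel sets of R^n: the n-fold product of the
   one-dimensional one. *)
Fixpoint lebesgue_tuple (R : realType) (n : nat) :
    {sigma_finite_measure set (n.-tuple (measurableTypeR R)) -> \bar R} :=
  match n with
  | 0 => @dirac _ (0.-tuple (measurableTypeR R)) [tuple] R
  | m.+1 => lebesgue_cons (lebesgue_tuple R m)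
  end.

(* Triples (p, q, t), with R^n represented by n-tuples because those carry the
   product Borel structure in the library. *)
Notation heis R n := (n.-tuple (measurableTypeR R) *
  n.-tuple (measurableTypeR R) * measurableTypeR R)%type.

Section heisenberg.
Context (R : realType) (n : nat).
Local Notation RT := (measurableTypeR R).
Local Notation H := (heis R n).

Definition haar : {sigma_finite_measure set H -> \bar R} :=
  sigma_product (sigma_product (lebesgue_tuple R n) (lebesgue_tuple R n))
    (@lebesgue_measure R).

Definition dot (p q : n.-tuple RT) : R := \sum_(i < n) tnth p i * tnth q i.

Definition tadd (p q : n.-tuple RT) : n.-tuple RT :=
  [tuple tnth p i + tnth q i | i < n].

Definition heis_mul (X P : H) : H :=
  (tadd X.1.1 P.1.1, tadd X.1.2 P.1.2,
   X.2 + P.2 + 2^-1 * (dot X.1.1 P.1.2 - dot X.1.2 P.1.1)).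

Definition inner (Q X : H) : R :=
  dot Q.1.1 X.1.1 + dot Q.1.2 X.1.2 + Q.2 * X.2.

Definition sqnorm (X : H) : R := inner X X.

Definition cabs (z : R[i]) : R := complex.Re `|z|.

Definition cis (s : R) : R[i] := Complex (cos s) (sin s).

Definition cintegral (h : H -> R[i]) : R[i] :=
  Complex (\int[haar]_X complex.Re (h X)) (\int[haar]_X complex.Im (h X)).

Definition cmeasurable (h : H -> R[i]) : Prop :=
  measurable_fun setT (fun X => complex.Re (h X) : RT) /\
  measurable_fun setT (fun X => complex.Im (h X) : RT).

Definition norm2sq (h : H -> R[i]) : \bar R :=
  (\int[haar]_X (cabs (h X) ^+ 2)%:E)%E.

Definition inL1 (h : H -> R[i]) : Prop :=
  cmeasurable h /\ (\int[haar]_X (cabs (h X))%:E < +oo)%E.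

Definition inL2 (h : H -> R[i]) : Prop := cmeasurable h /\ (norm2sq h < +oo)%E.

Definition fourier1 (h : H -> R[i]) (Q : H) : R[i] :=
  cintegral (fun X => h X * cis (- (2 * pi * inner Q X))).

(* [hf] is the value at [h] of the extension by continuity to L^2 of the
   transform [fourier1] on L^1 `&` L^2. *)
Definition is_fourier2 (h hf : H -> R[i]) : Prop :=
  inL2 hf /\
  exists u : nat -> H -> R[i],
    [/\ forall k, inL1 (u k) /\ inL2 (u k),
        norm2sq (fun X => u k X - h X) @[k --> \oo] --> 0%E &
        norm2sq (fun Q => fourier1 (u k) Q - hf Q) @[k --> \oo] --> 0%E].

(* A representative of the L^2 Fourier transform, which is unique up to almost
   everywhere equality and exists for every [h] in L^2 by Plancherel's theorem. *)
Definition fourier2 (h : H -> R[i]) : H -> R[i] :=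
  xget (fun=> 0) [set hf | is_fourier2 h hf].

(* V_g f (Q, P); the window is the first argument. *)
Definition stft (g f : H -> R[i]) (Q P : H) : R[i] :=
  cintegral (fun X => fourier2 f X * (fourier2 g (heis_mul X P))^*%C *
                      cis (- (2 * pi * inner Q X))).

End heisenberg.

(* Main.v *)
(* Let [F] and [G] be the Fourier transforms of [f] and [g], and put
   h_P(X) = F(X) conj(G(X.P)), so that V_g f(., P) is the Fourier transform of h_P. For
   almost every P the first hypothesis makes this transform integrable against
   exp(pi |Q|^2). As a > pi and, by left invariance of Haar measure, G(X.P) is square
   integrable against Gaussians in X for almost every P, also h_P is integrable against
   exp(pi r^2 |X|^2) for some r > 1.

   By Beurling's uncertainty principle h_P = 0. Following Hedenmalm, if k is the transform
   of such a function on R^d, d > 0, then A(l) = Re \int conj(k(y)) k(l y) dy is a power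
   series in l of radius of convergence at least r, while l^d A(l) = A(1/l) by
   substitution. Hence A = 0, and A(1) is the squared norm of k.

   Finally \int \int |h_P(X)|^2 dX dP = ||F||^2 ||G||^2, so F = 0 or G = 0. The existence
   and the injectivity of the transform on L^2 rest on Bessel's inequality and on
   convolution with Gaussians. *)

Require Import Defs.
From HB Require Import structures.
From mathcomp Require Import all_boot all_order all_algebra.
From mathcomp Require Import all_classical all_reals all_analysis.
From mathcomp.real_closed Require Import complex.
From mathcomp Require Import measurable_realfun.
From mathcomp Require Import ring lra.

Import Order.TTheory GRing.Theory Num.Theory.
Import numFieldNormedType.Exports.

Local Open Scope classical_set_scope.
Local Open Scope ring_scope.

Set Implicit Arguments.
Unset Strict Implicit.
Unset Printing Implicit Defensive.

(** The functional equation matches the exponents k + d of l^d A(l) with the exponents - k of A(1/l)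
    on the annulus 1/r < |l| < r. As d > 0, no exponent occurs on both sides, and this forces every
    coefficient to vanish. The annulus is nonempty only for r > 1, and here the strict inequality a
    > pi is spent: a = pi r^2 + pi e^2, where the first term weights h_P and the second leaves a
    Gaussian against which G(X.P) is integrated. The radius comes from 2 pi r |<y, x>| <= pi |y|^2 +
    pi r^2 |x|^2, which bounds the expanded kernel by the product of the two weights.

    Complex functions are pairs of real ones and l stays real: instead of holomorphy the argument
    uses exponential sums in t = ln l. Uniqueness is always reached in the same way: the transform
    of a Gaussian is explicit, so a function with vanishing transform is orthogonal to all
    Gaussians, and narrow Gaussians recover its integrals over enough sets. The record [euclid]
    carries these facts from the line to products. *)

(** * Real-valued integration, Fubini's theorem and affine substitutions *)

Section integration.
Context d (T : measurableType d) (R : realType).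
Variable mu : {measure set T -> \bar R}.
Implicit Types f g h : T -> R.

Definition L1 f := mu.-integrable setT (EFin \o f).

Lemma L1_measurable f : L1 f -> measurable_fun setT f.
Proof. by move=> /measurable_int /measurable_EFinP. Qed.

Lemma L1_le f g : measurable_fun setT f -> (forall x, `|f x| <= g x) ->
  L1 g -> L1 f.
Proof.
move=> mf fg; apply: le_integrable => //; first exact/measurable_EFinP.
by move=> x _ /=; rewrite lee_fin (le_trans (fg x))// ler_norm.
Qed.

Lemma L1P f : measurable_fun setT f -> L1 f <-> (\int[mu]_x `|f x|%:E < +oo)%E.
Proof.
move=> mf; split; first by move=> /integrableP[].
by move=> h; apply/integrableP; split => //; exact/measurable_EFinP.
Qed.

Lemma L1_ge0P f : measurable_fun setT f -> (forall x, 0 <= f x) ->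
  L1 f <-> (\int[mu]_x (f x)%:E < +oo)%E.
Proof.
move=> mf f0; rewrite L1P//.
by under eq_integral do rewrite ger0_norm//.
Qed.

Lemma L1D f g : L1 f -> L1 g -> L1 (fun x => f x + g x).
Proof. by move=> lf lg; have := integrableD measurableT lf lg. Qed.

Lemma L1B f g : L1 f -> L1 g -> L1 (fun x => f x - g x).
Proof. by move=> lf lg; have := integrableB measurableT lf lg. Qed.

Lemma L1Z c f : L1 f -> L1 (fun x => c * f x).
Proof. by move=> lf; have := integrableZl measurableT c lf. Qed.

Lemma L1_norm f : L1 f -> L1 (fun x => `|f x|).
Proof. by move=> lf; have := integrable_abse lf. Qed.

Lemma eq_L1 f g : f =1 g -> L1 f -> L1 g.
Proof. by move=> /funext ->. Qed.

Lemma L1_bounded M f g : L1 f -> measurable_fun setT g ->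
  (forall x, `|g x| <= M) -> L1 (fun x => f x * g x).
Proof.
move=> lf mg gM.
apply: (@L1_le _ (fun x => M * `|f x|)).
- by apply: measurable_funM => //; exact: L1_measurable.
- by move=> x; rewrite normrM mulrC ler_wpM2r.
- exact/L1Z/L1_norm.
Qed.

Lemma Rintegral_EFin f : L1 f -> (\int[mu]_x f x)%:E = (\int[mu]_x (f x)%:E)%E.
Proof. by move=> lf; rewrite /Rintegral fineK//; exact: integrable_fin_num. Qed.

Lemma ae_eq_Rintegral f g : measurable_fun setT f -> measurable_fun setT g ->
  {ae mu, forall x, f x = g x} -> \int[mu]_x f x = \int[mu]_x g x.
Proof.
move=> mf mg fg; congr fine; apply: ae_eq_integral => //.
- exact/measurable_EFinP.
- exact/measurable_EFinP.
- by apply: filterS fg => x /= -> .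
Qed.

Lemma Rintegral_eq0_ae f : L1 f -> (forall x, 0 <= f x) ->
  \int[mu]_x f x = 0 -> {ae mu, forall x, f x = 0}.
Proof.
move=> lf f0 If.
have h : (\int[mu]_x (f x)%:E = 0)%E by rewrite -Rintegral_EFin// If.
have /(ae_eq_integral_abs mu measurableT (measurable_int _ lf)) :
    (\int[mu]_x `|(EFin \o f) x| = 0)%E.
  by rewrite -h; apply: eq_integral => x _ /=; rewrite ger0_norm.
by apply: filterS => x /= /(_ I)[].
Qed.

Lemma integral_eq0_ae f : measurable_fun setT f -> (forall x, 0 <= f x) ->
  (\int[mu]_x (f x)%:E = 0)%E -> {ae mu, forall x, f x = 0}.
Proof.
move=> mf f0 h; apply: Rintegral_eq0_ae => //; last by rewrite /Rintegral h.
by apply/L1_ge0P => //; rewrite h.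
Qed.

Lemma cvg_Rintegral (f_ : nat -> T -> R) f g :
  (forall n, measurable_fun setT (f_ n)) -> measurable_fun setT f ->
  {ae mu, forall x, f_ ^~ x @ \oo --> f x} ->
  L1 g -> (forall n x, `|f_ n x| <= g x) ->
  L1 f /\ (\int[mu]_x f_ n x) @[n --> \oo] --> \int[mu]_x f x.
Proof.
move=> mf_ mf cf lg fg.
have [||||lf _ cI] := @dominated_convergence _ _ _ mu _ measurableT
   (fun n x => (f_ n x)%:E) (EFin \o f) (EFin \o g) _ _ _ lg _.
- by move=> n; exact/measurable_EFinP.
- exact/measurable_EFinP.
- by apply: filterS cf => x cx _; apply: cvg_EFin => //; exact: nearW.
- by apply/aeW => x n _ /=; rewrite lee_fin.
split => //.
apply: (@fine_cvg _ _ _ _ (fun n => \int[mu]_x (f_ n x)%:E)%E).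
by rewrite -[\int[mu]_x f x]/(fine _) fineK//; exact: integrable_fin_num.
Qed.

End integration.
Arguments L1 {d T R}.

Section fubini_real.
Context d1 d2 (T1 : measurableType d1) (T2 : measurableType d2) (R : realType).
Variables (m1 : {sigma_finite_measure set T1 -> \bar R})
          (m2 : {sigma_finite_measure set T2 -> \bar R}).
Implicit Types f : T1 * T2 -> R.

Local Notation m12 := (sigma_product m1 m2).

Lemma L1_iter f (g : T1 -> R) : measurable_fun setT f -> L1 m1 g ->
  (forall x, (\int[m2]_y `|f (x, y)|%:E <= (g x)%:E)%E) -> L1 m12 f.
Proof.
move=> mf lg fg; apply/(integrable12ltyP _ _ _).2; first exact/measurable_EFinP.
have /integrableP[_] := lg; apply: le_lt_trans; apply: ge0_le_integral => //=.
- by move=> x _; exact: integral_ge0.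
- apply: (measurable_fun_fubini_tonelli_F (fun z => (`|f z|)%:E)) => //=.
  by apply/measurable_EFinP; exact: measurableT_comp.
- apply/measurable_EFinP; apply: measurableT_comp => //; exact: L1_measurable lg.
- by move=> x _; rewrite (le_trans (fg x))// lee_fin ler_norm.
Qed.

Lemma L1_prod f (g : T1 -> R) (h : T2 -> R) : measurable_fun setT f ->
  L1 m1 g -> L1 m2 h -> (forall x y, `|f (x, y)| <= g x * h y) ->
  L1 m12 f.
Proof.
move=> mf lg lh fgh.
apply: (@L1_iter _ (fun x => \int[m2]_y `|h y| * `|g x|)) => //.
  exact/L1Z/L1_norm.
move=> x; rewrite mulrC EFinM (Rintegral_EFin (L1_norm lh)).
rewrite -ge0_integralZl//=; last first.
  by apply/measurable_EFinP; apply: measurableT_comp => //; exact: L1_measurable lh.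
apply: ge0_le_integral => //=.
- apply/measurable_EFinP; apply: measurableT_comp => //.
  by apply: measurableT_comp => //; exact: measurable_pair1.
- apply/measurable_EFinP; apply: measurable_funM => //.
  by apply: measurableT_comp => //; exact: L1_measurable lh.
- by move=> y _; rewrite -EFinM lee_fin (le_trans (fgh x y))// -normrM ler_norm.
Qed.

(** No integrability is assumed: Tonelli handles the positive and negative parts, and [fine] sends
    an infinite difference to 0. *)
Lemma measurable_Rintegral1 f : measurable_fun setT f ->
  measurable_fun setT (fun x => \int[m2]_y f (x, y)).
Proof.
move=> mf; apply: measurableT_comp => //.
rewrite (_ : (fun x => _) = ((fun x => \int[m2]_y (EFin \o f)^\+ (x, y)) \-
   (fun x => \int[m2]_y (EFin \o f)^\- (x, y)))%E); last first.
  apply/funext => x; rewrite [LHS]integralE.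
  by congr (_ - _)%E; apply: eq_integral => y _; rewrite unlock.
have mf' : measurable_fun setT (EFin \o f) by exact/measurable_EFinP.
apply: emeasurable_funB.
- apply: (measurable_fun_fubini_tonelli_F ((EFin \o f)^\+)%E) => //.
  exact: measurable_funepos.
- apply: (measurable_fun_fubini_tonelli_F ((EFin \o f)^\-)%E) => //.
  exact: measurable_funeneg.
Qed.

Lemma measurable_Rintegral2 f : measurable_fun setT f ->
  measurable_fun setT (fun y => \int[m1]_x f (x, y)).
Proof.
move=> mf; apply: measurableT_comp => //.
rewrite (_ : (fun x => _) = ((fun y => \int[m1]_x (EFin \o f)^\+ (x, y)) \-
   (fun y => \int[m1]_x (EFin \o f)^\- (x, y)))%E); last first.
  apply/funext => x; rewrite [LHS]integralE.
  by congr (_ - _)%E; apply: eq_integral => y _; rewrite unlock.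
have mf' : measurable_fun setT (EFin \o f) by exact/measurable_EFinP.
apply: emeasurable_funB.
- apply: (measurable_fun_fubini_tonelli_G ((EFin \o f)^\+)%E) => //.
  exact: measurable_funepos.
- apply: (measurable_fun_fubini_tonelli_G ((EFin \o f)^\-)%E) => //.
  exact: measurable_funeneg.
Qed.

Lemma L1_Rintegral1 f : L1 m12 f -> L1 m1 (fun x => \int[m2]_y f (x, y)).
Proof.
move=> lf; apply: le_integrable (integrable_fubini_F lf) => //.
  by apply/measurable_EFinP/measurable_Rintegral1; exact: L1_measurable lf.
move=> x _; rewrite /= /Rintegral /fubini_F.
by case: (integral _ _ _) => [r| |] //=; rewrite leey.
Qed.

Lemma L1_Rintegral2 f : L1 m12 f -> L1 m2 (fun y => \int[m1]_x f (x, y)).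
Proof.
move=> lf.
apply/L1P.
  by apply: measurable_Rintegral2; exact: L1_measurable lf.
have /(integrable21ltyP _ _ _).1 := lf.
move=> /(_ (measurable_int _ lf)); apply: le_lt_trans; apply: ge0_le_integral => //=.
- apply/measurable_EFinP; apply: measurableT_comp => //.
  by apply: measurable_Rintegral2; exact: L1_measurable lf.
- apply: (measurable_fun_fubini_tonelli_G (fun z => (`|f z|)%:E)) => //=.
  apply/measurable_EFinP; apply: measurableT_comp => //; exact: L1_measurable lf.
- move=> y _.
  have my : measurable_fun setT (fun x => (f (x, y))%:E).
    apply/measurable_EFinP; exact: measurableT_comp (L1_measurable lf) (measurable_pair2 y).
  apply: (le_trans _ (le_abse_integral m1 measurableT my)).
  by rewrite /Rintegral; case: (integral _ _ _) => [r| |] //=; rewrite leey.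
Qed.

(** The inner integrals are finite only for almost every [x]; on the exceptional null set [fine] may
    change them. *)
Lemma Rfubini1 f : L1 m12 f ->
  \int[m12]_z f z = \int[m1]_x \int[m2]_y f (x, y).
Proof.
move=> lf; rewrite /Rintegral; congr fine.
rewrite -(integral12_prod_meas1 lf); apply: ae_eq_integral => //.
- exact: measurable_fubini_F lf.
- apply/measurable_EFinP; apply: measurable_Rintegral1.
  exact: L1_measurable lf.
- apply: filterS (ae_integrable1 lf) => x lx _ /=.
  by rewrite fineK//; exact: integrable_fin_num.
Qed.

Lemma Rfubini2 f : L1 m12 f ->
  \int[m12]_z f z = \int[m2]_y \int[m1]_x f (x, y).
Proof.
move=> lf; rewrite /Rintegral; congr fine.
rewrite -(integral21_prod_meas1 lf); apply: ae_eq_integral => //.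
- exact: measurable_fubini_G lf.
- apply/measurable_EFinP; apply: measurable_Rintegral2.
  exact: L1_measurable lf.
- apply: filterS (ae_integrable2 lf) => x lx _ /=.
  by rewrite fineK//; exact: integrable_fin_num.
Qed.

Lemma Rfubini f : L1 m12 f ->
  \int[m1]_x \int[m2]_y f (x, y) = \int[m2]_y \int[m1]_x f (x, y).
Proof. by move=> lf; rewrite -Rfubini1// Rfubini2. Qed.

End fubini_real.

Section trig_bounds.
Variable R : realType.
Implicit Type x : R.

Lemma cos_bound x : `|cos x| <= 1.
Proof. by rewrite ler_norml cos_geN1 cos_le1. Qed.

Lemma sin_bound x : `|sin x| <= 1.
Proof. by rewrite ler_norml sin_geN1 sin_le1. Qed.

Lemma measurable_cos : measurable_fun setT (@cos R).
Proof. by apply: continuous_measurable_fun; exact: continuous_cos. Qed.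

Lemma measurable_sin : measurable_fun setT (@sin R).
Proof. by apply: continuous_measurable_fun; exact: continuous_sin. Qed.

End trig_bounds.

Section line.
Variable R : realType.
Local Notation RT := (measurableTypeR R).
Local Notation lambda := (@lebesgue_measure R).

Definition affine (c b : R) (x : RT) : RT := c * x + b.

Lemma measurable_affine (c b : R) : measurable_fun setT (affine c b).
Proof. by apply: measurable_funD => //; apply: measurable_funM. Qed.

Let push (c b : R) : {measure set RT -> \bar R} :=
  measure_function_pushforward__canonical__measure_function_Measure lambda
    (measurable_affine c b).

(** Lebesgue measure is determined by its values on the intervals []u, v]], and the rescaled
    pushforward [m] takes the same values there. *)
Lemma lebesgue_affine (c b : R) (A : set RT) : c != 0 -> measurable A ->
  lambda A = (`|c|%:E * lambda (affine c b @^-1` A))%E.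
Proof.
move=> c0 mA.
pose m := mscale (NngNum (normr_ge0 c)) (push c b).
suff : lambda A = m A by [].
apply: lebesgue_measure_unique => //= _ [[u v]] _ <-.
rewrite /m /mscale /= /pushforward /= /affine.
have [c_gt0|c_le0] := ltP 0 c.
  rewrite (_ : _ @^-1` _ = `](u - b) / c, (v - b) / c]%classic); last first.
    apply/seteqP; split => x /=; rewrite !in_itv/= ltr_pdivrMr// ler_pdivlMr//;
    by move=> /andP[? ?]; apply/andP; split; lra.
  rewrite !lebesgue_measure_itv/= !lte_fin ltr_pM2r ?invr_gt0// ltrD2r.
  case: ifPn => _; last by rewrite mule0.
  by rewrite -!EFinB -EFinM gtr0_norm//; congr EFin; field; rewrite gt_eqF.
(* For negative [c] the preimage is closed on the left instead of on the right, which leaves its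
   length unchanged. *)
have c_lt0 : c < 0 by rewrite lt_neqAle c0.
rewrite (_ : _ @^-1` _ = `[(v - b) / c, (u - b) / c[%classic); last first.
  apply/seteqP; split => x /=; rewrite !in_itv/= ler_ndivrMr// ltr_ndivlMr//;
  by move=> /andP[? ?]; apply/andP; split; lra.
rewrite !lebesgue_measure_itv/= !lte_fin ltr_nM2r ?invr_lt0// ltrD2r.
case: ifPn => _; last by rewrite mule0.
by rewrite -!EFinB -EFinM ltr0_norm//; congr EFin; field; rewrite lt_eqF.
Qed.

Lemma ge0_integral_affine (c b : R) (f : RT -> \bar R) : c != 0 ->
  measurable_fun setT f -> (forall x, 0 <= f x)%E ->
  (\int[lambda]_x f (affine c b x) = (`|c|^-1)%:E * \int[lambda]_x f x)%E.
Proof.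
move=> c0 mf f0.
have nc : 0 < `|c| by rewrite normr_gt0.
have h : (\int[mscale (NngNum (normr_ge0 c)) (push c b)]_x f x =
    `|c|%:E * \int[lambda]_x f (affine c b x))%E.
  rewrite ge0_integral_mscale//; congr (_ * _)%E.
  by rewrite ge0_integral_pushforward//; exact: measurable_affine.
have -> : (\int[lambda]_x f x =
  \int[mscale (NngNum (normr_ge0 c)) (push c b)]_x f x)%E.
  by apply: eq_measure_integral => A mA _ /=; exact: lebesgue_affine.
by rewrite h muleA -EFinM mulVf ?gt_eqF// mul1e.
Qed.

End line.

(** * Gaussians *)

Section gauss_line.
Variable R : realType.
Local Notation RT := (measurableTypeR R).
Local Notation lambda := (@lebesgue_measure R).
Local Notation gauss := (@gauss_fun R).

(** The fundamental theorem of calculus on [[- n, n]], followed by dominated convergence with bound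
    [|h'|]. *)
Lemma Rintegral_derive_eq0 (h h' : R -> R) :
  (forall x : R, is_derive x 1 h (h' x)) -> continuous h' -> L1 lambda h' ->
  (h n%:R - h (- n%:R)) @[n --> \oo] --> 0 -> \int[lambda]_x h' x = 0.
Proof.
move=> dh ch' lh' h0.
have mh' : measurable_fun setT (h' : RT -> RT) by exact: L1_measurable lh'.
(* With [n.+1] no interval is degenerate, as the fundamental theorem requires. *)
pose I n : set RT := `[- n.+1%:R, n.+1%:R]%classic.
have [|||||_ c] := @cvg_Rintegral _ _ _ lambda (fun n x => h' x * \1_(I n) x) h'
    (fun x => `|h' x|).
- by move=> n; apply: measurable_funM => //; apply: measurable_indic; exact: measurable_itv.
- exact: mh'.
- apply: aeW => x; apply: cvg_near_cst.
  near=> n; rewrite indicE mem_set ?mulr1// /I /= in_itv/=.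
  rewrite -ler_norml ltW// (@lt_le_trans _ _ n%:R)//.
    by near: n; apply: nbhs_infty_gtr.
  by rewrite ler_nat.
- exact: L1_norm.
- move=> n x; rewrite normrM ler_piMr// indicE; case: (_ \in _) => /=;
  by rewrite ?normr1 ?normr0.
have E n : \int[lambda]_x (h' x * \1_(I n) x) = h n.+1%:R - h (- n.+1%:R).
  have -> : (fun x => h' x * \1_(I n) x) = h' \_ (I n).
    apply/funext => x; rewrite patchE indicE; case: ifPn => _;
    by rewrite ?mulr1 ?mulr0.
  rewrite -Rintegral_mkcond /Rintegral.
  have dcont : continuous h.
    by move=> x; apply/differentiable_continuous/derivable1_diffP; case: (dh x).
  rewrite (@continuous_FTC2 _ h' h)//.
  - by rewrite gtrN // ltr0n.
  - exact: continuous_subspaceT.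
  - split.
    + by move=> x _; case: (dh x).
    + by apply: cvg_at_right_filter; exact: dcont.
    + by apply: cvg_at_left_filter; exact: dcont.
  - by move=> x _; rewrite derive1E; case: (dh x).
move: c; rewrite (funext E) => c.
have h0' : (h n.+1%:R - h (- n.+1%:R)) @[n --> \oo] --> 0.
  by rewrite (cvg_shiftS (fun n => h n%:R - h (- n%:R))).
exact: (cvg_unique _ c h0').
Unshelve. all: by end_near. Qed.

Let g x := expR (- (pi * x ^+ 2)) : R.

Let gE x : g x = gauss (Num.sqrt pi * x + 0).
Proof. by rewrite /g /gauss_fun addr0 exprMn sqr_sqrtr// pi_ge0. Qed.

Let mg : measurable_fun setT (g : RT -> RT).
Proof.
apply: measurableT_comp => //; apply: measurableT_comp => //.
by apply: measurable_funM => //; exact: measurable_funX.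
Qed.

Lemma integral_gauss_pi : (\int[lambda]_x (g x)%:E = 1)%E.
Proof.
under eq_integral do rewrite gE.
rewrite (@ge0_integral_affine R (Num.sqrt pi) 0 (fun x => (gauss x)%:E))//.
- rewrite integralT_gauss -EFinM ger0_norm ?sqrtr_ge0// mulVf//.
  by rewrite gt_eqF// sqrtr_gt0 pi_gt0.
- by rewrite gt_eqF// sqrtr_gt0 pi_gt0.
- by apply/measurable_EFinP; exact: measurable_gauss_fun.
- by move=> x; rewrite lee_fin gauss_fun_ge0.
Qed.

Let lg : L1 lambda g.
Proof.
by apply/L1_ge0P => //; rewrite ?integral_gauss_pi ?ltry// => x; exact: expR_ge0.
Qed.

(** Dominates the integrand once it is differentiated in [xi]: |x| <= 1 + x^2 <= exp(x^2), and pi >=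
    2 leaves at least the decay exp(- x^2) of [gauss]. *)
Let xg_le x : `|x * g x| <= gauss x.
Proof.
rewrite normrM (ger0_norm (expR_ge0 _)).
have h1 : `|x| <= expR (x ^+ 2).
  apply: le_trans (expR_ge1Dx _).
  have : 0 <= (`|x| - 1) ^+ 2 by exact: sqr_ge0.
  rewrite -(real_normK (num_real x)); nra.
apply: (@le_trans _ _ (expR (x ^+ 2) * g x)); first by rewrite ler_wpM2r// expR_ge0.
rewrite /g /gauss_fun -expRD ler_expR.
have : 0 <= x ^+ 2 by exact: sqr_ge0.
have := @pi_ge2 R; nra.
Qed.

Let F xi : R := \int[lambda]_x (g x * cos (2 * pi * x * xi)).

Let lgc xi : L1 lambda (fun x => g x * cos (2 * pi * x * xi)).
Proof.
apply: (@L1_bounded _ _ _ _ 1) => //; last by move=> x; exact: cos_bound.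
apply: measurableT_comp; first exact: measurable_cos.
by apply: measurable_funM => //; apply: measurable_funM.
Qed.

Let lxgs xi : L1 lambda (fun x => x * g x * sin (2 * pi * x * xi)).
Proof.
apply: (@L1_bounded _ _ _ _ 1); last by move=> x; exact: sin_bound.
  apply: (@L1_le _ RT _ _ _ gauss) => //.
  - exact: measurable_funM.
  - exact: integrableT_gauss.
apply: measurableT_comp; first exact: measurable_sin.
by apply: measurable_funM => //; apply: measurable_funM.
Qed.

Let dcosxi (x xi : R) : is_derive xi 1 (fun xi => g x * cos (2 * pi * x * xi))
  (- (2 * pi) * (x * g x * sin (2 * pi * x * xi))).
Proof.
apply: is_derive_eq.
by rewrite ?(scaler0, scale0r, addr0, add0r) /GRing.scale/=; ring.
Qed.

Let dF (xi : R) : is_derive xi 1 F (- (2 * pi) * \int[lambda]_x (x * g x * sin (2 * pi * x * xi))).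
Proof.
have I : [set` `]xi - 1, xi + 1[] xi by rewrite /= in_itv/=; apply/andP; split; lra.
have := @cvg_differentiation_under_integral R _ _ lambda
  (fun xi x => g x * cos (2 * pi * x * xi)) setT measurableT xi _ _ I
  (fun xi _ => lgc xi).
move=> /(_ _ (fun x => 2 * pi * gauss x)) cv.
have dE x y : partial1of2 (fun xi x => g x * cos (2 * pi * x * xi)) x y =
  - (2 * pi) * (y * g y * sin (2 * pi * y * x)).
  by rewrite partial1of2E; case: (dcosxi y x).
have cv2 : h^-1 *: (F (h + xi) - F xi) @[h --> 0^'] -->
   - (2 * pi) * \int[lambda]_x (x * g x * sin (2 * pi * x * xi)).
  rewrite -RintegralZl//; last exact: lxgs.
  have -> : \int[lambda]_x (- (2 * pi) * (x * g x * sin (2 * pi * x * xi))) =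
      \int[lambda]_x partial1of2 (fun xi x => g x * cos (2 * pi * x * xi)) xi x.
    by apply: eq_Rintegral => x _; rewrite dE.
  apply: cv => //.
  - by move=> y; rewrite mulr_ge0 ?gauss_fun_ge0// mulr_ge0// pi_ge0.
  - by have := L1Z (2 * pi) (@integrableT_gauss R).
  - move=> x y _ _; rewrite dE normrM normrN (@ger0_norm _ (2 * pi)) ?mulr_ge0 ?pi_ge0//.
    rewrite ler_wpM2l ?mulr_ge0 ?pi_ge0// normrM (le_trans _ (xg_le y))//.
    by rewrite ler_piMr// sin_bound.
apply: DeriveDef.
  by apply/cvg_ex; eexists; under eq_fun do rewrite scaler1; exact: cv2.
by rewrite -derive1E; apply/cvg_lim => //; exact: cv2.
Qed.

(** Integration by parts, in the form that the derivative of [g x * sin (2 * pi * x * xi)] has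
    integral zero. *)
Let ibp xi : \int[lambda]_x (x * g x * sin (2 * pi * x * xi)) = xi * F xi.
Proof.
have dh (x : R) : is_derive x 1 (fun x => g x * sin (2 * pi * x * xi))
   (- (2 * pi) * (x * g x * sin (2 * pi * x * xi)) +
     2 * pi * xi * (g x * cos (2 * pi * x * xi))).
  rewrite /g; apply: is_derive_eq.
  by rewrite ?(scaler0, scale0r, addr0, add0r) /GRing.scale/=; ring.
have l1 : L1 lambda (fun x => - (2 * pi) * (x * g x * sin (2 * pi * x * xi))).
  exact: L1Z.
have l2 : L1 lambda (fun x => 2 * pi * xi * (g x * cos (2 * pi * x * xi))).
  exact: L1Z.
have := @Rintegral_derive_eq0 _ _ dh.
rewrite (RintegralD _ l1 l2)// (RintegralZl _ _ (lxgs xi))// (RintegralZl _ _ (lgc xi))//.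
move=> /(_ _ (L1D l1 l2)) h.
have h3 : - (2 * pi) * \int[lambda]_x (x * g x * sin (2 * pi * x * xi)) +
   2 * pi * xi * F xi = 0.
  apply: h.
  - have cg : continuous g.
      move=> y; apply: continuous_comp; last exact: continuous_expR.
      apply: cvgN; apply: cvgM; first exact: cvg_cst.
      exact: exprn_continuous.
    have ca : continuous (fun y => 2 * pi * y * xi : R).
      move=> y; apply: cvgM; last exact: cvg_cst.
      by apply: cvgM; [exact: cvg_cst|exact: cvg_id].
    move=> y; apply: cvgD; apply: cvgM; try exact: cvg_cst.
      apply: cvgM; first by apply: cvgM; [exact: cvg_id|exact: cg].
      by apply: continuous_comp; [exact: ca|exact: continuous_sin].
    apply: cvgM; first exact: cg.
    by apply: continuous_comp; [exact: ca|exact: continuous_cos].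
  - have hg : g n%:R @[n --> \oo] --> 0.
      have c1 : gauss n%:R @[n --> \oo] --> (0 : R).
        by apply: (cvg_comp _ _ (@cvgr_idn R)); exact: cvg_gauss_fun.
      apply: (@squeeze_cvgr _ _ _ _ (cst 0) (fun n => gauss n%:R)) => //; last exact: cvg_cst.
      near=> n; rewrite expR_ge0/= /g /gauss_fun ler_expR lerN2 ler_peMl ?sqr_ge0//.
      by rewrite (le_trans _ (@pi_ge2 R))// ler1n.
    apply: (@squeeze_cvgr _ _ _ _ (fun n => - (2 * g n%:R)) (fun n => 2 * g n%:R)).
    + near=> n; rewrite -ler_norml (le_trans (ler_normB _ _))//.
      rewrite !normrM /g sqrrN !(ger0_norm (expR_ge0 _)).
      by rewrite [leRHS]mulr_natl [leRHS]mulr2n lerD// ler_piMr ?expR_ge0 ?sin_bound.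
    + by rewrite -oppr0 -(mulr0 2); apply: cvgN; apply: cvgM => //; exact: cvg_cst.
    + by rewrite -(mulr0 2); apply: cvgM => //; exact: cvg_cst.
have pi0 : (pi : R) != 0 by rewrite gt_eqF// pi_gt0.
by apply: (mulfI pi0); lra.
Unshelve. all: by end_near. Qed.

(** By [dF] and [ibp] the transform [F] solves F' = - 2 pi xi F. Hence F(xi) exp(pi xi^2) is
    constant, and F(0) = 1 is the Gaussian integral. *)
Lemma fourier_gauss_line xi : 
  \int[lambda]_x (g x * cos (2 * pi * x * xi)) = g xi.
Proof.
pose P x := F x * expR (pi * x ^+ 2).
have dP (x : R) : is_derive x 1 P 0.
  have d1 := dF x; rewrite /P; apply: is_derive_eq.
  rewrite ibp ?(scaler0, scale0r, addr0, add0r) /GRing.scale/=; ring.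
have := is_derive_0_is_cst xi 0 dP; rewrite /P expr0n mulr0 expR0 mulr1.
have -> : F 0 = 1.
  rewrite /F; under eq_Rintegral do rewrite mulr0 cos0 mulr1.
  by rewrite /Rintegral integral_gauss_pi.
have e0 : expR (pi * xi ^+ 2) != 0 :> R by rewrite gt_eqF// expR_gt0.
by move=> h; rewrite -/(F xi) /g expRN; apply: (mulIf e0); rewrite mulVf.
Qed.

End gauss_line.

(** * Euclidean spaces *)

Section change_of_variables.
Context d (T : measurableType d) (R : realType).
Variables (mu : {measure set T -> \bar R}) (s : T -> T) (k : R).
Hypothesis ms : measurable_fun setT s.
Hypothesis k_ge0 : 0 <= k.
Hypothesis scov : forall phi : T -> \bar R, measurable_fun setT phi ->
  (forall x, 0 <= phi x)%E -> (\int[mu]_x phi (s x) = k%:E * \int[mu]_x phi x)%E.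

Lemma L1_comp (f : T -> R) : L1 mu f -> L1 mu (f \o s).
Proof.
move=> lf; have mf := L1_measurable lf.
apply/L1P; first exact: measurableT_comp.
rewrite (scov (phi := fun x => `|f x|%:E))//.
  by apply: lte_mul_pinfty => //; exact/L1P.
by apply/measurable_EFinP; exact: measurableT_comp.
Qed.

(** The formula for nonnegative functions is applied to both parts of [f]; their integrals are
    finite, so [k] distributes over the difference. *)
Lemma Rintegral_comp (f : T -> R) : L1 mu f ->
  \int[mu]_x f (s x) = k * \int[mu]_x f x.
Proof.
move=> lf; apply: EFin_inj; rewrite EFinM !Rintegral_EFin//; last exact: L1_comp.
have mf : measurable_fun setT (EFin \o f) by exact: measurable_int lf.
rewrite integralE [in RHS]integralE.
have := scov (measurable_funepos mf) (funepos_ge0 (EFin \o f)).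
have := scov (measurable_funeneg mf) (funeneg_ge0 (EFin \o f)).
have -> : (\int[mu]_x (EFin \o f)^\+ (s x) = \int[mu]_x (fun x => (f (s x))%:E)^\+ x)%E.
  by apply: eq_integral => x _; rewrite unlock.
have -> : (\int[mu]_x (EFin \o f)^\- (s x) = \int[mu]_x (fun x => (f (s x))%:E)^\- x)%E.
  by apply: eq_integral => x _; rewrite unlock.
move=> -> ->; rewrite -muleBr//.
have := integrable_funepos measurableT lf; have := integrable_funeneg measurableT lf.
move=> /(integrable_fin_num measurableT) l1 /(integrable_fin_num measurableT) l2.
by rewrite fin_num_adde_defr.
Qed.

End change_of_variables.

(* All that is used of Lebesgue measure on R^dim: this is stable under products, hence
   holds for [haar]. *)
Record euclid d (T : measurableType d) (R : realType)
    (mu : {sigma_finite_measure set T -> \bar R}) (add : T -> T -> T)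
    (scl : R -> T -> T) (ip : T -> T -> R) (dim : nat) : Prop := Euclid {
  eu_madd : measurable_fun setT (fun z : T * T => add z.1 z.2);
  eu_mscl : forall c, measurable_fun setT (scl c);
  eu_mip : measurable_fun setT (fun z : T * T => ip z.1 z.2);
  eu_ipC : forall x y, ip x y = ip y x;
  eu_ipD : forall x y z, ip (add x y) z = ip x z + ip y z;
  eu_ipZ : forall c x y, ip (scl c x) y = c * ip x y;
  eu_ip_ge0 : forall x, 0 <= ip x x;
  eu_trans : forall (b : T) (phi : T -> \bar R), measurable_fun setT phi ->
    (forall x, 0 <= phi x)%E -> (\int[mu]_x phi (add x b) = \int[mu]_x phi x)%E;
  eu_scale : forall (c : R) (phi : T -> \bar R), c != 0 ->
    measurable_fun setT phi -> (forall x, 0 <= phi x)%E ->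
    (\int[mu]_x phi (scl c x) = ((`|c| ^+ dim)^-1)%:E * \int[mu]_x phi x)%E;
  eu_gauss1 : (\int[mu]_x (expR (- (pi * ip x x)))%:E = 1)%E;
  eu_gauss : forall xi, \int[mu]_x (expR (- (pi * ip x x)) * cos (2 * pi * ip x xi))
    = expR (- (pi * ip xi xi));
  (* Sets without boundary mass: dilating towards [x] stays on the side of [x]. *)
  eu_pi : exists Pi : set (set T), [/\ Pi setT, setI_closed Pi,
    Pi `<=` measurable, measurable `<=` <<s Pi >> & forall K, Pi K ->
    {ae mu, forall x, forall z, \forall k \near \oo,
      K (add (scl (k.+1%:R^-1) z) x) <-> K x}] }.

Section euclid_line.
Variable R : realType.
Local Notation RT := (measurableTypeR R).

Lemma euclid_line : @euclid _ RT R (@lebesgue_measure R) +%R *%R *%R 1.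
Proof.
split.
- by apply: measurable_funD.
- by move=> c; exact: measurable_funM.
- by apply: measurable_funM.
- exact: mulrC.
- by move=> x y z; exact: mulrDl.
- by move=> c x y; rewrite mulrA.
- by move=> x; rewrite -expr2 sqr_ge0.
- move=> b phi mphi phi0.
  have := @ge0_integral_affine R 1 b phi (oner_neq0 _) mphi phi0.
  rewrite normr1 invr1 mul1e => <-.
  by apply: eq_integral => x _; rewrite /affine mul1r.
- move=> c phi c0 mphi phi0.
  have := @ge0_integral_affine R c 0 phi c0 mphi phi0.
  rewrite expr1 => <-.
  by apply: eq_integral => x _; rewrite /affine addr0.
- by under eq_integral do rewrite -expr2; exact: integral_gauss_pi.
- move=> xi; rewrite -expr2 -fourier_gauss_line; apply: eq_Rintegral => x _.
  by rewrite -expr2 mulrA.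
(* Open half-lines generate the Borel sets, and each has a single boundary point. A point off the
   boundary keeps its side under small displacements. *)
- exists [set K | K = setT \/ exists b, K = [set` `]-oo, b[]]; split.
  + by left.
  + move=> A B [->|[b ->]]; first by rewrite setTI.
    move=> [->|[c ->]]; first by rewrite setIT; right; exists b.
    right; exists (Num.min b c); apply/seteqP; split=> x /=; rewrite !in_itv/= lt_min.
      by move=> [-> ->].
    by move=> /andP[-> ->].
  + by move=> A [->//|[b ->]]; exact: measurable_itv.
  + move=> A mA.
    have : (@RGenInftyO.G R).-sigma.-measurable A.
      by rewrite -RGenInftyO.measurableE.
    by apply: sub_sigma_algebra2 => B [b ->]; right; exists b.
  + move=> K [->|[b ->]]; first by apply: aeW => x z; near=> k.
    exists [set b]; split; [exact: measurable_set1|exact: lebesgue_measure_set1|].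
    move=> x /= h; apply: contrapT => xb; apply: h => z.
    have c : k.+1%:R^-1 * z + x @[k --> \oo] --> 0 * z + x.
      by apply: cvgD; [apply: cvgM; [exact: cvg_harmonic|exact: cvg_cst]|exact: cvg_cst].
    rewrite mul0r add0r in c.
    have [xlt|xgt|//] := ltgtP x b.
    * near=> k; rewrite !in_itv/= xlt; split => // _.
      by near: k; exact: (cvgr_lt _ c).
    * near=> k; rewrite !in_itv/= [x < b]ltNge (ltW xgt)/=; split => //.
      rewrite ltNge ltW//=.
      by near: k; exact: (cvgr_gt _ c).
Unshelve. all: by end_near. Qed.

End euclid_line.

Section euclid_theory.
Context d (T : measurableType d) (R : realType).
Variables (mu : {sigma_finite_measure set T -> \bar R}).
Variables (add : T -> T -> T) (scl : R -> T -> T) (ip : T -> T -> R) (dim : nat).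
Hypothesis eu : euclid mu add scl ip dim.
Implicit Types x y z : T.

Lemma eu_ipDr x y z : ip z (add x y) = ip z x + ip z y.
Proof. by rewrite !(eu_ipC eu z) (eu_ipD eu). Qed.

Lemma eu_ipZr c x y : ip y (scl c x) = c * ip y x.
Proof. by rewrite !(eu_ipC eu y) (eu_ipZ eu). Qed.

Lemma measurable_sq : measurable_fun setT (fun x => ip x x).
Proof.
apply: (measurableT_comp (eu_mip eu)
  (measurable_fun_pair (@measurable_id _ _ setT) (@measurable_id _ _ setT))).
Qed.

Lemma measurable_ip1 y : measurable_fun setT (ip y).
Proof. exact: measurableT_comp (eu_mip eu) (measurable_pair1 y). Qed.

Lemma measurable_ip2 y : measurable_fun setT (ip^~ y).
Proof. by under eq_fun do rewrite (eu_ipC eu); exact: measurable_ip1. Qed.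

Definition gaussian x : R := expR (- (pi * ip x x)).

Lemma measurable_gaussian : measurable_fun setT gaussian.
Proof.
apply: measurableT_comp => //; apply: measurableT_comp => //.
by apply: measurable_funM => //; exact: measurable_sq.
Qed.

Lemma L1_gaussian : L1 mu gaussian.
Proof.
apply/L1_ge0P; [exact: measurable_gaussian|by move=> x; exact: expR_ge0|].
by rewrite (eu_gauss1 eu) ltry.
Qed.

Lemma Rintegral_gaussian : \int[mu]_x gaussian x = 1.
Proof. by rewrite /Rintegral (eu_gauss1 eu). Qed.

Lemma scale_factor_ge0 (c : R) : 0 <= (`|c| ^+ dim)^-1.
Proof. by rewrite invr_ge0 exprn_ge0. Qed.

Lemma L1_scale c (f : T -> R) : c != 0 -> L1 mu f -> L1 mu (fun x => f (scl c x)).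
Proof.
move=> c0 lf; apply: (L1_comp (eu_mscl eu c) (scale_factor_ge0 c)) => //.
by move=> phi; exact: (eu_scale eu).
Qed.

Lemma Rintegral_scale c (f : T -> R) : c != 0 -> L1 mu f ->
  \int[mu]_x f (scl c x) = (`|c| ^+ dim)^-1 * \int[mu]_x f x.
Proof.
move=> c0 lf; apply: (Rintegral_comp (eu_mscl eu c) (scale_factor_ge0 c)) => //.
by move=> phi; exact: (eu_scale eu).
Qed.

Lemma measurable_trans b : measurable_fun setT (add^~ b).
Proof. exact: measurableT_comp (eu_madd eu) (measurable_pair2 b). Qed.

Lemma L1_trans b (f : T -> R) : L1 mu f -> L1 mu (fun x => f (add x b)).
Proof.
move=> lf; apply: (@L1_comp _ _ _ _ _ 1 (measurable_trans b)) => //.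
by move=> phi mphi phi0; rewrite mul1e; exact: (eu_trans eu).
Qed.

Lemma Rintegral_trans b (f : T -> R) : L1 mu f ->
  \int[mu]_x f (add x b) = \int[mu]_x f x.
Proof.
move=> lf; rewrite (@Rintegral_comp _ _ _ _ _ 1 (measurable_trans b)) ?mul1r//.
by move=> phi mphi phi0; rewrite mul1e; exact: (eu_trans eu).
Qed.

Lemma L1_gaussian_cos z : L1 mu (fun x => gaussian x * cos (2 * pi * ip x z)).
Proof.
apply: (@L1_bounded _ _ _ _ 1 _ _ L1_gaussian); last by move=> x; exact: cos_bound.
apply: measurableT_comp; first exact: measurable_cos.
by apply: measurable_funM => //; exact: measurable_ip2.
Qed.

Lemma L1_gaussian_sin z : L1 mu (fun x => gaussian x * sin (2 * pi * ip x z)).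
Proof.
apply: (@L1_bounded _ _ _ _ 1 _ _ L1_gaussian); last by move=> x; exact: sin_bound.
apply: measurableT_comp; first exact: measurable_sin.
by apply: measurable_funM => //; exact: measurable_ip2.
Qed.

(** The integrand is odd: the substitution of [scl (-1) x] changes its sign and preserves the
    integral. *)
Lemma Rintegral_gaussian_sin z :
  \int[mu]_x (gaussian x * sin (2 * pi * ip x z)) = 0.
Proof.
have N1 : -1 != 0 :> R by rewrite oppr_eq0 oner_eq0.
have := Rintegral_scale N1 (L1_gaussian_sin z).
rewrite normrN1 expr1n invr1 mul1r => h.
have : \int[mu]_x (gaussian (scl (-1) x) * sin (2 * pi * ip (scl (-1) x) z)) =
   - 1 * \int[mu]_x (gaussian x * sin (2 * pi * ip x z)).
  rewrite -RintegralZl//; last exact: L1_gaussian_sin.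
  apply: eq_Rintegral => x _; rewrite /gaussian !(eu_ipZ eu) eu_ipZr.
  by rewrite !mulN1r opprK mulrN sinN mulrN.
by rewrite h; lra.
Qed.

End euclid_theory.

Section euclid_prod.
Context d1 d2 (T1 : measurableType d1) (T2 : measurableType d2) (R : realType).
Variables (m1 : {sigma_finite_measure set T1 -> \bar R}).
Variables (add1 : T1 -> T1 -> T1) (scl1 : R -> T1 -> T1) (ip1 : T1 -> T1 -> R).
Variables (m2 : {sigma_finite_measure set T2 -> \bar R}).
Variables (add2 : T2 -> T2 -> T2) (scl2 : R -> T2 -> T2) (ip2 : T2 -> T2 -> R).
Variables n1 n2 : nat.
Hypothesis eu1 : euclid m1 add1 scl1 ip1 n1.
Hypothesis eu2 : euclid m2 add2 scl2 ip2 n2.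
Implicit Types z : T1 * T2.

Let add z z' := (add1 z.1 z'.1, add2 z.2 z'.2).
Let scl c z := (scl1 c z.1, scl2 c z.2).
Let ip z z' := ip1 z.1 z'.1 + ip2 z.2 z'.2.

Lemma Rintegral_prod_mul (f : T1 -> R) (g : T2 -> R) : L1 m1 f -> L1 m2 g ->
  \int[sigma_product m1 m2]_z (f z.1 * g z.2) = \int[m1]_x f x * \int[m2]_y g y.
Proof.
move=> lf lg; rewrite Rfubini1/=.
  rewrite -RintegralZr//; apply: eq_Rintegral => x _.
  by rewrite -RintegralZl.
apply: (L1_prod _ (L1_norm lf) (L1_norm lg)).
  apply: measurable_funM.
  - exact: measurableT_comp (L1_measurable lf) measurable_fst.
  - exact: measurableT_comp (L1_measurable lg) measurable_snd.
by move=> x y /=; rewrite normrM.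
Qed.

Lemma L1_prod_mul (f : T1 -> R) (g : T2 -> R) : L1 m1 f -> L1 m2 g ->
  L1 (sigma_product m1 m2) (fun z => f z.1 * g z.2).
Proof.
move=> lf lg; apply: (L1_prod _ (L1_norm lf) (L1_norm lg)).
  apply: measurable_funM.
  - exact: measurableT_comp (L1_measurable lf) measurable_fst.
  - exact: measurableT_comp (L1_measurable lg) measurable_snd.
by move=> x y /=; rewrite normrM.
Qed.

Let gaussE z : expR (- (pi * ip z z)) = gaussian ip1 z.1 * gaussian ip2 z.2 :> R.
Proof. by rewrite /gaussian -expRD; congr expR; rewrite /ip; ring. Qed.

(** Tonelli, with the two substitutions made one coordinate at a time. *)
Let prod_cov (s1 : T1 -> T1) (s2 : T2 -> T2) (k1 k2 : R) (phi : T1 * T2 -> \bar R) :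
  0 <= k1 -> 0 <= k2 -> measurable_fun setT s1 -> measurable_fun setT s2 ->
  (forall phi : T1 -> \bar R, measurable_fun setT phi ->
  (forall x, 0 <= phi x)%E -> (\int[m1]_x phi (s1 x) = k1%:E * \int[m1]_x phi x)%E) ->
  (forall phi : T2 -> \bar R, measurable_fun setT phi ->
  (forall x, 0 <= phi x)%E -> (\int[m2]_x phi (s2 x) = k2%:E * \int[m2]_x phi x)%E) ->
  measurable_fun setT phi -> (forall x, 0 <= phi x)%E ->
  (\int[sigma_product m1 m2]_z phi (s1 z.1, s2 z.2) =
   (k1 * k2)%:E * \int[sigma_product m1 m2]_z phi z)%E.
Proof.
move=> k1_ge0 k2_ge0 ms1 ms2 h1 h2 mphi phi0.
have ms : measurable_fun setT (fun z : T1 * T2 => (s1 z.1, s2 z.2)).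
  apply: measurable_fun_pair; first exact: measurableT_comp ms1 measurable_fst.
  exact: measurableT_comp ms2 measurable_snd.
rewrite /sigma_product (fubini_tonelli1 (fun z => phi (s1 z.1, s2 z.2)))//=; last first.
  exact: measurableT_comp mphi ms.
rewrite (fubini_tonelli1 phi)// /fubini_F/=.
pose Phi x := (\int[m2]_y phi (x, y))%E.
have mPhi : measurable_fun setT Phi by exact: measurable_fun_fubini_tonelli_F.
have Phi0 x : (0 <= Phi x)%E by exact: integral_ge0.
under eq_integral.
  move=> x _; rewrite (h2 (fun y => phi (s1 x, y)))//; last first.
    exact: measurableT_comp mphi (measurable_pair1 _).
  over.
rewrite ge0_integralZl//=; last 2 first.
  - exact: measurableT_comp mPhi ms1.
  - by move=> x _; exact: Phi0.
by rewrite (h1 Phi)// muleA -EFinM mulrC.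
Qed.

Lemma euclid_prod : euclid (sigma_product m1 m2) add scl ip (n1 + n2).
Proof.
have m11 : measurable_fun setT (fun z : (T1 * T2) * (T1 * T2) => (z.1.1, z.2.1)).
  apply: measurable_fun_pair.
  - exact: measurableT_comp measurable_fst measurable_fst.
  - exact: measurableT_comp measurable_fst measurable_snd.
have m22 : measurable_fun setT (fun z : (T1 * T2) * (T1 * T2) => (z.1.2, z.2.2)).
  apply: measurable_fun_pair.
  - exact: measurableT_comp measurable_snd measurable_fst.
  - exact: measurableT_comp measurable_snd measurable_snd.
split.
- apply: measurable_fun_pair.
  + exact: measurableT_comp (eu_madd eu1) m11.
  + exact: measurableT_comp (eu_madd eu2) m22.
- move=> c; apply: measurable_fun_pair.
  + exact: measurableT_comp (eu_mscl eu1 c) measurable_fst.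
  + exact: measurableT_comp (eu_mscl eu2 c) measurable_snd.
- apply: measurable_funD.
  + exact: measurableT_comp (eu_mip eu1) m11.
  + exact: measurableT_comp (eu_mip eu2) m22.
- by move=> x y; rewrite /ip (eu_ipC eu1) (eu_ipC eu2).
- by move=> x y z; rewrite /ip (eu_ipD eu1) (eu_ipD eu2) addrACA.
- by move=> c x y; rewrite /ip (eu_ipZ eu1) (eu_ipZ eu2) mulrDr.
- by move=> x; rewrite addr_ge0// ?(eu_ip_ge0 eu1)// (eu_ip_ge0 eu2).
- move=> b phi mphi phi0.
  have := @prod_cov (add1^~ b.1) (add2^~ b.2) 1 1 phi ler01 ler01
    (measurable_trans eu1 _) (measurable_trans eu2 _).
  rewrite mulr1 mul1e; apply => //.
  + by move=> ? ? ?; rewrite mul1e; exact: (eu_trans eu1).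
  + by move=> ? ? ?; rewrite mul1e; exact: (eu_trans eu2).
- move=> c phi c0 mphi phi0.
  rewrite exprD invfM.
  apply: prod_cov => //; rewrite ?invr_ge0 ?exprn_ge0//.
  + exact: (eu_mscl eu1).
  + exact: (eu_mscl eu2).
  + by move=> ? ? ?; exact: (eu_scale eu1).
  + by move=> ? ? ?; exact: (eu_scale eu2).
- under eq_integral do rewrite gaussE.
  have l12 := L1_prod_mul (L1_gaussian eu1) (L1_gaussian eu2).
  rewrite -(Rintegral_EFin l12).
  rewrite (Rintegral_prod_mul (L1_gaussian eu1) (L1_gaussian eu2)).
  by rewrite (Rintegral_gaussian eu1) (Rintegral_gaussian eu2) mulr1.
- move=> xi; rewrite gaussE.
  have c1 := L1_gaussian_cos eu1 xi.1; have c2 := L1_gaussian_cos eu2 xi.2.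
  have s1 := L1_gaussian_sin eu1 xi.1; have s2 := L1_gaussian_sin eu2 xi.2.
  (* The addition formula for the cosine. The product of sines contributes nothing, since each sine
     integral vanishes by oddness. *)
  transitivity (\int[sigma_product m1 m2]_z (
    (gaussian ip1 z.1 * cos (2 * pi * ip1 z.1 xi.1)) *
    (gaussian ip2 z.2 * cos (2 * pi * ip2 z.2 xi.2)) -
    (gaussian ip1 z.1 * sin (2 * pi * ip1 z.1 xi.1)) *
    (gaussian ip2 z.2 * sin (2 * pi * ip2 z.2 xi.2)))).
    by apply: eq_Rintegral => z _; rewrite gaussE /ip mulrDr cosD; ring.
  rewrite (RintegralB _ (L1_prod_mul c1 c2) (L1_prod_mul s1 s2))//.
  rewrite (Rintegral_prod_mul c1 c2) (Rintegral_prod_mul s1 s2) (Rintegral_gaussian_sin eu1) mul0r subr0.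
  by rewrite (eu_gauss eu1) (eu_gauss eu2).
- have [Pi1 [T_1 I1 M1 G1 N1]] := eu_pi eu1.
  have [Pi2 [T_2 I2 M2 G2 N2]] := eu_pi eu2.
  (* Products of sets of the two families: a point is exceptional only if one of its coordinates is,
     so the exceptional set lies in two null cylinders. *)
  exists [set A `*` B | A in Pi1 & B in Pi2]; split.
  + by exists setT => //; exists setT => //; rewrite setXTT.
  + move=> _ _ [A PA] [B PB] <- [A' PA'] [B' PB'] <-.
    exists (A `&` A'); first exact: I1.
    exists (B `&` B'); first exact: I2.
    by rewrite setXI.
  + move=> _ [A PA] [B PB] <-; apply: measurableX; [exact: M1|exact: M2].
  + set S := <<s _ >>.
    have sS : sigma_algebra setT S by exact: smallest_sigma_algebra.
    (* The sets whose cylinder lies in [S] form a sigma-algebra containing [Pi1]; rectangles are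
       then intersections of two cylinders. *)
    have h1 A : measurable A -> S (A `*` setT).
      move=> /G1; apply: (@smallest_sub _ _ Pi1 [set A | S (A `*` setT)]).
        split => /=.
        - by rewrite set0X; case: sS.
        - move=> B SB; rewrite (_ : _ `*` _ = setT `\` (B `*` setT)).
            by case: sS => _ + _; apply.
          by apply/seteqP; split => -[x y] /=; tauto.
        - move=> F SF; rewrite (_ : _ `*` _ = \bigcup_k (F k `*` setT)).
            by case: sS => _ _; apply.
          apply/seteqP; split => -[x y] /=; first by move=> [[k _ ?] _]; exists k.
          by move=> [k _ [? _]]; split => //; exists k.
      by move=> B PB /=; apply: sub_sigma_algebra; exists B => //; exists setT.
    have h2 A : measurable A -> S (setT `*` A).
      move=> /G2; apply: (@smallest_sub _ _ Pi2 [set A | S (setT `*` A)]).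
        split => /=.
        - by rewrite setX0; case: sS.
        - move=> B SB; rewrite (_ : _ `*` _ = setT `\` (setT `*` B)).
            by case: sS => _ + _; apply.
          by apply/seteqP; split => -[x y] /=; tauto.
        - move=> F SF; rewrite (_ : _ `*` _ = \bigcup_k (setT `*` F k)).
            by case: sS => _ _; apply.
          apply/seteqP; split => -[x y] /=; first by move=> [_ [k _ ?]]; exists k.
          by move=> [k _ [_ ?]]; split => //; exists k.
      by move=> B PB /=; apply: sub_sigma_algebra; exists setT => //; exists B.
    rewrite measurable_prod_measurableType; apply: smallest_sub => //.
    move=> _ [A mA] [B mB] <-.
    rewrite (_ : A `*` B = (A `*` setT) `&` (setT `*` B)); last first.
      by rewrite -setXI setIT setTI.
    apply: (@measurableI _ (g_sigma_algebraType [set A `*` B | A in Pi1 & B in Pi2])).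
      exact: h1.
    exact: h2.
  + move=> _ [A PA] [B PB] <-.
    have [S1 [mS1 S10 sS1]] := N1 _ PA; have [S2 [mS2 S20 sS2]] := N2 _ PB.
    exists ((S1 `*` setT) `|` (setT `*` S2)); split.
    * by apply: measurableU; exact: measurableX.
    * rewrite null_set_setU//; try exact: measurableX.
      (* [m2 setT] may be infinite: the convention that zero times infinity is zero is used here. *)
      - transitivity (m1 S1 * m2 setT)%E; first exact: product_measure1E.
        by rewrite S10 mul0e.
      - transitivity (m1 setT * m2 S2)%E; first exact: product_measure1E.
        by rewrite S20 mule0.
    * move=> [x y] /=; apply: contra_notP => /not_orP[nx ny] z.
      have {}nx : ~ S1 x by move=> ?; apply: nx.
      have {}ny : ~ S2 y by move=> ?; apply: ny.
      have hx : forall z1 : T1, \forall k \near \oo, A (add1 (scl1 (k.+1%:R^-1) z1) x) <-> A x.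
        by apply: contrapT => h; apply: nx; exact: sS1.
      have hy : forall z2 : T2, \forall k \near \oo, B (add2 (scl2 (k.+1%:R^-1) z2) y) <-> B y.
        by apply: contrapT => h; apply: ny; exact: sS2.
      move: (hx z.1) (hy z.2); apply: filterS2 => k h1 h2.
      by split => -[/h1 ? /h2 ?].
Unshelve. all: by end_near. Qed.

End euclid_prod.

Section euclid_iso.
Context d1 d2 (T1 : measurableType d1) (T2 : measurableType d2) (R : realType).
Variables (m1 : {sigma_finite_measure set T1 -> \bar R}).
Variables (add1 : T1 -> T1 -> T1) (scl1 : R -> T1 -> T1) (ip1 : T1 -> T1 -> R).
Variables (m2 : {sigma_finite_measure set T2 -> \bar R}).
Variables (add2 : T2 -> T2 -> T2) (scl2 : R -> T2 -> T2) (ip2 : T2 -> T2 -> R).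
Variable n : nat.
Hypothesis eu1 : euclid m1 add1 scl1 ip1 n.
Variables (f : T1 -> T2) (g : T2 -> T1).
Hypothesis fK : cancel f g.
Hypothesis gK : cancel g f.
Hypothesis mf : measurable_fun setT f.
Hypothesis mg : measurable_fun setT g.
Hypothesis m2E : forall A, m2 A = m1 (f @^-1` A).
Hypothesis addE : forall x y, f (add1 x y) = add2 (f x) (f y).
Hypothesis sclE : forall c x, f (scl1 c x) = scl2 c (f x).
Hypothesis ipE : forall x y, ip1 x y = ip2 (f x) (f y).

Let intE (phi : T2 -> \bar R) : measurable_fun setT phi ->
  (forall x, 0 <= phi x)%E -> (\int[m2]_x phi x = \int[m1]_x phi (f x))%E.
Proof.
move=> mphi phi0.
rewrite -[RHS](ge0_integral_pushforward mf m1 measurableT mphi)//.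
by apply: eq_measure_integral => A mA _; exact: m2E.
Qed.

Let L1E (phi : T2 -> R) : measurable_fun setT phi -> L1 m1 (phi \o f) ->
  \int[m2]_x phi x = \int[m1]_x phi (f x).
Proof.
move=> mphi l; rewrite /Rintegral; congr fine; rewrite integralE [in RHS]integralE.
have mp : measurable_fun setT (EFin \o phi) by exact/measurable_EFinP.
have -> : (\int[m1]_x (fun x => (phi (f x))%:E)^\+ x = \int[m1]_x (EFin \o phi)^\+ (f x))%E.
  by apply: eq_integral => x _; rewrite unlock.
have -> : (\int[m1]_x (fun x => (phi (f x))%:E)^\- x = \int[m1]_x (EFin \o phi)^\- (f x))%E.
  by apply: eq_integral => x _; rewrite unlock.
by congr (_ - _)%E; apply: intE => //;
  [exact: measurable_funepos|exact: measurable_funeneg].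
Qed.

Let mgg : measurable_fun setT (fun z : T2 * T2 => (g z.1, g z.2)).
Proof.
apply: measurable_fun_pair.
- exact: measurableT_comp mg measurable_fst.
- exact: measurableT_comp mg measurable_snd.
Qed.

(** Transport along a bijection that is linear, isometric, measurable in both directions and carries
    [m1] to [m2]. It will identify pairs of a head and a tail with tuples. *)
Lemma euclid_iso : euclid m2 add2 scl2 ip2 n.
Proof.
have m2add : measurable_fun setT (fun z : T2 * T2 => add2 z.1 z.2).
  rewrite (_ : (fun _ => _) = f \o (fun z => add1 z.1 z.2) \o (fun z : T2 * T2 => (g z.1, g z.2))).
    by apply: measurableT_comp mgg; exact: measurableT_comp mf (eu_madd eu1).
  by apply/funext => z /=; rewrite addE !gK.
have m2scl c : measurable_fun setT (scl2 c).
  rewrite (_ : scl2 c = f \o (scl1 c) \o g).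
    by apply: measurableT_comp mg; exact: measurableT_comp mf (eu_mscl eu1 c).
  by apply/funext => z /=; rewrite sclE !gK.
have m2ip : measurable_fun setT (fun z : T2 * T2 => ip2 z.1 z.2).
  rewrite (_ : (fun _ => _) = (fun z => ip1 z.1 z.2) \o (fun z : T2 * T2 => (g z.1, g z.2))).
    exact: measurableT_comp (eu_mip eu1) mgg.
  by apply/funext => z /=; rewrite ipE !gK.
have m2sq : measurable_fun setT (fun x => ip2 x x).
  exact: (measurableT_comp m2ip (measurable_fun_pair (@measurable_id _ _ setT) (@measurable_id _ _ setT))).
split => //.
- by move=> x y; rewrite -(gK x) -(gK y) -!ipE (eu_ipC eu1).
- by move=> x y z; rewrite -(gK x) -(gK y) -(gK z) -addE -!ipE (eu_ipD eu1).
- by move=> c x y; rewrite -(gK x) -(gK y) -sclE -!ipE (eu_ipZ eu1).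
- by move=> x; rewrite -(gK x) -!ipE (eu_ip_ge0 eu1).
- move=> b phi mphi phi0.
  rewrite intE//; last by exact: measurableT_comp mphi (measurableT_comp m2add (measurable_pair2 b)).
  rewrite [RHS]intE// -[RHS](@eu_trans _ _ _ _ _ _ _ _ eu1 (g b) (phi \o f) (measurableT_comp mphi mf))//;
    last by move=> x; exact: phi0.
  by apply: eq_integral => x _ /=; rewrite addE gK.
- move=> c phi c0 mphi phi0.
  rewrite intE//; last exact: measurableT_comp mphi (m2scl c).
  rewrite [in RHS]intE// -[RHS](@eu_scale _ _ _ _ _ _ _ _ eu1 c (phi \o f) c0 (measurableT_comp mphi mf))//;
    last by move=> x; exact: phi0.
  by apply: eq_integral => x _ /=; rewrite sclE.
- rewrite intE; last 2 first.
  + apply/measurable_EFinP; apply: measurableT_comp => //.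
    by apply: measurableT_comp => //; exact: measurable_funM.
  + by move=> x; rewrite lee_fin expR_ge0.
  by rewrite -(eu_gauss1 eu1); apply: eq_integral => x _; rewrite ipE.
- move=> xi; rewrite L1E.
  + rewrite -(gK xi) -ipE -(eu_gauss eu1); apply: eq_Rintegral => x _.
    by rewrite !ipE.
  + apply: measurable_funM.
      by apply: measurableT_comp => //; apply: measurableT_comp => //; exact: measurable_funM.
    apply: measurableT_comp; first exact: measurable_cos.
    by apply: measurable_funM => //; exact: measurableT_comp m2ip (measurable_pair2 xi).
  + apply: eq_L1 (L1_gaussian_cos eu1 (g xi)) => x /=.
    by rewrite /gaussian !ipE gK.
- have [Pi [T_ I_ M_ G_ N_]] := eu_pi eu1.
  exists [set A | Pi (f @^-1` A)]; split => /=.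
  + by rewrite preimage_setT.
  + by move=> A B /= PA PB; rewrite preimage_setI; exact: I_.
  + move=> A /= /M_ mA; rewrite (_ : A = g @^-1` (f @^-1` A)).
      by rewrite -[X in measurable X]setTI; exact: mg.
    by apply/seteqP; split => x /=; rewrite gK.
  + move=> A mA.
    have : measurable (f @^-1` A) by rewrite -[X in measurable X]setTI; exact: mf.
    move=> /G_; set S := <<s [set A | Pi (f @^-1` A)] >>.
    have sS : sigma_algebra setT S by exact: smallest_sigma_algebra.
    have e (B : set T2) : B = g @^-1` (f @^-1` B).
      by apply/seteqP; split => x /=; rewrite gK.
    have e' (B : set T1) : B = f @^-1` (g @^-1` B).
      by apply/seteqP; split => x /=; rewrite fK.
    rewrite [X in _ -> S X]e.
    apply: (@smallest_sub _ _ Pi [set B | S (g @^-1` B)]).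
      split => /=.
      - by rewrite preimage_set0; case: sS.
      - by move=> B SB; rewrite setTD preimage_setC -setTD; case: sS => _ + _; apply.
      - by move=> F SF; rewrite preimage_bigcup; case: sS => _ _; apply.
    by move=> B PB /=; apply: sub_sigma_algebra => /=; rewrite -e'.
  + move=> K /N_ [N [mN N0 sN]].
    exists (g @^-1` N); split.
    * by rewrite -[X in measurable X]setTI; exact: mg.
    * rewrite m2E (_ : _ @^-1` _ = N)//.
      by apply/seteqP; split => x /=; rewrite fK.
    * move=> x /= nx; apply: sN => /= h; apply: nx => z.
      have := h (g z); apply: filterS => k.
      by rewrite /= addE sclE !gK.
Qed.

End euclid_iso.

Section euclid_tuple.
Variable R : realType.
Local Notation RT := (measurableTypeR R).

Definition tscale n (c : R) (p : n.-tuple RT) : n.-tuple RT :=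
  [tuple c * tnth p i | i < n].

(** A single point of mass one: all sets are trivial, hence all functions measurable, and
    integration is evaluation at the point. *)
Lemma euclid_tuple0 :
  euclid (lebesgue_tuple R 0) (@tadd R 0) (@tscale 0) (@dot R 0) 0.
Proof.
have E (x y : 0.-tuple RT) : x = y by rewrite (tuple0 x) (tuple0 y).
have dot0 (x y : 0.-tuple RT) : dot x y = 0 by rewrite /dot big_ord0.
have mT d (T : measurableType d) (f : T -> 0.-tuple RT) : measurable_fun setT f.
  by rewrite (_ : f = cst [tuple])//; apply/funext => x; exact: E.
have SE (A : set (0.-tuple RT)) : A = set0 \/ A = setT.
  have [A0|nA] := pselect (A [tuple]).
    by right; apply/seteqP; split => // x _; rewrite (E x [tuple]).
  by left; apply/seteqP; split => // x; rewrite (E x [tuple]).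
have m0 (phi : 0.-tuple RT -> \bar R) : measurable_fun setT phi.
  by move=> _ B mB; rewrite setTI; case: (SE (phi @^-1` B)) => ->.
have int0 (phi : 0.-tuple RT -> \bar R) :
    (\int[lebesgue_tuple R 0]_x phi x = phi [tuple])%E.
  by rewrite /= (integral_dirac _ measurableT (m0 phi)) diracT mul1e.
split.
- exact: mT.
- by move=> c; exact: mT.
- rewrite (_ : (fun z => dot z.1 z.2) = cst 0); first exact: measurable_cst.
  by apply/funext => z; exact: dot0.
- by move=> x y; rewrite !dot0.
- by move=> x y z; rewrite !dot0 addr0.
- by move=> c x y; rewrite !dot0 mulr0.
- by move=> x; rewrite dot0.
- by move=> b phi mphi phi0; apply: eq_integral => x _; congr phi; exact: E.
- move=> c phi c0 mphi phi0; rewrite expr0 invr1 mul1e.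
  by apply: eq_integral => x _; congr phi; exact: E.
- by rewrite int0 dot0 mulr0 oppr0 expR0.
- by move=> xi; rewrite /Rintegral int0 !dot0 mulr0 oppr0 expR0 mulr0 cos0 mulr1.
- exists [set setT]; split => //.
  + by move=> A B -> ->; rewrite setTI.
  + by move=> A ->.
  + move=> A _; have sS : sigma_algebra setT <<s [set (@setT (0.-tuple RT))] >>.
      exact: smallest_sigma_algebra.
    case: (SE A) => ->; first by case: sS.
    exact: sub_sigma_algebra.
  + by move=> K ->; apply: aeW => x z; near=> k.
Unshelve. all: by end_near. Qed.

Lemma euclid_tuple n :
  euclid (lebesgue_tuple R n) (@tadd R n) (@tscale n) (@dot R n) n.
Proof.
elim: n => [|n IH]; first exact: euclid_tuple0.
have eu := euclid_prod (euclid_line R) IH.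
rewrite add1n in eu.
apply: (euclid_iso eu (f := @cons_pair R n) (g := @uncons R n)) => //.
- exact: cons_pairK.
- by move=> x; rewrite /cons_pair /uncons /=; apply: val_inj => /=; rewrite [in RHS](tuple_eta x).
- exact: measurable_cons_pair.
- exact: measurable_uncons.
- move=> x y; apply: eq_from_tnth => i; rewrite tnth_mktuple.
  case: (unliftP ord0 i) => [j ->|->].
    by rewrite !tnthS/= tnth_mktuple.
  by rewrite !tnth0.
- move=> c x; apply: eq_from_tnth => i; rewrite tnth_mktuple.
  case: (unliftP ord0 i) => [j ->|->].
    by rewrite !tnthS/= tnth_mktuple.
  by rewrite !tnth0.
- move=> x y; rewrite /dot big_ord_recl !tnth0; congr (_ + _).
  by apply: eq_bigr => i _; rewrite !tnthS.
Qed.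

(** The vector space addition underlying the group: the Fourier transform and the Gaussians refer to
    it, and not to [heis_mul]. *)
Definition hadd n (X Y : heis R n) : heis R n :=
  (tadd X.1.1 Y.1.1, tadd X.1.2 Y.1.2, X.2 + Y.2).

Definition hscale n c (X : heis R n) : heis R n :=
  (tscale c X.1.1, tscale c X.1.2, c * X.2).

Lemma euclid_heis n :
  euclid (haar R n) (@hadd n) (@hscale n) (@inner R n) (n + n + 1).
Proof.
exact: (euclid_prod (euclid_prod (euclid_tuple n) (euclid_tuple n)) (euclid_line R)).
Qed.

End euclid_tuple.

(** * Uniqueness of the Fourier transform *)

Section pi_lambda.
Context d (T : measurableType d) (R : realType).
Variables (mu : {measure set T -> \bar R}) (Pi : set (set T)) (h : T -> R).
Hypothesis lh : L1 mu h.

Let lh1 A : measurable A -> L1 mu (fun x => h x * \1_A x).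
Proof.
move=> mA; apply: (@L1_bounded _ _ _ _ 1) => //.
by move=> x; rewrite indicE; case: (_ \in _); rewrite ?normr1 ?normr0.
Qed.

(** The measurable sets over which [h] integrates to zero form a lambda-system, by linearity for
    differences and dominated convergence for increasing unions. It contains [Pi], hence every
    measurable set. *)
Lemma ae_eq0_pi_system : Pi setT -> setI_closed Pi -> Pi `<=` measurable ->
  measurable `<=` <<s Pi >> ->
  (forall A, Pi A -> \int[mu]_x (h x * \1_A x) = 0) ->
  {ae mu, forall x, h x = 0}.
Proof.
move=> PT PI Pm mP h0.
pose H := [set A | measurable A /\ \int[mu]_x (h x * \1_A x) = 0].
have hH : measurable `<=` H.
  move=> A /mP; apply: lambda_system_subset => //; last by move=> B PB; split; [exact: Pm|exact: h0].
  split => //.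
  - by split; [exact: measurableT|exact: h0].
  - move=> A0 B BA [mA A00] [mB B0]; split; first exact: measurableD.
    transitivity (\int[mu]_x (h x * \1_A0 x - h x * \1_B x)).
      apply: eq_Rintegral => x _; rewrite -mulrBr; congr (_ * _).
      rewrite !indicE in_setD; have [/set_mem xB|xB] := boolP (x \in B).
        by rewrite (mem_set (BA _ xB)) subrr.
      by rewrite andbT subr0.
    by rewrite (RintegralB _ (lh1 mA) (lh1 mB))// A00 B0 subrr.
  - move=> F ndF HF; have mF k : measurable (F k) by case: (HF k).
    have mU : measurable (\bigcup_k F k) by exact: bigcup_measurable.
    split => //.
    have [|||||_ c] := @cvg_Rintegral _ _ _ mu (fun k x => h x * \1_(F k) x)
      (fun x => h x * \1_(\bigcup_k F k) x) (fun x => `|h x|).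
    + by move=> k; exact: L1_measurable (lh1 (mF k)).
    + exact: L1_measurable (lh1 mU).
    + apply: aeW => x; apply: cvg_near_cst.
      have [[k _ Fkx]|nU] := pselect ((\bigcup_k F k) x).
        near=> j; rewrite !indicE !mem_set//; first by exists k.
        by move: Fkx; apply/subsetPset/ndF; near: j; exact: nbhs_infty_ge.
      near=> j; rewrite !indicE !memNset//.
      by move=> Fjx; apply: nU; exists j.
    + exact: L1_norm.
    + move=> k x; rewrite normrM ler_piMr// indicE.
      by case: (_ \in _); rewrite ?normr1 ?normr0.
    apply: (cvg_unique _ c) => //.
    rewrite (_ : (fun _ => _) = cst 0); first exact: cvg_cst.
    by apply/funext => k; case: (HF k).
have hae := @integral_ae_eq _ _ _ mu setT measurableT (cst 0%E) (EFin \o h) lh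
  (measurable_cst _).
suff : ae_eq mu setT (EFin \o h) (cst 0%E).
  move=> [N [mN N0 sN]]; exists N; split=> // x hx; apply: sN => /= e; apply: hx.
  by have [] := e I.
apply: hae => E _ mE; rewrite integral0 integral_mkcond; apply/esym.
have [_ e] := hH _ mE.
transitivity ((\int[mu]_x (h x * \1_E x))%:E); first by rewrite e.
rewrite (Rintegral_EFin (lh1 mE)); apply: eq_integral => x _; rewrite patchE indicE.
by case: ifPn => _ /=; rewrite ?mulr1 ?mulr0.
Unshelve. all: by end_near. Qed.

End pi_lambda.

Section heat_kernel.
Context d (T : measurableType d) (R : realType).
Variables (mu : {sigma_finite_measure set T -> \bar R}).
Variables (add : T -> T -> T) (scl : R -> T -> T) (ip : T -> T -> R) (dim : nat).
Hypothesis eu : euclid mu add scl ip dim.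
Implicit Types x y : T.

(** The squared distance |x - y|^2, multiplied out because [euclid] has no subtraction. *)
Definition sqdist x y : R := ip x x - 2 * ip x y + ip y y.

Lemma sqdistE x y : sqdist x y = ip (add x (scl (-1) y)) (add x (scl (-1) y)).
Proof.
rewrite /sqdist !(eu_ipD eu, eu_ipDr eu, eu_ipZ eu, eu_ipZr eu) (eu_ipC eu y x); ring.
Qed.

Lemma sqdistC x y : sqdist x y = sqdist y x.
Proof. by rewrite /sqdist (eu_ipC eu x y); ring. Qed.

Lemma measurable_sqdist : measurable_fun setT (fun z : T * T => sqdist z.1 z.2).
Proof.
apply: measurable_funD; first apply: measurable_funB.
- exact: measurableT_comp (measurable_sq eu) measurable_fst.
- by apply: measurable_funM => //; exact: eu_mip eu.
- exact: measurableT_comp (measurable_sq eu) measurable_snd.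
Qed.

(** The heat kernel at a time proportional to c^-2, normalized to have maximum 1; its mass is then
    |c|^(-dim). *)
Definition heat (c : R) x y : R := expR (- (pi * c ^+ 2 * sqdist x y)).

Lemma heatC c x y : heat c x y = heat c y x.
Proof. by rewrite /heat sqdistC. Qed.

Lemma heat_ge0 c x y : 0 <= heat c x y. Proof. exact: expR_ge0. Qed.

Lemma heat_le1 c x y : heat c x y <= 1.
Proof.
rewrite -expR0 ler_expR oppr_le0; apply: mulr_ge0.
  by rewrite mulr_ge0 ?pi_ge0 ?sqr_ge0.
by rewrite sqdistE (eu_ip_ge0 eu).
Qed.

Lemma measurable_heat c : measurable_fun setT (fun z : T * T => heat c z.1 z.2).
Proof.
apply: measurableT_comp => //; apply: measurableT_comp => //.
by apply: measurable_funM => //; exact: measurable_sqdist.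
Qed.

Lemma heat_gaussian c x y :
  heat c y x = gaussian ip (scl c (add y (scl (-1) x))).
Proof.
rewrite /heat /gaussian !(eu_ipZ eu, eu_ipZr eu) -sqdistE; congr (expR (- _)).
by ring.
Qed.

Lemma L1_heat c x : c != 0 -> L1 mu (heat c ^~ x).
Proof.
move=> c0.
have := L1_trans eu (scl (-1) x) (L1_scale eu c0 (L1_gaussian eu)).
by apply: eq_L1 => y; rewrite heat_gaussian.
Qed.

Lemma Rintegral_heat c x : c != 0 -> \int[mu]_y heat c y x = (`|c| ^+ dim)^-1.
Proof.
move=> c0; under eq_Rintegral do rewrite heat_gaussian.
rewrite (Rintegral_trans eu (scl (-1) x) (L1_scale eu c0 (L1_gaussian eu))).
by rewrite (Rintegral_scale eu c0 (L1_gaussian eu)) (Rintegral_gaussian eu) mulr1.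
Qed.

(** Magnifying by [c] around [x] turns every kernel centred at [x] into the same Gaussian, which
    serves as a dominating function for all [c] at once. *)
Lemma heat_dilate c x z : c != 0 -> heat c (add (scl c^-1 z) x) x = gaussian ip z.
Proof.
move=> c0; rewrite /heat /gaussian; congr (expR (- _)); rewrite /sqdist.
rewrite !(eu_ipD eu, eu_ipDr eu, eu_ipZ eu, eu_ipZr eu) (eu_ipC eu x z).
by field.
Qed.

(** Justifies exchanges of integrals: integrating first in [z.2] leaves [h] times the mass of the
    kernel, which does not depend on [z.1]. *)
Lemma L1_heat2 (c : R) (h : T -> R) (b : (T * T)%type -> R) (M : R) : c != 0 -> L1 mu h ->
  measurable_fun setT b -> (forall z, `|b z| <= M) ->
  L1 (sigma_product mu mu) (fun z : T * T => h z.1 * heat c z.2 z.1 * b z).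
Proof.
move=> c0 lh mb bM.
have mhh : measurable_fun setT (fun z : T * T => h z.1 * heat c z.2 z.1).
  apply: measurable_funM; first exact: measurableT_comp (L1_measurable lh) measurable_fst.
  by under eq_fun do rewrite heatC; exact: measurable_heat.
apply: L1_bounded bM => //.
apply: (@L1_iter _ _ _ _ _ _ _ _ (fun x => (`|c| ^+ dim)^-1 * `|h x|)) => //.
  exact/L1Z/L1_norm.
move=> x /=; rewrite -(Rintegral_heat x c0) mulrC EFinM (Rintegral_EFin (L1_heat x c0)).
rewrite -ge0_integralZl//=; last 2 first.
- by apply/measurable_EFinP; exact: L1_measurable (L1_heat x c0).
- by move=> y _; rewrite lee_fin heat_ge0.
by under eq_integral do rewrite normrM (ger0_norm (heat_ge0 _ _ _)) EFinM.
Qed.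

(* On a set [A] of [eu_pi], the averages of [\1_A] against narrow Gaussians tend to [\1_A]
   almost everywhere. *)
Lemma heat_uniqueness (h : T -> R) : L1 mu h ->
  (forall c y, 0 < c -> \int[mu]_x (h x * heat c y x) = 0) ->
  {ae mu, forall x, h x = 0}.
Proof.
move=> lh h0.
have [Pi [PT PI Pm mP Pnear]] := eu_pi eu.
apply: (ae_eq0_pi_system lh PT PI Pm mP) => A PA.
have mA := Pm _ PA; have mh := L1_measurable lh.
have mI : measurable_fun setT (\1_A : T -> R) by exact: measurable_indic.
have bI x : `|\1_A x : R| <= 1.
  by rewrite indicE; case: (_ \in _); rewrite ?normr1 ?normr0.
pose c k : R := k.+1%:R.
have c0 k : c k != 0 by rewrite pnatr_eq0.
(* The average of [\1_A] against the kernel of mass one centred at [x], as [kapE] confirms. In this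
   magnified form only the argument of [\1_A] depends on [k]. *)
pose kap k x : R := \int[mu]_z (gaussian ip z * \1_A (add (scl (c k)^-1 z) x)).
have mdil k x : measurable_fun setT (fun z => add (scl (c k)^-1 z) x).
  exact: measurableT_comp (measurable_trans eu x) (eu_mscl eu _).
have mdil2 k : measurable_fun setT (fun z : T * T => add (scl (c k)^-1 z.2) z.1).
  apply: measurableT_comp (eu_madd eu) (measurable_fun_pair _ _).
    exact: measurableT_comp (eu_mscl eu _) measurable_snd.
  exact: measurable_fst.
have mg2 : measurable_fun setT (fun z : T * T => gaussian ip z.2).
  exact: measurableT_comp (measurable_gaussian eu) measurable_snd.
have lgI k x : L1 mu (fun z => gaussian ip z * \1_A (add (scl (c k)^-1 z) x)).
  apply: (@L1_bounded _ _ _ _ 1 _ _ (L1_gaussian eu)) => //.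
  exact: measurableT_comp mI (mdil k x).
have mkap k : measurable_fun setT (kap k).
  apply: (measurable_Rintegral1 mu (f := fun z => gaussian ip z.2 * \1_A (add (scl (c k)^-1 z.2) z.1))).
  by apply: measurable_funM => //; exact: measurableT_comp mI (mdil2 k).
have kap_le k x : `|kap k x| <= 1.
  rewrite (le_trans (le_normr_Rintegral _ (lgI k x)))// -(Rintegral_gaussian eu).
  apply: le_Rintegral => //; [exact: L1_norm|exact: L1_gaussian eu|].
  by move=> z _; rewrite normrM ger0_norm ?expR_ge0// ler_piMr ?expR_ge0.
have kapE k x : kap k x = `|c k| ^+ dim * \int[mu]_y (\1_A y * heat (c k) y x).
  have lI : L1 mu (fun y => \1_A y * heat (c k) y x).
    under eq_fun do rewrite mulrC.
    by apply: (@L1_bounded _ _ _ _ 1) => //; exact: L1_heat.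
  have ci : (c k)^-1 != 0 by rewrite invr_eq0.
  have := Rintegral_scale eu ci (L1_trans eu x lI).
  rewrite (Rintegral_trans eu x lI) normfV exprVn invrK => <-.
  by apply: eq_Rintegral => z _; rewrite heat_dilate// mulrC.
have l2 k := L1_heat2 (c0 k) lh (b := fun z => \1_A z.2)
  (measurableT_comp mI measurable_snd) (fun z => bI z.2).
(* By Fubini this is, up to a constant, an integral over [y] in [A] of the quantities that vanish by
   [h0]. *)
have Ik k : \int[mu]_x (h x * kap k x) = 0.
  transitivity (`|c k| ^+ dim * \int[mu]_x \int[mu]_y (h x * heat (c k) y x * \1_A y)).
    rewrite -[RHS](RintegralZl _ measurableT (L1_Rintegral1 (l2 k))).
      apply: eq_Rintegral => x _; rewrite kapE mulrCA; congr (_ * _).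
      rewrite -RintegralZl//.
        by apply: eq_Rintegral => y _; ring.
      under eq_fun do rewrite mulrC.
      by apply: (@L1_bounded _ _ _ _ 1) => //; exact: L1_heat.
  rewrite (Rfubini (l2 k))/=.
  rewrite (_ : (fun y => _) = cst 0) ?Rintegral_cst ?mul0r ?mulr0//.
  apply/funext => y /=.
  transitivity (\1_A y * \int[mu]_x (h x * heat (c k) y x)).
    rewrite -RintegralZl//; first by apply: eq_Rintegral => x _; ring.
    apply: (@L1_bounded _ _ _ _ 1) => //; last by move=> x; rewrite ger0_norm ?heat_ge0// heat_le1.
    exact: measurableT_comp (measurable_heat (c k)) (measurable_pair1 y).
  by rewrite h0 ?mulr0// ltr0n.
have [|||||_ cv] := @cvg_Rintegral _ _ _ mu (fun k x => h x * kap k x)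
    (fun x => h x * \1_A x) (fun x => `|h x|).
- by move=> k; exact: measurable_funM.
- exact: measurable_funM.
- apply: filterS (Pnear _ PA) => x nx.
  apply: cvgM; first exact: cvg_cst.
  have [|||||_ cv] := @cvg_Rintegral _ _ _ mu (fun k z => gaussian ip z * \1_A (add (scl (c k)^-1 z) x))
    (fun z => gaussian ip z * \1_A x) (gaussian ip).
  + by move=> k; exact: L1_measurable (lgI k x).
  + by apply: measurable_funM => //; exact: measurable_gaussian eu.
  + apply: aeW => z; apply: cvg_near_cst; have := nx z; apply: filterS => k e.
    by rewrite !indicE; congr (_ * (nat_of_bool _)%:R); apply/idP/idP; rewrite !inE => /e.
  + exact: L1_gaussian eu.
  + by move=> k z; rewrite normrM ger0_norm ?expR_ge0// ler_piMr ?expR_ge0.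
  move: cv; rewrite (RintegralZr _ _ (L1_gaussian eu))//.
  by rewrite (Rintegral_gaussian eu) mul1r.
- exact: L1_norm.
- by move=> k x; rewrite normrM ler_piMr.
apply: (cvg_unique _ cv) => //.
by rewrite (funext Ik); exact: cvg_cst.
Qed.

End heat_kernel.

Section fourier.
Context d (T : measurableType d) (R : realType).
Variables (mu : {sigma_finite_measure set T -> \bar R}).
Variables (add : T -> T -> T) (scl : R -> T -> T) (ip : T -> T -> R) (dim : nat).
Hypothesis eu : euclid mu add scl ip dim.
Implicit Types (x y : T) (u v : T -> R).

(* Real and imaginary parts of the Fourier transform of [u + i v]. *)
Definition fre u v y : R :=
  \int[mu]_x (u x * cos (2 * pi * ip y x) + v x * sin (2 * pi * ip y x)).

Definition fim u v y : R :=
  \int[mu]_x (v x * cos (2 * pi * ip y x) - u x * sin (2 * pi * ip y x)).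

Let mcos2 : measurable_fun setT (fun z : T * T => cos (2 * pi * ip z.1 z.2) : R).
Proof.
apply: measurableT_comp; first exact: measurable_cos.
by apply: measurable_funM => //; exact: eu_mip eu.
Qed.

Let msin2 : measurable_fun setT (fun z : T * T => sin (2 * pi * ip z.1 z.2) : R).
Proof.
apply: measurableT_comp; first exact: measurable_sin.
by apply: measurable_funM => //; exact: eu_mip eu.
Qed.

Let mcos y : measurable_fun setT (fun x => cos (2 * pi * ip y x) : R).
Proof. exact: measurableT_comp mcos2 (measurable_pair1 y). Qed.

Let msin y : measurable_fun setT (fun x => sin (2 * pi * ip y x) : R).
Proof. exact: measurableT_comp msin2 (measurable_pair1 y). Qed.

Let msnd (f : T -> R) : measurable_fun setT f ->
  measurable_fun setT (fun z : T * T => f z.2).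
Proof. by move=> mf; exact: measurableT_comp mf measurable_snd. Qed.

Let mfst (f : T -> R) : measurable_fun setT f ->
  measurable_fun setT (fun z : T * T => f z.1).
Proof. by move=> mf; exact: measurableT_comp mf measurable_fst. Qed.

Lemma L1_cos u y : L1 mu u -> L1 mu (fun x => u x * cos (2 * pi * ip y x)).
Proof.
by move=> lu; apply: (L1_bounded lu (M := 1)) => // x; exact: cos_bound.
Qed.

Lemma L1_sin u y : L1 mu u -> L1 mu (fun x => u x * sin (2 * pi * ip y x)).
Proof.
by move=> lu; apply: (L1_bounded lu (M := 1)) => // x; exact: sin_bound.
Qed.

(** As [v - i u] is - i times [u + i v], its transform has the imaginary part [fim u v] as real
    part. Statements on imaginary parts are reduced in this way to statements on real parts. *)
Lemma fre_fim u v : fre v (fun x => - u x) = fim u v.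
Proof.
by apply/funext => y; apply: eq_Rintegral => x _; rewrite mulNr.
Qed.

Lemma fim_fre u v y : L1 mu u -> L1 mu v -> fim v (fun x => - u x) y = - fre u v y.
Proof.
move=> lu lv; rewrite -mulN1r /fre -RintegralZl//; last first.
  by apply: L1D; [exact: L1_cos|exact: L1_sin].
by apply: eq_Rintegral => x _; ring.
Qed.

Lemma measurable_fre u v : measurable_fun setT u -> measurable_fun setT v ->
  measurable_fun setT (fre u v).
Proof.
move=> mU mv.
apply: (measurable_Rintegral1 mu (f := fun z => u z.2 * cos (2 * pi * ip z.1 z.2) +
  v z.2 * sin (2 * pi * ip z.1 z.2))).
by apply: measurable_funD; apply: measurable_funM => //; exact: msnd.
Qed.

Lemma measurable_fim u v : measurable_fun setT u -> measurable_fun setT v ->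
  measurable_fun setT (fim u v).
Proof.
by move=> mU mv; rewrite -fre_fim; apply: measurable_fre => //; exact: measurableT_comp.
Qed.

Lemma fre_bound u v y : L1 mu u -> L1 mu v ->
  `|fre u v y| <= \int[mu]_x (`|u x| + `|v x|).
Proof.
move=> lu lv.
have l : L1 mu (fun x => u x * cos (2 * pi * ip y x) + v x * sin (2 * pi * ip y x)).
  by apply: L1D; [exact: L1_cos|exact: L1_sin].
rewrite (le_trans (le_normr_Rintegral _ l))//.
apply: le_Rintegral => //; first exact: L1_norm.
  by apply: L1D; exact: L1_norm.
move=> x _; rewrite (le_trans (ler_normD _ _))// !normrM lerD//.
  by rewrite ler_piMr// cos_bound.
by rewrite ler_piMr// sin_bound.
Qed.

Lemma fim_bound u v y : L1 mu u -> L1 mu v ->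
  `|fim u v y| <= \int[mu]_x (`|u x| + `|v x|).
Proof.
move=> lu lv; rewrite -fre_fim (le_trans (fre_bound _ _ _))//.
  by apply: eq_L1 (L1Z (-1) lu) => x; rewrite mulN1r.
by under eq_Rintegral do rewrite normrN addrC.
Qed.

(** A Gaussian of width [c]. Its transform is [heat] up to the factor c^dim, and it tends to 1 as
    [c] grows, so it acts both as a test function and as a cut-off. *)
Definition dilgauss (c : R) y : R := gaussian ip (scl c^-1 y).

Lemma dilgauss_ge0 c y : 0 <= dilgauss c y. Proof. exact: expR_ge0. Qed.

Lemma L1_dilgauss c : c != 0 -> L1 mu (dilgauss c).
Proof.
by move=> c0; apply: (L1_scale eu) (L1_gaussian eu); rewrite invr_eq0.
Qed.

Lemma measurable_dilgauss c : c != 0 -> measurable_fun setT (dilgauss c).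
Proof. by move=> /L1_dilgauss /L1_measurable. Qed.

Lemma fourier_dilgauss c x y : 0 < c ->
  \int[mu]_z (dilgauss c z * cos (2 * pi * (ip z x - ip z y))) = c ^+ dim * heat ip c y x.
Proof.
move=> c0; have c1 : c^-1 != 0 by rewrite invr_eq0 gt_eqF.
(* Chosen so that [ip (scl c^-1 z) z0 = ip z x - ip z y]. *)
pose z0 := scl c (add x (scl (-1) y)).
have := Rintegral_scale eu c1 (L1_gaussian_cos eu z0).
rewrite (eu_gauss eu) normfV exprVn invrK (gtr0_norm c0) => h.
transitivity (\int[mu]_z (gaussian ip (scl c^-1 z) * cos (2 * pi * ip (scl c^-1 z) z0))).
  apply: eq_Rintegral => z _; rewrite /z0 !(eu_ipZ eu, eu_ipZr eu, eu_ipDr eu).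
  congr (_ * cos (_ * _)); field; by rewrite gt_eqF.
rewrite h; congr (_ * _); rewrite (heatC eu) /heat (sqdistE eu) /z0 !(eu_ipZ eu, eu_ipZr eu).
by congr (expR (- _)); ring.
Qed.

Lemma fourier_dilgauss_sin c x y : 0 < c ->
  \int[mu]_z (dilgauss c z * sin (2 * pi * (ip z x - ip z y))) = 0.
Proof.
move=> c0; have c1 : c^-1 != 0 by rewrite invr_eq0 gt_eqF.
pose z0 := scl c (add x (scl (-1) y)).
have := Rintegral_scale eu c1 (L1_gaussian_sin eu z0).
rewrite (Rintegral_gaussian_sin eu) mulr0 => <-.
apply: eq_Rintegral => z _; rewrite /z0 !(eu_ipZ eu, eu_ipZr eu, eu_ipDr eu).
by congr (_ * sin (_ * _)); field; rewrite gt_eqF.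
Qed.

(** The left side is the real part of the inverse transform applied to the transform of [u + i v],
    damped by a Gaussian. Fubini moves the integration onto the Gaussian, and the sine terms with
    [v] vanish by oddness. *)
Lemma fourier_heat u v c y : 0 < c -> L1 mu u -> L1 mu v ->
  \int[mu]_z ((fre u v z * cos (2 * pi * ip z y) - fim u v z * sin (2 * pi * ip z y))
     * dilgauss c z) = c ^+ dim * \int[mu]_x (u x * heat ip c y x).
Proof.
move=> c0 lu lv; have c1 : c != 0 by rewrite gt_eqF.
have mU := L1_measurable lu; have mv := L1_measurable lv.
have mg := measurable_dilgauss c1.
pose k (z : T * T) : R := (u z.2 * cos (2 * pi * (ip z.1 z.2 - ip z.1 y)) +
  v z.2 * sin (2 * pi * (ip z.1 z.2 - ip z.1 y))) * dilgauss c z.1.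
have mdiff : measurable_fun setT (fun z : T * T => 2 * pi * (ip z.1 z.2 - ip z.1 y)).
  apply: measurable_funM => //; apply: measurable_funB; first exact: eu_mip eu.
  exact: mfst (measurable_ip2 eu y).
have mk : measurable_fun setT k.
  apply: measurable_funM; last exact: mfst.
  apply: measurable_funD; apply: measurable_funM; try exact: msnd.
  - by apply: measurableT_comp mdiff; exact: measurable_cos.
  - by apply: measurableT_comp mdiff; exact: measurable_sin.
have lk : L1 (sigma_product mu mu) k.
  apply: (L1_prod mk (L1_dilgauss c1) (L1D (L1_norm lu) (L1_norm lv))).
  move=> z x; rewrite /k /= normrM (ger0_norm (dilgauss_ge0 _ _)) mulrC.
  rewrite ler_wpM2l ?dilgauss_ge0// (le_trans (ler_normD _ _))// !normrM lerD//.
    by rewrite ler_piMr// cos_bound.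
  by rewrite ler_piMr// sin_bound.
transitivity (\int[mu]_z \int[mu]_x k (z, x)).
  apply: eq_Rintegral => z _; rewrite /k /=.
  have l1 := L1D (L1_cos z lu) (L1_sin z lv).
  have l2 := L1B (L1_cos z lv) (L1_sin z lu).
  have := RintegralB measurableT (L1Z (cos (2 * pi * ip z y)) l1) (L1Z (sin (2 * pi * ip z y)) l2).
  rewrite (RintegralZl _ _ l1)// (RintegralZl _ _ l2)// => e.
  rewrite [fre u v z * _]mulrC [fim u v z * _]mulrC -e mulrC -RintegralZl//; last first.
    by apply: L1B; exact: L1Z.
  by apply: eq_Rintegral => x _; rewrite [2 * pi * (_ - _)]mulrBr cosB sinB; ring.
rewrite (Rfubini lk) -RintegralZl//; last first.
  apply: (L1_bounded lu (M := 1)).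
    exact: measurableT_comp (measurable_heat eu c) (measurable_pair1 y).
  by move=> x; rewrite ger0_norm ?heat_ge0// (heat_le1 eu).
apply: eq_Rintegral => x _; rewrite /k /=.
have md : measurable_fun setT (fun z => 2 * pi * (ip z x - ip z y)).
  by apply: measurable_funM => //; apply: measurable_funB; exact: measurable_ip2 eu _.
have lc : L1 mu (fun z => dilgauss c z * cos (2 * pi * (ip z x - ip z y))).
  apply: (L1_bounded (L1_dilgauss c1) (M := 1)); last by move=> z; exact: cos_bound.
  by apply: measurableT_comp md; exact: measurable_cos.
have ls : L1 mu (fun z => dilgauss c z * sin (2 * pi * (ip z x - ip z y))).
  apply: (L1_bounded (L1_dilgauss c1) (M := 1)); last by move=> z; exact: sin_bound.
  by apply: measurableT_comp md; exact: measurable_sin.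
transitivity (\int[mu]_z (u x * (dilgauss c z * cos (2 * pi * (ip z x - ip z y))) +
  v x * (dilgauss c z * sin (2 * pi * (ip z x - ip z y))))).
  by apply: eq_Rintegral => z _; ring.
rewrite (RintegralD _ (L1Z (u x) lc) (L1Z (v x) ls))// (RintegralZl _ _ lc)// (RintegralZl _ _ ls)//.
by rewrite fourier_dilgauss// fourier_dilgauss_sin//; ring.
Qed.

Lemma fourier_uniqueness_re u v : L1 mu u -> L1 mu v ->
  {ae mu, forall y, fre u v y = 0} -> {ae mu, forall y, fim u v y = 0} ->
  {ae mu, forall x, u x = 0}.
Proof.
move=> lu lv fr0 fi0; apply: (heat_uniqueness eu lu) => c y c0.
have c1 : c ^+ dim != 0 by rewrite expf_neq0// gt_eqF.
apply: (mulfI c1); rewrite mulr0 -(fourier_heat y c0 lu lv).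
have mU := L1_measurable lu; have mv := L1_measurable lv.
rewrite (@ae_eq_Rintegral _ _ _ _ _ (cst 0))//.
- by rewrite Rintegral_cst// mul0r.
- apply: measurable_funM; last by apply: measurable_dilgauss; rewrite gt_eqF.
  apply: measurable_funB; apply: measurable_funM.
  + exact: measurable_fre.
  + apply: measurableT_comp; first exact: measurable_cos.
    by apply: measurable_funM => //; exact: measurable_ip2 eu y.
  + exact: measurable_fim.
  + apply: measurableT_comp; first exact: measurable_sin.
    by apply: measurable_funM => //; exact: measurable_ip2 eu y.
- by apply: filterS2 fr0 fi0 => z -> ->; rewrite !mul0r subr0 mul0r.
Qed.

Lemma fourier_uniqueness u v : L1 mu u -> L1 mu v ->
  {ae mu, forall y, fre u v y = 0} -> {ae mu, forall y, fim u v y = 0} ->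
  {ae mu, forall x, u x = 0} /\ {ae mu, forall x, v x = 0}.
Proof.
move=> lu lv fr0 fi0; split; first exact: fourier_uniqueness_re fr0 fi0.
have lNu : L1 mu (fun x => - u x) by apply: eq_L1 (L1Z (-1) lu) => x; rewrite mulN1r.
apply: (fourier_uniqueness_re lv lNu); first by rewrite fre_fim.
by apply: filterS fr0 => y e; rewrite fim_fre// e oppr0.
Qed.

(** As [f] may fail to be integrable, [heat_uniqueness] is applied to its product with a Gaussian; a
    Gaussian times a heat kernel is again a multiple of a heat kernel. *)
Lemma square_integrable_uniqueness (f : T -> R) : measurable_fun setT f ->
  L1 mu (fun x => f x ^+ 2) ->
  (forall c y, 0 < c -> \int[mu]_x (f x * heat ip c y x) = 0) ->
  {ae mu, forall x, f x = 0}.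
Proof.
move=> mf lf2 f0.
have mg := measurable_gaussian eu.
have lh : L1 mu (fun x => f x * gaussian ip x).
  apply: (@L1_le _ _ _ _ _ (fun x => f x ^+ 2 + gaussian ip x)).
  - exact: measurable_funM.
  - move=> x; rewrite normrM (ger0_norm (expR_ge0 _)) -/(gaussian _ _).
    have g1 : gaussian ip x <= 1.
      by rewrite -expR0 ler_expR oppr_le0 mulr_ge0 ?pi_ge0// (eu_ip_ge0 eu).
    have g0 : 0 <= gaussian ip x by exact: expR_ge0.
    have : 0 <= (`|f x| - 1) ^+ 2 by exact: sqr_ge0.
    have := normr_ge0 (f x); rewrite -(real_normK (num_real (f x))); nra.
  - by apply: L1D => //; exact: L1_gaussian eu.
suff : {ae mu, forall x, f x * gaussian ip x = 0}.
  apply: filterS => x /eqP; rewrite mulf_eq0 => /orP[/eqP//|].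
  by rewrite gt_eqF// expR_gt0.
apply: (heat_uniqueness eu lh) => c y c0.
(* Completing the square: with s = c^2 / (1 + c^2), |x|^2 + c^2 |x - y|^2 = (1 + c^2) |x - s y|^2 +
   s |y|^2. *)
have c2 : 0 < 1 + c ^+ 2 by rewrite ltr_pwDl// sqr_ge0.
pose c1 := Num.sqrt (1 + c ^+ 2).
have c1_gt0 : 0 < c1 by rewrite sqrtr_gt0.
pose y1 := scl (c ^+ 2 / (1 + c ^+ 2)) y.
pose K : R := expR (- (pi * (c ^+ 2 / (1 + c ^+ 2)) * ip y y)).
transitivity (\int[mu]_x (K * (f x * heat ip c1 y1 x))).
  apply: eq_Rintegral => x _; rewrite -mulrA [RHS]mulrCA; congr (_ * _).
  rewrite /K /gaussian /heat -!expRD; congr expR.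
  rewrite /sqdist /y1 /c1 sqr_sqrtr ?ltW// !(eu_ipZ eu, eu_ipZr eu).
  by field; rewrite gt_eqF.
rewrite RintegralZl ?f0 ?mulr0//.
apply: (@L1_le _ _ _ _ _ (fun x => f x ^+ 2 + heat ip c1 y1 x)).
- by apply: measurable_funM => //; exact: measurableT_comp (measurable_heat eu c1) (measurable_pair1 y1).
- move=> x; rewrite normrM (ger0_norm (heat_ge0 _ _ _ _)).
  have g1 := heat_le1 eu c1 y1 x; have g0 := heat_ge0 ip c1 y1 x.
  have : 0 <= (`|f x| - 1) ^+ 2 by exact: sqr_ge0.
  have := normr_ge0 (f x); rewrite -(real_normK (num_real (f x))); nra.
- apply: L1D => //.
  have c10 : c1 != 0 by rewrite gt_eqF.
  by apply: eq_L1 (L1_heat eu y1 c10) => x; rewrite (heatC eu).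
Qed.

End fourier.

(** * Square-integrable functions *)

Section plancherel.
Context d (T : measurableType d) (R : realType).
Variables (mu : {sigma_finite_measure set T -> \bar R}).
Variables (add : T -> T -> T) (scl : R -> T -> T) (ip : T -> T -> R) (dim : nat).
Hypothesis eu : euclid mu add scl ip dim.
Implicit Types (x y : T) (u v : T -> R).

Local Notation fre := (fre mu ip).
Local Notation fim := (fim mu ip).
Local Notation dilgauss := (dilgauss scl ip).

(** For [c > 0], the convolution of [u] with the heat kernel of mass one. *)
Let heatint (c : R) (u : T -> R) y : R := c ^+ dim * \int[mu]_x (u x * heat ip c y x).

Let L1_uheat c y u : 0 < c -> L1 mu u -> L1 mu (fun x => u x * heat ip c y x).
Proof.
move=> c0 lu; apply: (L1_bounded lu (M := 1)).
  exact: measurableT_comp (measurable_heat eu c) (measurable_pair1 y).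
by move=> x; rewrite ger0_norm ?heat_ge0// (heat_le1 eu).
Qed.

Let measurable_heatint c u : measurable_fun setT u -> measurable_fun setT (heatint c u).
Proof.
move=> mU; apply: measurable_funM => //.
apply: (measurable_Rintegral1 mu (f := fun z => u z.2 * heat ip c z.1 z.2)).
apply: measurable_funM; last exact: measurable_heat eu c.
exact: measurableT_comp mU measurable_snd.
Qed.

Let L1_mul_heatint c u : 0 < c -> L1 mu u -> L1 mu (fun y => u y * heatint c u y).
Proof.
move=> c0 lu.
apply: (L1_bounded lu (M := c ^+ dim * \int[mu]_x `|u x|)).
  by apply: measurable_heatint; exact: L1_measurable lu.
move=> y; rewrite normrM ger0_norm ?exprn_ge0 ?(ltW c0)//.
rewrite ler_wpM2l ?exprn_ge0 ?(ltW c0)//.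
rewrite (le_trans (le_normr_Rintegral _ (L1_uheat y c0 lu)))//.
apply: le_Rintegral => //; [exact/L1_norm/L1_uheat|exact: L1_norm|].
by move=> x _; rewrite normrM ler_piMr// ger0_norm ?heat_ge0// (heat_le1 eu).
Qed.

(** Since 2 u(x) u(y) <= u(x)^2 + u(y)^2 and the kernel is symmetric of mass one, each of the two
    squares contributes half of the right side. *)
Let heatint_le c u : 0 < c -> L1 mu u -> L1 mu (fun x => u x ^+ 2) ->
  \int[mu]_y (u y * heatint c u y) <= \int[mu]_x u x ^+ 2.
Proof.
move=> c0 lu lu2; have c1 : c != 0 by rewrite gt_eqF.
have cd : c ^+ dim != 0 by rewrite expf_neq0.
have l2 := L1_heat2 eu c1 lu2 (b := cst 1) (M := 1) (measurable_cst _)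
  (fun z => eq_ind_r (fun a => is_true (a <= 1)) (lexx 1) (normr1 _)).
have e2 : \int[mu]_y heatint c (fun x => u x ^+ 2) y = \int[mu]_x u x ^+ 2.
  have h := Rfubini l2.
  have lI : L1 mu (fun y => \int[mu]_x (u x ^+ 2 * heat ip c y x)).
    have := L1_Rintegral2 l2; apply: eq_L1 => y /=.
    by apply: eq_Rintegral => x _; rewrite mulr1.
  rewrite /heatint (RintegralZl _ measurableT lI).
  transitivity (c ^+ dim * \int[mu]_x \int[mu]_y (u x ^+ 2 * heat ip c y x * cst 1 (x, y))).
    rewrite h; congr (_ * _); apply: eq_Rintegral => y _.
    by apply: eq_Rintegral => x _; rewrite /= mulr1.
  transitivity (c ^+ dim * \int[mu]_x (u x ^+ 2 * (`|c| ^+ dim)^-1)).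
    congr (_ * _); apply: eq_Rintegral => x _.
    under eq_Rintegral do rewrite /= mulr1.
    by rewrite (RintegralZl _ measurableT (L1_heat eu x c1)) (Rintegral_heat eu).
  by rewrite (RintegralZr _ measurableT lu2) (gtr0_norm c0) mulrCA mulfV ?mulr1.
have l3 : L1 mu (heatint c (fun x => u x ^+ 2)).
  apply: L1Z; have := L1_Rintegral2 l2; apply: eq_L1 => y /=.
  by apply: eq_Rintegral => x _; rewrite mulr1.
apply: (@le_trans _ _ (\int[mu]_y (2^-1 * heatint c (fun x => u x ^+ 2) y + 2^-1 * u y ^+ 2))).
  apply: le_Rintegral => //; first exact: L1_mul_heatint.
    by apply: L1D; exact: L1Z.
  move=> y _; rewrite /heatint.
  have lh : L1 mu (heat ip c y) by apply: eq_L1 (L1_heat eu y c1) => x; rewrite (heatC eu).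
  have e1 : u y ^+ 2 = c ^+ dim * \int[mu]_x (u y ^+ 2 * heat ip c y x).
    rewrite (RintegralZl _ measurableT lh).
    under eq_Rintegral do rewrite (heatC eu).
    by rewrite (Rintegral_heat eu)// (gtr0_norm c0) mulrCA mulfV ?mulr1.
  rewrite [in leRHS]e1 ![2^-1 * _]mulrCA [u y * _]mulrCA -mulrDr.
  rewrite ler_wpM2l ?exprn_ge0 ?(ltW c0)//.
  rewrite -(RintegralZl _ _ (L1_uheat y c0 lu))// -(RintegralZl _ _ (L1_uheat y c0 lu2))//.
  rewrite -(RintegralZl _ _ (L1Z (u y ^+ 2) lh))//.
  rewrite -(RintegralD measurableT (L1Z _ (L1_uheat y c0 lu2)) (L1Z _ (L1Z (u y ^+ 2) lh))).
  apply: le_Rintegral => //.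
  - exact/L1Z/L1_uheat.
  - by apply: L1D; apply: L1Z; [exact: L1_uheat|exact: L1Z].
  - move=> x _; have := heat_ge0 ip c y x.
    have : 0 <= (u x - u y) ^+ 2 by exact: sqr_ge0.
    set w := heat _ _ _ _ => h1 h2.
    have := mulr_ge0 h1 h2; lra.
rewrite (RintegralD _ (L1Z 2^-1 l3) (L1Z 2^-1 lu2))// (RintegralZl _ _ l3)// (RintegralZl _ _ lu2)//.
by rewrite e2; lra.
Qed.

(** Integrating [fourier_heat] against [u] and its analogue for the imaginary part against [v]
    reassembles the squared modulus of the transform, by Fubini. *)
Let plancherel_weighted c u v : 0 < c -> L1 mu u -> L1 mu v ->
  \int[mu]_z ((fre u v z ^+ 2 + fim u v z ^+ 2) * dilgauss c z) =
  \int[mu]_y (u y * heatint c u y + v y * heatint c v y).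
Proof.
move=> c0 lu lv; have c1 : c != 0 by rewrite gt_eqF.
have lNu : L1 mu (fun x => - u x) by apply: eq_L1 (L1Z (-1) lu) => x; rewrite mulN1r.
have mU := L1_measurable lu; have mv := L1_measurable lv.
have mfr := measurable_fre eu mU mv; have mfi := measurable_fim eu mU mv.
(* [A] and [B] are the real and imaginary parts of the transform at [z] times exp(2 pi i <z, y>). *)
pose A z y := fre u v z * cos (2 * pi * ip z y) - fim u v z * sin (2 * pi * ip z y).
pose B z y := fim u v z * cos (2 * pi * ip z y) + fre u v z * sin (2 * pi * ip z y).
have eA y : heatint c u y = \int[mu]_z (A z y * dilgauss c z).
  by rewrite /heatint -(fourier_heat eu y c0 lu lv).
have eB y : heatint c v y = \int[mu]_z (B z y * dilgauss c z).
  rewrite /heatint -(fourier_heat eu y c0 lv lNu); apply: eq_Rintegral => z _.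
  by rewrite fre_fim (fim_fre eu)// /B mulNr opprK.
pose M : R := \int[mu]_x (`|u x| + `|v x|).
have frM z : `|fre u v z| <= M by exact: (fre_bound eu z lu lv).
have fiM z : `|fim u v z| <= M by exact: (fim_bound eu z lu lv).
have trig (a b s : R) : `|a| <= M -> `|b| <= M ->
    `|a * cos s - b * sin s| <= M + M /\ `|b * cos s + a * sin s| <= M + M.
  move=> aM bM; split.
    rewrite (le_trans (ler_normB _ _))// !normrM lerD//.
      by rewrite (le_trans _ aM)// ler_piMr// cos_bound.
    by rewrite (le_trans _ bM)// ler_piMr// sin_bound.
  rewrite (le_trans (ler_normD _ _))// !normrM lerD//.
    by rewrite (le_trans _ bM)// ler_piMr// cos_bound.
  by rewrite (le_trans _ aM)// ler_piMr// sin_bound.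
have mcs : measurable_fun setT (fun z : T * T => cos (2 * pi * ip z.1 z.2) : R) /\
  measurable_fun setT (fun z : T * T => sin (2 * pi * ip z.1 z.2) : R).
  have m2 : measurable_fun setT (fun z : T * T => 2 * pi * ip z.1 z.2).
    by apply: measurable_funM => //; exact: eu_mip eu.
  by split; apply: measurableT_comp m2; [exact: measurable_cos|exact: measurable_sin].
have [mc ms] := mcs.
have mf1 (f : T -> R) : measurable_fun setT f -> measurable_fun setT (fun z : T * T => f z.1).
  by move=> mf; exact: measurableT_comp mf measurable_fst.
have mf2 (f : T -> R) : measurable_fun setT f -> measurable_fun setT (fun z : T * T => f z.2).
  by move=> mf; exact: measurableT_comp mf measurable_snd.
have mA : measurable_fun setT (fun z : T * T => A z.1 z.2).
  by apply: measurable_funB; apply: measurable_funM => //; exact: mf1.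
have mB : measurable_fun setT (fun z : T * T => B z.1 z.2).
  by apply: measurable_funD; apply: measurable_funM => //; exact: mf1.
have mdg := measurable_dilgauss eu c1.
pose k (z : T * T) : R := (u z.2 * A z.1 z.2 + v z.2 * B z.1 z.2) * dilgauss c z.1.
have mk : measurable_fun setT k.
  apply: measurable_funM; last exact: mf1.
  by apply: measurable_funD; apply: measurable_funM => //; exact: mf2.
have lk : L1 (sigma_product mu mu) k.
  apply: (L1_prod mk (L1_dilgauss eu c1) (L1Z (M + M) (L1D (L1_norm lu) (L1_norm lv)))).
  move=> z y; rewrite /k /= normrM (ger0_norm (dilgauss_ge0 _ _ _ _)) mulrC.
  rewrite ler_wpM2l ?dilgauss_ge0// (le_trans (ler_normD _ _))// !normrM mulrDr.
  have [hA hB] := trig _ _ (2 * pi * ip z y) (frM z) (fiM z).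
  by rewrite [leRHS]addrC [leRHS]addrC lerD// mulrC ler_wpM2r.
have ldA y : L1 mu (fun z => A z y * dilgauss c z).
  under eq_fun do rewrite mulrC.
  apply: (L1_bounded (L1_dilgauss eu c1) (M := M + M)).
    exact: measurableT_comp mA (measurable_pair2 y).
  by move=> z; have [] := trig _ _ (2 * pi * ip z y) (frM z) (fiM z).
have ldB y : L1 mu (fun z => B z y * dilgauss c z).
  under eq_fun do rewrite mulrC.
  apply: (L1_bounded (L1_dilgauss eu c1) (M := M + M)).
    exact: measurableT_comp mB (measurable_pair2 y).
  by move=> z; have [] := trig _ _ (2 * pi * ip z y) (frM z) (fiM z).
transitivity (\int[mu]_z \int[mu]_y k (z, y)).
  apply: eq_Rintegral => z _; rewrite /k /=.
  have l1 := L1D (L1_cos eu z lu) (L1_sin eu z lv).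
  have l2 := L1B (L1_cos eu z lv) (L1_sin eu z lu).
  have l3 : L1 mu (fun y => u y * A z y + v y * B z y).
    have := L1D (L1Z (fre u v z) l1) (L1Z (fim u v z) l2).
    by apply: eq_L1 => y; rewrite /A /B; ring.
  rewrite (RintegralZr _ measurableT l3); congr (_ * _); rewrite !expr2.
  rewrite -[X in X + _](RintegralZl (fre u v z) measurableT l1).
  rewrite -[X in _ + X](RintegralZl (fim u v z) measurableT l2).
  rewrite -(RintegralD measurableT (L1Z _ l1) (L1Z _ l2)).
  by apply: eq_Rintegral => y _; rewrite /A /B; ring.
rewrite (Rfubini lk); apply: eq_Rintegral => y _; rewrite eA eB /k /=.
rewrite -(RintegralZl (u y) measurableT (ldA y)) -(RintegralZl (v y) measurableT (ldB y)).
rewrite -(RintegralD measurableT (L1Z _ (ldA y)) (L1Z _ (ldB y))).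
by apply: eq_Rintegral => z _; ring.
Qed.

(* Regularize with a Gaussian weight and let it tend to 1. *)
Lemma bessel u v : L1 mu u -> L1 mu v ->
  L1 mu (fun x => u x ^+ 2) -> L1 mu (fun x => v x ^+ 2) ->
  (\int[mu]_z (fre u v z ^+ 2 + fim u v z ^+ 2)%:E <=
   \int[mu]_x (u x ^+ 2 + v x ^+ 2)%:E)%E.
Proof.
move=> lu lv lu2 lv2.
have mU := L1_measurable lu; have mv := L1_measurable lv.
have mfr := measurable_fre eu mU mv; have mfi := measurable_fim eu mU mv.
have mS : measurable_fun setT (fun z => fre u v z ^+ 2 + fim u v z ^+ 2).
  by apply: measurable_funD; exact: measurable_funX.
have S0 z : 0 <= fre u v z ^+ 2 + fim u v z ^+ 2 by rewrite addr_ge0 ?sqr_ge0.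
pose c k : R := k.+1%:R.
have c0 k : 0 < c k by rewrite ltr0n.
have cn0 k : c k != 0 by rewrite gt_eqF.
have dg k z : dilgauss (c k) z = expR (- (pi * ip z z * (c k)^-1 ^+ 2)).
  by rewrite /dilgauss /gaussian !(eu_ipZ eu, eu_ipZr eu); congr (expR (- _)); ring.
pose M : R := \int[mu]_x (`|u x| + `|v x|).
have SM z : fre u v z ^+ 2 + fim u v z ^+ 2 <= M ^+ 2 + M ^+ 2.
  have := fre_bound eu z lu lv; have := fim_bound eu z lu lv; rewrite -/M => h1 h2.
  rewrite -(real_normK (num_real (fre u v z))) -(real_normK (num_real (fim u v z))).
  by rewrite lerD// lerXn2r// ?nnegrE// (le_trans _ h1).
have lk k : L1 mu (fun z => (fre u v z ^+ 2 + fim u v z ^+ 2) * dilgauss (c k) z).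
  under eq_fun do rewrite mulrC.
  apply: (L1_bounded (L1_dilgauss eu (cn0 k)) (M := M ^+ 2 + M ^+ 2)) => //.
  by move=> z; rewrite ger0_norm.
have limE z : limn (fun k => ((fre u v z ^+ 2 + fim u v z ^+ 2) * dilgauss (c k) z)%:E) =
    (fre u v z ^+ 2 + fim u v z ^+ 2)%:E.
  apply/cvg_lim => //; apply: cvg_EFin; first exact: nearW.
  rewrite -[X in _ --> X]mulr1; apply: cvgM; first exact: cvg_cst.
  under eq_fun do rewrite dg.
  rewrite -expR0; apply: continuous_cvg; first exact: continuous_expR.
  rewrite -oppr0; apply: cvgN; rewrite -(mulr0 (pi * ip z z)); apply: cvgM; first exact: cvg_cst.
  rewrite (_ : 0 = 0 * 0); last by rewrite mulr0.
  by under eq_fun do rewrite expr2; apply: cvgM; exact: cvg_harmonic.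
pose W k := (\int[mu]_z ((fre u v z ^+ 2 + fim u v z ^+ 2) * dilgauss (c k) z)%:E)%E.
have nd z : {homo (fun k => ((fre u v z ^+ 2 + fim u v z ^+ 2) * dilgauss (c k) z)%:E) :
    a b / (a <= b)%N >-> (a <= b)%E}.
  move=> a b ab; rewrite lee_fin ler_wpM2l// !dg ler_expR lerN2.
  rewrite ler_wpM2l ?mulr_ge0 ?pi_ge0 ?(eu_ip_ge0 eu)// lerXn2r ?nnegrE ?invr_ge0 ?(ltW (c0 _))//.
  by rewrite lef_pV2 ?posrE// ler_nat ltnS.
have -> : (\int[mu]_z (fre u v z ^+ 2 + fim u v z ^+ 2)%:E = limn W)%E.
  rewrite /W -monotone_convergence//.
  - by apply: eq_integral => z _; rewrite limE.
  - by move=> k; apply/measurable_EFinP; exact: L1_measurable (lk k).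
  - by move=> k z _; rewrite lee_fin mulr_ge0// expR_ge0.
apply: lime_le.
  apply: ereal_nondecreasing_is_cvgn => a b ab; apply: ge0_le_integral => //.
  - by move=> z _; rewrite lee_fin mulr_ge0// expR_ge0.
  - by apply/measurable_EFinP; exact: L1_measurable (lk a).
  - by apply/measurable_EFinP; exact: L1_measurable (lk b).
  - by move=> z _; exact: nd.
near=> k; rewrite /W -(Rintegral_EFin (lk k)) (plancherel_weighted (c0 k) lu lv).
rewrite -(Rintegral_EFin (L1D lu2 lv2)) lee_fin.
rewrite (RintegralD measurableT (L1_mul_heatint (c0 k) lu) (L1_mul_heatint (c0 k) lv)).
rewrite (RintegralD measurableT lu2 lv2).
by apply: lerD; apply: heatint_le.
Unshelve. all: by end_near. Qed.

End plancherel.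

Section square_integral.
Context d (T : measurableType d) (R : realType).
Variable mu : {measure set T -> \bar R}.
Implicit Types f g h : T -> R.

Definition sqint f : \bar R := (\int[mu]_x (f x ^+ 2)%:E)%E.

Lemma sqint_ge0 f : (0 <= sqint f)%E.
Proof. by apply: integral_ge0 => x _; rewrite lee_fin sqr_ge0. Qed.

Lemma measurable_sqr f : measurable_fun setT f -> measurable_fun setT (fun x => f x ^+ 2).
Proof. exact: measurable_funX. Qed.

Lemma L1_sqr f : measurable_fun setT f -> L1 mu (fun x => f x ^+ 2) <-> (sqint f < +oo)%E.
Proof.
by move=> mf; apply: L1_ge0P; [exact: measurable_sqr|move=> x; exact: sqr_ge0].
Qed.

(** From (a + b)^2 <= 2 a^2 + 2 b^2. It plays the part of the triangle inequality without square
    roots of extended reals. *)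
Lemma sqint_leD f g h : measurable_fun setT f -> measurable_fun setT g ->
  measurable_fun setT h -> (forall x, `|f x| <= `|g x| + `|h x|) ->
  (sqint f <= 2%:E * sqint g + 2%:E * sqint h)%E.
Proof.
move=> mf mg mh fgh.
have mg2 : measurable_fun setT (fun x => (g x ^+ 2)%:E).
  by apply/measurable_EFinP; exact: measurable_sqr.
have mh2 : measurable_fun setT (fun x => (h x ^+ 2)%:E).
  by apply/measurable_EFinP; exact: measurable_sqr.
rewrite /sqint -!ge0_integralZl//=; try by move=> x _; rewrite lee_fin sqr_ge0.
rewrite -ge0_integralD//=; try by move=> x _; rewrite -EFinM lee_fin mulr_ge0// sqr_ge0.
- apply: ge0_le_integral => //=.
  + by move=> x _; rewrite lee_fin sqr_ge0.
  + by apply/measurable_EFinP; exact: measurable_sqr.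
  + by apply: emeasurable_funD; exact: measurable_funeM.
  + move=> x _; rewrite -!EFinM -EFinD lee_fin.
    have := fgh x; have := sqr_ge0 (`|g x| - `|h x|).
    rewrite -(real_normK (num_real (f x))) -(real_normK (num_real (g x))).
    rewrite -(real_normK (num_real (h x))).
    have := normr_ge0 (f x); have := normr_ge0 (g x); have := normr_ge0 (h x); nra.
- exact: measurable_funeM.
- exact: measurable_funeM.
Qed.

(** A weighted form of Cauchy-Schwarz, 2 |f g| <= f^2 / eta + eta g^2, with [eta] adapted to the
    norm of [g]. *)
Lemma cvg_inner0 (f : nat -> T -> R) g :
  (forall k, measurable_fun setT (f k)) -> measurable_fun setT g ->
  sqint (f k) @[k --> \oo] --> 0%E -> L1 mu (fun x => g x ^+ 2) ->
  \int[mu]_x (f k x * g x) @[k --> \oo] --> 0.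
Proof.
move=> mf mg f0 lg.
pose I := \int[mu]_x g x ^+ 2.
have I0 : 0 <= I by apply: Rintegral_ge0 => x _; exact: sqr_ge0.
apply/cvgrPdist_le => e e0.
(* Then [eta * I <= e], also when [I = 0], and it remains to have the square integral of [f k] below
   [e * eta]. *)
pose eta := e / (I + 1).
have I1 : 0 < I + 1 by rewrite ltr_pwDr.
have eta0 : 0 < eta by rewrite divr_gt0.
have : \forall k \near \oo, (sqint (f k) < (e * eta)%:E)%E.
  by apply: (f0 [set r | (r < (e * eta)%:E)%E]); apply: open_ereal_lt'; rewrite lte_fin mulr_gt0.
apply: filterS => k fk.
have lf : L1 mu (fun x => f k x ^+ 2).
  by apply/L1_sqr => //; rewrite (lt_trans fk)// ltry.
have lfg : L1 mu (fun x => f k x * g x).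
  apply: (@L1_le _ T _ _ _ (fun x => f k x ^+ 2 + g x ^+ 2)); [exact: measurable_funM| |exact: L1D].
  move=> x; rewrite normrM -(real_normK (num_real (f k x))) -(real_normK (num_real (g x))).
  have := normr_ge0 (f k x); have := normr_ge0 (g x); have := sqr_ge0 (`|f k x| - `|g x|); nra.
rewrite sub0r normrN (le_trans (le_normr_Rintegral _ lfg))//.
have lA := L1Z (2^-1 * eta^-1) lf; have lB := L1Z (2^-1 * eta) lg.
apply: (@le_trans _ _ (\int[mu]_x (2^-1 * eta^-1 * f k x ^+ 2 + 2^-1 * eta * g x ^+ 2))).
  apply: le_Rintegral => //; [exact: L1_norm|exact: L1D|].
  move=> x _; rewrite normrM.
  have := sqr_ge0 (`|f k x| - eta * `|g x|).
  rewrite -(real_normK (num_real (f k x))) -(real_normK (num_real (g x))) => h.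
  rewrite -subr_ge0 (_ : _ - _ = 2^-1 * eta^-1 * (`|f k x| - eta * `|g x|) ^+ 2); last first.
    by field; rewrite gt_eqF.
  by rewrite mulr_ge0// mulr_ge0 ?invr_ge0// ltW.
rewrite (RintegralD measurableT lA lB) (RintegralZl _ measurableT lf) (RintegralZl _ measurableT lg) -/I.
have : \int[mu]_x f k x ^+ 2 <= e * eta.
  by rewrite -lee_fin (Rintegral_EFin lf) ltW.
have h1 : eta * I <= e.
  by rewrite /eta mulrAC ler_pdivrMr// ler_pM2l// lerDl.
move=> h2.
have h3 : eta^-1 * \int[mu]_x f k x ^+ 2 <= e.
  by rewrite mulrC ler_pdivrMr.
have e2 : e = 2^-1 * e + 2^-1 * e by field.
rewrite -!mulrA [leRHS]e2; apply: lerD; rewrite ler_wpM2l ?invr_ge0 //.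
by rewrite mulrA.
Qed.

(* The dominating function [4 * \sum_k 4^k (f (k+1) - f k)^2] controls the
   distance to the limit and may be infinite, in which case nothing is claimed. *)
Lemma riesz_fischer (f : nat -> T -> R) (C : R) :
  (forall k, measurable_fun setT (f k)) ->
  (forall k, (sqint (fun x => f k.+1 x - f k x)%R <= (C / 8 ^+ k)%:E)%E) ->
  exists2 phi : T -> R, measurable_fun setT phi &
    sqint (fun x => f k x - phi x) @[k --> \oo] --> 0%E.
Proof.
move=> mf fC.
have C0 : 0 <= C.
  by have := le_trans (sqint_ge0 _) (fC 0); rewrite expr0 divr1 lee_fin.
pose D k x := f k.+1 x - f k x.
have mD k : measurable_fun setT (D k) by exact: measurable_funB.
(* The weight 4^k is small enough against the decay 8^-k for [M] to be integrable, and large enough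
   to give |D k x| <= sqrt(M x) / 2^k, a summable bound. *)
pose h k x : \bar R := (4 ^+ k * D k x ^+ 2)%R%:E.
have h0 k x : (0 <= h k x)%E by rewrite lee_fin mulr_ge0 ?sqr_ge0// exprn_ge0.
have mh k : measurable_fun setT (h k).
  by apply/measurable_EFinP; apply: measurable_funM => //; exact: measurable_sqr.
pose M x : \bar R := (\sum_(k <oo) h k x)%E.
have M0 x : (0 <= M x)%E by exact: nneseries_ge0.
have mM : measurable_fun setT M.
  by have := @ge0_emeasurable_sum _ _ _ setT h predT (fun k x _ _ => h0 k x) (fun k _ => mh k).
have iM : (\int[mu]_x M x < +oo)%E.
  rewrite integral_nneseries//.
  apply: (@le_lt_trans _ _ (2 * C)%:E); last exact: ltry.
  have := @cvg_geometric_eseries_half R (2 * C) 0.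
  rewrite expr0 divr1 => /cvg_lim <- //.
  apply: lee_nneseries; first by move=> k _ _; exact: integral_ge0.
  move=> k _; rewrite /h.
  under eq_integral do rewrite EFinM.
  rewrite ge0_integralZl//=; last 2 first.
  - by apply/measurable_EFinP; exact: measurable_sqr.
  - by move=> x _; rewrite lee_fin sqr_ge0.
  apply: le_trans (lee_wpmul2l _ (fC k)) _; first by rewrite lee_fin exprn_ge0.
  rewrite -EFinM lee_fin addn1 natrX exprS.
  rewrite (_ : 8 = 4 * 2 :> R); last by rewrite -natrM.
  rewrite exprMn le_eqVlt; apply/orP; left; apply/eqP; field.
  by rewrite !expf_neq0 ?pnatr_eq0.
pose E := [set x | (M x < +oo)%E].
have mE : measurable E by rewrite -[E]setTI; exact: emeasurable_fun_infty_o.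
(* Cutting off outside [E] makes the sequence converge at every point, so that its limit is
   measurable. *)
pose psi k x := f k x * \1_E x.
have mpsi k : measurable_fun setT (psi k) by apply: measurable_funM.
have step x k : E x -> `|D k x| <= Num.sqrt (fine (M x)) / 2 ^+ k.
  move=> Ex; have Mfin : M x \is a fin_num by rewrite ge0_fin_numE.
  have : (h k x <= M x)%E.
    apply: le_trans (@nneseries_lim_ge _ (h ^~ x) predT 0 k.+1 (fun n _ _ => h0 n x)).
    by rewrite big_mkord big_ord_recr/= leeDr// sume_ge0.
  rewrite -(fineK Mfin) lee_fin => hk.
  rewrite -(ler_pXn2r (n := 2))// ?nnegrE ?divr_ge0 ?sqrtr_ge0 ?exprn_ge0//.
  rewrite real_normK ?num_real// exprMn sqr_sqrtr ?fine_ge0//.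
  rewrite exprVn -exprM mulnC exprM (_ : 2 ^+ 2 = 4 :> R); last by rewrite -natrX.
    by rewrite ler_pdivlMr ?exprn_gt0// mulrC.
  by rewrite fineK.
have hlim : forall x, exists2 l : R, (psi k x @[k --> \oo] --> l) &
    forall k, E x -> `|f k x - l| <= 2 * Num.sqrt (fine (M x)) / 2 ^+ k.
  move=> x; have [Ex|nEx] := pselect (E x); last first.
    exists 0 => //; apply: cvg_near_cst; apply: nearW => k.
    by rewrite /psi indicE memNset ?mulr0.
  pose B := Num.sqrt (fine (M x)).
  have B0 : 0 <= B by exact: sqrtr_ge0.
  (* Nested intervals: the increments from rank [k] on add up to at most 2 B / 2^k. *)
  pose lo k := f k x - 2 * B / 2 ^+ k; pose up k := f k x + 2 * B / 2 ^+ k.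
  have e2 k : 2 * B / 2 ^+ k.+1 = 2 * B / 2 ^+ k - B / 2 ^+ k.
    by rewrite exprS; field; rewrite expf_neq0.
  have nd : nondecreasing_seq lo.
    apply/nondecreasing_seqP => k; rewrite /lo e2.
    by have := step x k Ex; rewrite -/B ler_norml /D => /andP[]; lra.
  have ni : nonincreasing_seq up.
    apply/nonincreasing_seqP => k; rewrite /up e2.
    by have := step x k Ex; rewrite -/B ler_norml /D => /andP[]; lra.
  have b0 k : 0 <= 2 * B / 2 ^+ k by rewrite divr_ge0 ?exprn_ge0// mulr_ge0.
  have lup j k : lo j <= up k.
    apply: (@le_trans _ _ (lo (maxn j k))); first by apply: nd; exact: leq_maxl.
    apply: (@le_trans _ _ (up (maxn j k))); last by apply: ni; exact: leq_maxr.
    by rewrite /lo /up; have := b0 (maxn j k); lra.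
  have clo : cvgn lo.
    apply: nondecreasing_is_cvgn => //; exists (up 0) => _ [k _ <-]; exact: lup.
  pose l := limn lo.
  have g0 : (2 * B / 2 ^+ k) @[k --> \oo] --> 0.
    rewrite -(mulr0 (2 * B)); apply: cvgM; first exact: cvg_cst.
    under eq_fun do rewrite -exprVn.
    by apply: cvg_expr; rewrite ger0_norm ?invr_ge0// invf_lt1// ltr1n.
  exists l.
    rewrite (_ : psi^~ x = (fun k => lo k + 2 * B / 2 ^+ k)).
      by rewrite -(addr0 l); apply: cvgD.
    by apply/funext => k; rewrite /psi indicE mem_set// mulr1 /lo subrK.
  move=> k _; rewrite -/B.
  have h1 : lo k <= l by exact: nondecreasing_cvgn_le.
  have h2 : l <= up k by apply: limr_le => //; apply: nearW => j; exact: lup.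
  by rewrite ler_norml; move: h1 h2; rewrite /lo /up; lra.
have [phi hphi] := @choice _ _ (fun (x : T) (l : R) => psi k x @[k --> \oo] --> l /\
    forall k, E x -> `|f k x - l| <= 2 * Num.sqrt (fine (M x)) / 2 ^+ k)
  (fun x => let: ex_intro2 l p q := hlim x in ex_intro _ l (conj p q)).
have mphi : measurable_fun setT phi.
  by apply: (measurable_fun_cvg mpsi) => x _; case: (hphi x).
exists phi => //.
have bd k : (sqint (fun x => f k x - phi x)%R <= (4 / 4 ^+ k)%:E * \int[mu]_x M x)%E.
  rewrite /sqint -ge0_integralZl//=.
  apply: ge0_le_integral => //=.
  - by move=> x _; rewrite lee_fin sqr_ge0.
  - by apply/measurable_EFinP; apply: measurable_sqr; exact: measurable_funB.
  - exact: measurable_funeM.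
  - move=> x _; have [Ex|] := boolP (M x < +oo)%E; last first.
      rewrite -leNgt leye_eq => /eqP ->.
      by rewrite gt0_muley ?leey// lte_fin divr_gt0// exprn_gt0.
    have Mfin : M x \is a fin_num by rewrite ge0_fin_numE.
    rewrite -(fineK Mfin) -EFinM lee_fin.
    have [_ /(_ k Ex) h1] := hphi x.
    rewrite -(real_normK (num_real _)).
    have := lerXn2r 2 _ _ h1; rewrite !nnegrE => /(_ _ _) h2.
    rewrite (le_trans (h2 _ _))// ?divr_ge0 ?mulr_ge0 ?sqrtr_ge0 ?exprn_ge0//.
    rewrite !exprMn sqr_sqrtr ?fine_ge0// exprVn -exprM mulnC exprM.
    by rewrite (_ : 2 ^+ 2 = 4 :> R) -?natrX// mulrAC.
apply: (@squeeze_cvge _ _ _ _ (cst 0%E) _ (fun k => (4 / 4 ^+ k)%:E * \int[mu]_x M x)%E).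
- by apply: nearW => k; rewrite sqint_ge0 bd.
- exact: cvg_cst.
- have If : (\int[mu]_x M x)%E \is a fin_num by rewrite ge0_fin_numE// integral_ge0.
  rewrite -(fineK If); under eq_fun do rewrite -EFinM.
  apply: cvg_EFin; first exact: nearW.
  rewrite -(mul0r (fine (\int[mu]_x M x))%E); apply: cvgM; last exact: cvg_cst.
  rewrite -(mulr0 4); apply: cvgM; first exact: cvg_cst.
  under eq_fun do rewrite -exprVn.
  by apply: cvg_expr; rewrite ger0_norm ?invr_ge0// invf_lt1// ltr1n.
Qed.

End square_integral.

Section fourier_L2.
Context d (T : measurableType d) (R : realType).
Variables (mu : {sigma_finite_measure set T -> \bar R}).
Variables (add : T -> T -> T) (scl : R -> T -> T) (ip : T -> T -> R) (dim : nat).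
Hypothesis eu : euclid mu add scl ip dim.
Implicit Types (x y : T) (u v : T -> R).

Local Notation fre := (fre mu ip).
Local Notation fim := (fim mu ip).
Local Notation dilgauss := (dilgauss scl ip).

Definition L12 u := L1 mu u /\ L1 mu (fun x => u x ^+ 2).

Lemma L12B u v : L12 u -> L12 v -> L12 (fun x => u x - v x).
Proof.
move=> [lu lu2] [lv lv2]; split; first exact: L1B.
have mU := L1_measurable lu; have mv := L1_measurable lv.
apply: (@L1_le _ T _ _ _ (fun x => 2 * u x ^+ 2 + 2 * v x ^+ 2)).
- by apply: measurable_funX; exact: measurable_funB.
- move=> x; rewrite ger0_norm ?sqr_ge0//.
  by have := sqr_ge0 (u x + v x); nra.
- by apply: L1D; exact: L1Z.
Qed.

Lemma freB u v u' v' y : L1 mu u -> L1 mu v -> L1 mu u' -> L1 mu v' ->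
  fre (fun x => u x - u' x) (fun x => v x - v' x) y = fre u v y - fre u' v' y.
Proof.
move=> lu lv lu' lv'; rewrite /fre.
rewrite -(RintegralB measurableT (L1D (L1_cos eu y lu) (L1_sin eu y lv))
  (L1D (L1_cos eu y lu') (L1_sin eu y lv'))).
by apply: eq_Rintegral => x _; ring.
Qed.

Lemma fimB u v u' v' y : L1 mu u -> L1 mu v -> L1 mu u' -> L1 mu v' ->
  fim (fun x => u x - u' x) (fun x => v x - v' x) y = fim u v y - fim u' v' y.
Proof.
move=> lu lv lu' lv'; rewrite /fim.
rewrite -(RintegralB measurableT (L1B (L1_cos eu y lv) (L1_sin eu y lu))
  (L1B (L1_cos eu y lv') (L1_sin eu y lu'))).
by apply: eq_Rintegral => x _; ring.
Qed.

Lemma sqintD (f g : T -> R) : measurable_fun setT f -> measurable_fun setT g ->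
  (\int[mu]_x (f x ^+ 2 + g x ^+ 2)%:E = sqint mu f + sqint mu g)%E.
Proof.
move=> mf mg; under eq_integral do rewrite EFinD.
rewrite ge0_integralD//; try by move=> x _; rewrite lee_fin sqr_ge0.
- by apply/measurable_EFinP; exact: measurable_sqr.
- by apply/measurable_EFinP; exact: measurable_sqr.
Qed.

Lemma fre_sqint u v : L12 u -> L12 v ->
  (sqint mu (fre u v) <= sqint mu u + sqint mu v)%E /\
  (sqint mu (fim u v) <= sqint mu u + sqint mu v)%E.
Proof.
move=> [lu lu2] [lv lv2].
have mU := L1_measurable lu; have mv := L1_measurable lv.
have := bessel eu lu lv lu2 lv2.
rewrite !sqintD//; [|exact: (measurable_fre eu)|exact: (measurable_fim eu)].
by move=> h; split; apply: le_trans h; [rewrite leeDl|rewrite leeDr]; rewrite ?sqint_ge0.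
Qed.

(** With a factor g between 0 and 1, |u g| <= u^2 + g gives integrability. The wider the Gaussian,
    the closer the factor is to 1, and u^2 dominates the squared error. *)
Lemma gauss_truncation u : measurable_fun setT u -> L1 mu (fun x => u x ^+ 2) ->
  [/\ forall k, L12 (fun x => u x * dilgauss k.+1%:R x),
     forall k x, `|u x * dilgauss k.+1%:R x| <= `|u x| &
     sqint mu (fun x => u x * dilgauss k.+1%:R x - u x) @[k --> \oo] --> 0%E].
Proof.
move=> mU lu2.
have k0 k : k.+1%:R != 0 :> R by rewrite pnatr_eq0.
have dgE k x : dilgauss k.+1%:R x = expR (- (pi * ip x x * k.+1%:R^-1 ^+ 2)).
  by rewrite /dilgauss /gaussian !(eu_ipZ eu, eu_ipZr eu); congr (expR (- _)); ring.
have dg0 k x : 0 <= dilgauss k.+1%:R x by exact: expR_ge0.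
have dg1 k x : dilgauss k.+1%:R x <= 1.
  rewrite dgE -expR0 ler_expR oppr_le0; apply: mulr_ge0; last exact: sqr_ge0.
  by rewrite mulr_ge0 ?pi_ge0 ?(eu_ip_ge0 eu).
have mdg k := measurable_dilgauss eu (k0 k).
have ble k x : `|u x * dilgauss k.+1%:R x| <= `|u x|.
  by rewrite normrM ler_piMr// ger0_norm.
have mud k : measurable_fun setT (fun x => u x * dilgauss k.+1%:R x).
  exact: measurable_funM.
have ble2 k x : (u x * dilgauss k.+1%:R x) ^+ 2 <= u x ^+ 2.
  rewrite -(real_normK (num_real (_ * _))) -(real_normK (num_real (u x))).
  by rewrite lerXn2r ?nnegrE.
split => //.
- move=> k; split.
    apply: (@L1_le _ T _ _ _ (fun x => u x ^+ 2 + dilgauss k.+1%:R x)) => //.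
    + move=> x; rewrite normrM (ger0_norm (dg0 k x)) -(real_normK (num_real (u x))).
      have := dg0 k x; have := dg1 k x; have := sqr_ge0 (`|u x| - 1); have := normr_ge0 (u x); nra.
    + by apply: L1D => //; exact: (L1_dilgauss eu (k0 k)).
  apply: (@L1_le _ T _ _ _ (fun x => u x ^+ 2)) => //; first exact: measurable_sqr.
  by move=> x; rewrite ger0_norm ?sqr_ge0.
- have mdif k : measurable_fun setT (fun x => u x * dilgauss k.+1%:R x - u x).
    exact: measurable_funB.
  have difle k x : (u x * dilgauss k.+1%:R x - u x) ^+ 2 <= u x ^+ 2.
    have := dg0 k x; have := dg1 k x; set w := dilgauss _ _ => h1 h0.
    rewrite (_ : _ - _ = u x * (w - 1)); last by ring.
    rewrite exprMn ler_piMr ?sqr_ge0// -(real_normK (num_real (w - 1))) expr_le1//.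
    by rewrite ler_norml; apply/andP; split; lra.
  have ldif k : L1 mu (fun x => (u x * dilgauss k.+1%:R x - u x) ^+ 2).
    apply: (@L1_le _ T _ _ _ (fun x => u x ^+ 2)) => //; first exact: measurable_sqr.
    by move=> x; rewrite ger0_norm ?sqr_ge0.
  have [|||||_ c] := @cvg_Rintegral _ T _ mu
    (fun k x => (u x * dilgauss k.+1%:R x - u x) ^+ 2) (cst 0) (fun x => u x ^+ 2).
  + by move=> k; exact: measurable_sqr.
  + exact: measurable_cst.
  + apply: aeW => x.
    have c1 : dilgauss k.+1%:R x @[k --> \oo] --> (1 : R).
      have c0 : - (pi * ip x x * k.+1%:R^-1 ^+ 2) @[k --> \oo] --> (0 : R).
        rewrite -[X in _ --> X]oppr0; apply: cvgN.
        rewrite -[X in _ --> X](mulr0 (pi * ip x x)).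
        apply: cvgM; first exact: cvg_cst.
        rewrite -[X in _ --> X](mulr0 0).
        by under eq_fun do rewrite expr2; apply: cvgM; exact: cvg_harmonic.
      have c00 : expR (- (pi * ip x x * k.+1%:R^-1 ^+ 2)) @[k --> \oo] --> expR (0 : R).
        exact: cvg_comp c0 (@continuous_expR R 0).
      rewrite expR0 in c00; apply: cvg_trans c00; apply: near_eq_cvg; apply: nearW => k.
      by rewrite dgE.
    have c2 : (u x * dilgauss k.+1%:R x - u x) @[k --> \oo] --> u x * 1 - u x.
      by apply: cvgB; [apply: cvgM => //|]; exact: cvg_cst.
    rewrite mulr1 subrr in c2.
    rewrite (_ : cst 0 x = 0 * 0 :> R); last by rewrite mulr0.
    by under eq_fun do rewrite expr2; apply: cvgM.
  + exact: lu2.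
  + by move=> k x; rewrite ger0_norm ?sqr_ge0.
  move: c; rewrite Rintegral_cst// mul0r => c.
  rewrite (_ : (fun k => _) = (fun k => (\int[mu]_x (u x * dilgauss k.+1%:R x - u x) ^+ 2)%:E)).
    by apply: cvg_EFin => //; exact: nearW.
  by apply/funext => k; rewrite (Rintegral_EFin (ldif k)).
Qed.

(** By Bessel's inequality the transforms of a rapidly convergent sequence of truncations converge
    rapidly too, and Riesz-Fischer provides their limit. *)
Lemma fourier_L2_exists u v : measurable_fun setT u -> measurable_fun setT v ->
  L1 mu (fun x => u x ^+ 2) -> L1 mu (fun x => v x ^+ 2) ->
  exists U V : nat -> T -> R, exists a b : T -> R,
  [/\ forall k, L12 (U k) /\ L12 (V k),
   (measurable_fun setT a /\ L1 mu (fun x => a x ^+ 2)) /\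
   (measurable_fun setT b /\ L1 mu (fun x => b x ^+ 2)),
   (sqint mu (fun x => U k x - u x) @[k --> \oo] --> 0%E) /\
   (sqint mu (fun x => V k x - v x) @[k --> \oo] --> 0%E) &
   (sqint mu (fun x => fre (U k) (V k) x - a x) @[k --> \oo] --> 0%E) /\
   (sqint mu (fun x => fim (U k) (V k) x - b x) @[k --> \oo] --> 0%E)].
Proof.
move=> mU mv lu2 lv2.
have [Lu _ cu] := gauss_truncation mU lu2.
have [Lv _ cv] := gauss_truncation mv lv2.
(* A subsequence with squared errors below 8^-j, the rate under which [riesz_fischer] applies. *)
have /choice[n hn] : forall j, exists k : nat,
    (j <= k)%N /\ (sqint mu (fun x => u x * dilgauss k.+1%:R x - u x)%R < (8^-1 ^+ j)%:E)%E /\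
    (sqint mu (fun x => v x * dilgauss k.+1%:R x - v x)%R < (8^-1 ^+ j)%:E)%E.
  move=> j; near \oo => k; exists k; split; first by near: k; exact: nbhs_infty_ge.
  have e0 : (0 < (8^-1 ^+ j)%:E :> \bar R)%E by rewrite lte_fin exprn_gt0.
  split; near: k.
    by apply: (cu [set r | (r < (8^-1 ^+ j)%:E)%E]); exact: open_ereal_lt'.
  by apply: (cv [set r | (r < (8^-1 ^+ j)%:E)%E]); exact: open_ereal_lt'.
pose U j x := u x * dilgauss (n j).+1%:R x.
pose V j x := v x * dilgauss (n j).+1%:R x.
have LU j : L12 (U j) by exact: Lu.
have LV j : L12 (V j) by exact: Lv.
have mUj j : measurable_fun setT (U j) by case: (LU j) => /L1_measurable.
have mVj j : measurable_fun setT (V j) by case: (LV j) => /L1_measurable.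
have g0 : ((8^-1 ^+ j)%:E : \bar R) @[j --> \oo] --> 0%E.
  apply: cvg_EFin; first exact: nearW.
  by apply: cvg_expr; rewrite ger0_norm ?invr_ge0// invf_lt1// ltr1n.
have cU : sqint mu (fun x => U k x - u x) @[k --> \oo] --> 0%E.
  apply: (@squeeze_cvge _ _ _ _ (cst 0%E) _ (fun j => (8^-1 ^+ j)%:E)) => //; last exact: cvg_cst.
  by apply: nearW => j; rewrite sqint_ge0/=; have [_ [/ltW]] := hn j.
have cV : sqint mu (fun x => V k x - v x) @[k --> \oo] --> 0%E.
  apply: (@squeeze_cvge _ _ _ _ (cst 0%E) _ (fun j => (8^-1 ^+ j)%:E)) => //; last exact: cvg_cst.
  by apply: nearW => j; rewrite sqint_ge0/=; have [_ [_ /ltW]] := hn j.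
(* The bound is 2 * 8^-(j+1) + 2 * 8^-j, below 4 * 8^-j. Real and imaginary parts together account
   for the constant 8 used below. *)
have step (w : T -> R) (W : nat -> T -> R) : measurable_fun setT w ->
    (forall j, measurable_fun setT (W j)) ->
    (forall j, sqint mu (fun x => W j x - w x)%R < (8^-1 ^+ j)%:E)%E ->
    forall j, (sqint mu (fun x => W j.+1 x - W j x)%R <= (4 / 8 ^+ j)%:E)%E.
  move=> mw mW h j.
  apply: (@le_trans _ _ (2%:E * sqint mu (fun x => W j.+1 x - w x)%R +
     2%:E * sqint mu (fun x => W j x - w x)%R)%E).
    apply: sqint_leD; try exact: measurable_funB.
    by move=> x; rewrite (le_trans _ (ler_normB _ _))// opprB addrA subrK.
  apply: (@le_trans _ _ (2%:E * (8^-1 ^+ j.+1)%:E + 2%:E * (8^-1 ^+ j)%:E)%E).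
    by apply: leeD; apply: lee_wpmul2l; rewrite ?lee_fin// ltW.
  rewrite -!EFinM -EFinD lee_fin exprS !exprVn.
  have : 0 <= (8 ^+ j)^-1 :> R by rewrite invr_ge0 exprn_ge0.
  by lra.
have stepU := step u U mU mUj (fun j => (hn j).2.1).
have stepV := step v V mv mVj (fun j => (hn j).2.2).
have mfr j : measurable_fun setT (fre (U j) (V j)) by exact: (measurable_fre eu).
have mfi j : measurable_fun setT (fim (U j) (V j)) by exact: (measurable_fim eu).
have both j := fre_sqint (L12B (LU j.+1) (LU j)) (L12B (LV j.+1) (LV j)).
have sum8 j : (sqint mu (fun x => U j.+1 x - U j x)%R + sqint mu (fun x => V j.+1 x - V j x)%R
    <= (8 / 8 ^+ j)%:E)%E.
  by apply: le_trans (leeD (stepU j) (stepV j)) _; rewrite -EFinD lee_fin; lra.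
have [a ma ca] : exists2 a : T -> R, measurable_fun setT a &
    sqint mu (fun x => fre (U k) (V k) x - a x) @[k --> \oo] --> 0%E.
  apply: (riesz_fischer (C := 8)) => // j.
  have [h _] := both j; apply: le_trans (sum8 j); apply: le_trans h.
  rewrite le_eqVlt; apply/orP; left; apply/eqP; congr sqint; apply/funext => x.
  by rewrite freB//; [exact: (LU _).1|exact: (LV _).1|exact: (LU _).1|exact: (LV _).1].
have [b mb cb] : exists2 b : T -> R, measurable_fun setT b &
    sqint mu (fun x => fim (U k) (V k) x - b x) @[k --> \oo] --> 0%E.
  apply: (riesz_fischer (C := 8)) => // j.
  have [_ h] := both j; apply: le_trans (sum8 j); apply: le_trans h.
  rewrite le_eqVlt; apply/orP; left; apply/eqP; congr sqint; apply/funext => x.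
  by rewrite fimB//; [exact: (LU _).1|exact: (LV _).1|exact: (LU _).1|exact: (LV _).1].
have fin (w : T -> R) (W : nat -> T -> R) : measurable_fun setT w ->
    (forall j, measurable_fun setT (W j)) -> (forall j, sqint mu (W j) < +oo)%E ->
    sqint mu (fun x => W k x - w x) @[k --> \oo] --> 0%E -> L1 mu (fun x => w x ^+ 2).
  move=> mw mW fW cW; apply/L1_sqr => //.
  near \oo => j.
  have hj : (sqint mu (fun x => W j x - w x)%R < 1%:E)%E.
    by near: j; apply: (cW [set r | (r < 1%:E)%E]); apply: open_ereal_lt'; rewrite lte_fin.
  apply: (@le_lt_trans _ _ (2%:E * sqint mu (W j) + 2%:E * sqint mu (fun x => W j x - w x)%R)%E).
    apply: sqint_leD => //; first exact: measurable_funB.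
    by move=> x; rewrite (le_trans _ (ler_normB _ _))// opprB addrC subrK.
  apply: lte_add_pinfty; apply: lte_mul_pinfty => //.
  by rewrite (lt_trans hj)// ltry.
have fsq j : (sqint mu (fre (U j) (V j)) < +oo)%E /\ (sqint mu (fim (U j) (V j)) < +oo)%E.
  have [h1 h2] := fre_sqint (LU j) (LV j).
  have h : (sqint mu (U j) + sqint mu (V j) < +oo)%E.
    by apply: lte_add_pinfty; apply/L1_sqr => //; [case: (LU j)|case: (LV j)].
  by split; [exact: le_lt_trans h1 h|exact: le_lt_trans h2 h].
exists U, V, a, b; split => //; split; split => //.
- by apply: (fin a (fun j => fre (U j) (V j))) => // j; case: (fsq j).
- by apply: (fin b (fun j => fim (U j) (V j))) => // j; case: (fsq j).
Unshelve. all: by end_near. Qed.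

(** [fourier_heat] writes the pairing of [U k] with a heat kernel as a pairing of its transform with
    square-integrable functions, which tends to 0. The pairing also tends to that of [u], which is
    thus orthogonal to all heat kernels. *)
Lemma fourier_L2_injective u v (U V : nat -> T -> R) :
  measurable_fun setT u -> measurable_fun setT v ->
  L1 mu (fun x => u x ^+ 2) -> L1 mu (fun x => v x ^+ 2) ->
  (forall k, L12 (U k) /\ L12 (V k)) ->
  sqint mu (fun x => U k x - u x) @[k --> \oo] --> 0%E ->
  sqint mu (fre (U k) (V k)) @[k --> \oo] --> 0%E ->
  sqint mu (fim (U k) (V k)) @[k --> \oo] --> 0%E ->
  {ae mu, forall x, u x = 0}.
Proof.
move=> mU mv lu2 lv2 LUV cU cr ci.
apply: (square_integrable_uniqueness eu mU lu2) => c y c0.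
have cn0 : c != 0 by rewrite gt_eqF.
have cd : c ^+ dim != 0 by rewrite expf_neq0.
have mUk k : measurable_fun setT (U k) by have [[/L1_measurable]] := LUV k.
have mVk k : measurable_fun setT (V k) by have [_ [/L1_measurable]] := LUV k.
have lh : L1 mu (heat ip c y) by apply: eq_L1 (L1_heat eu y cn0) => x; rewrite (heatC eu).
have mh := L1_measurable lh.
have lh2 : L1 mu (fun x => heat ip c y x ^+ 2).
  apply: (@L1_le _ T _ _ _ (heat ip c y)) => //; first exact: measurable_sqr.
  move=> x; rewrite ger0_norm ?sqr_ge0// expr2 ler_piMr ?heat_ge0//.
  exact: (heat_le1 eu c y x).
have mdg := measurable_dilgauss eu cn0.
have ldg2 (f : T -> R) : measurable_fun setT f -> (forall x, `|f x| <= 1) ->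
    L1 mu (fun x => (f x * dilgauss c x) ^+ 2).
  move=> mf f1.
  apply: (@L1_le _ T _ _ _ (dilgauss c)); last exact: (L1_dilgauss eu cn0).
    by apply: measurable_sqr; exact: measurable_funM.
  move=> x; rewrite ger0_norm ?sqr_ge0// exprMn.
  have d0 : 0 <= dilgauss c x by exact: expR_ge0.
  have d1 : dilgauss c x <= 1.
    by rewrite -expR0 ler_expR oppr_le0 mulr_ge0 ?pi_ge0// (eu_ip_ge0 eu).
  rewrite -(real_normK (num_real (f x))).
  have h1 : `|f x| ^+ 2 <= 1 by rewrite expr_le1.
  have h2 : dilgauss c x ^+ 2 <= dilgauss c x by rewrite expr2 ler_piMr.
  by rewrite -[leRHS]mul1r ler_pM// sqr_ge0.
have mcy : measurable_fun setT (fun z => cos (2 * pi * ip z y) : R).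
  apply: measurableT_comp; first exact: measurable_cos.
  by apply: measurable_funM => //; exact: (measurable_ip2 eu y).
have msy : measurable_fun setT (fun z => sin (2 * pi * ip z y) : R).
  apply: measurableT_comp; first exact: measurable_sin.
  by apply: measurable_funM => //; exact: (measurable_ip2 eu y).
have mfr j : measurable_fun setT (fre (U j) (V j)) by exact: (measurable_fre eu).
have mfi j : measurable_fun setT (fim (U j) (V j)) by exact: (measurable_fim eu).
have c1 := cvg_inner0 mfr (measurable_funM mcy mdg) cr (ldg2 _ mcy (fun x => cos_bound _)).
have c2 := cvg_inner0 mfi (measurable_funM msy mdg) ci (ldg2 _ msy (fun x => sin_bound _)).
have c3 := cvg_inner0 (fun k => measurable_funB (mUk k) mU) mh cU lh2.
have lUh k : L1 mu (fun x => U k x * heat ip c y x).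
  apply: (L1_bounded (M := 1)) => //; first by have [[]] := LUV k.
  by move=> x; rewrite ger0_norm ?heat_ge0// (heat_le1 eu).
have luh : L1 mu (fun x => u x * heat ip c y x).
  apply: (@L1_le _ T _ _ _ (fun x => u x ^+ 2 + heat ip c y x ^+ 2)); [exact: measurable_funM| |exact: L1D].
  move=> x; rewrite normrM -(real_normK (num_real (u x))) -(real_normK (num_real (heat ip c y x))).
  by have := sqr_ge0 (`|u x| - `|heat ip c y x|); have := normr_ge0 (u x);
    have := normr_ge0 (heat ip c y x); nra.
have bdl k (f : T -> R) : measurable_fun setT f -> (forall x, `|f x| <= 1) ->
   (L1 mu (fun z => fre (U k) (V k) z * (f z * dilgauss c z))) /\
   (L1 mu (fun z => fim (U k) (V k) z * (f z * dilgauss c z))).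
  move=> mf f1; have [[lU _] [lV _]] := LUV k.
  have lfd : L1 mu (fun z => f z * dilgauss c z).
    under eq_fun do rewrite mulrC.
    by apply: (L1_bounded (M := 1)) => //; exact: (L1_dilgauss eu cn0).
  split; under eq_fun do rewrite mulrC.
  - by apply: (L1_bounded lfd) => // z; exact: (fre_bound eu z lU lV).
  - by apply: (L1_bounded lfd) => // z; exact: (fim_bound eu z lU lV).
have c4 : c ^+ dim * \int[mu]_x (U k x * heat ip c y x) @[k --> \oo] --> 0 - 0.
  rewrite (_ : (fun k => _) = (fun k =>
    \int[mu]_x (fre (U k) (V k) x * (cos (2 * pi * ip x y) * dilgauss c x)) -
    \int[mu]_x (fim (U k) (V k) x * (sin (2 * pi * ip x y) * dilgauss c x)))).
    exact: cvgB c1 c2.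
  apply/funext => k; have [[lU _] [lV _]] := LUV k.
  rewrite -(fourier_heat eu y c0 lU lV).
  have [l1 _] := bdl k _ mcy (fun x => cos_bound _).
  have [_ l2] := bdl k _ msy (fun x => sin_bound _).
  by rewrite -(RintegralB measurableT l1 l2); apply: eq_Rintegral => z _; ring.
have c5 : \int[mu]_x (U k x * heat ip c y x) @[k --> \oo] --> \int[mu]_x (u x * heat ip c y x).
  rewrite -[X in _ --> X]add0r.
  rewrite (_ : (fun k => _) = (fun k => \int[mu]_x ((U k \- u) x * heat ip c y x) +
    \int[mu]_x (u x * heat ip c y x))); first by apply: cvgD c3 _; exact: cvg_cst.
  apply/funext => k.
  have l : L1 mu (fun x => (U k \- u) x * heat ip c y x).
    by apply: eq_L1 (L1B (lUh k) luh) => x /=; ring.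
  by rewrite -(RintegralD measurableT l luh); apply: eq_Rintegral => z _ /=; ring.
apply: (mulfI cd); rewrite mulr0 -[RHS](subr0 0).
apply: (cvg_unique _ _ c4) => //.
by apply: cvgM => //; exact: cvg_cst.
Qed.

End fourier_L2.

(** * A Liouville theorem *)

Section exponential_series.
Variable R : realType.
Implicit Types (x s t : R) (k n : nat).

Definition cosc k : R := (~~ odd k)%:R * (-1) ^+ k./2 / k`!%:R.
(** A Taylor coefficient of the sine; no relation to the cardinal sine. *)
Definition sinc k : R := (odd k)%:R * (-1) ^+ k.-1./2 / k`!%:R.

Lemma cos_coeff_cosc x k : cos_coeff x k = cosc k * x ^+ k.
Proof. by rewrite /cos_coeff /cosc /= mulrAC. Qed.

Lemma sin_coeff_sinc x k : sin_coeff x k = sinc k * x ^+ k.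
Proof. by rewrite /sin_coeff /sinc /= mulrAC. Qed.

Lemma cosc_le k : `|cosc k| <= k`!%:R^-1.
Proof.
rewrite /cosc !normrM normrX normrN1 expr1n mulr1 normfV !normr_nat.
by rewrite ler_piMl ?invr_ge0//; case: (odd k).
Qed.

Lemma sinc_le k : `|sinc k| <= k`!%:R^-1.
Proof.
rewrite /sinc !normrM normrX normrN1 expr1n mulr1 normfV !normr_nat.
by rewrite ler_piMl ?invr_ge0//; case: (odd k).
Qed.

Lemma cvg_cosc x : (\sum_(k < n) cosc k * x ^+ k) @[n --> \oo] --> cos x.
Proof.
have c := @is_cvg_series_cos_coeff R x; rewrite cos.unlock.
have E : (fun n => \sum_(k < n) cosc k * x ^+ k) = series (cos_coeff x).
  by apply/funext => n; rewrite /series/= big_mkord; apply: eq_bigr => k _; rewrite cos_coeff_cosc.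
by rewrite E.
Qed.

Lemma cvg_sinc x : (\sum_(k < n) sinc k * x ^+ k) @[n --> \oo] --> sin x.
Proof.
have c := @is_cvg_series_sin_coeff R x; rewrite sin.unlock.
have E : (fun n => \sum_(k < n) sinc k * x ^+ k) = series (sin_coeff x).
  by apply/funext => n; rewrite /series/= big_mkord; apply: eq_bigr => k _; rewrite sin_coeff_sinc.
by rewrite E.
Qed.

Lemma cvg_expc x : (\sum_(k < n) k`!%:R^-1 * x ^+ k) @[n --> \oo] --> expR x.
Proof.
have := @is_cvg_series_exp_coeff R x; rewrite /expR => c.
have E : (fun n => \sum_(k < n) k`!%:R^-1 * x ^+ k) = series (exp_coeff x).
  by apply/funext => n; rewrite /series/= big_mkord; apply: eq_bigr => k _; rewrite mulrC.
by rewrite E.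
Qed.

Lemma expc_le x n : 0 <= x -> \sum_(k < n) k`!%:R^-1 * x ^+ k <= expR x.
Proof.
move=> x0; rewrite -(cvg_lim _ (@cvg_expc x))//.
apply: (nondecreasing_cvgn_le (u_ := fun n => \sum_(k < n) k`!%:R^-1 * x ^+ k)).
  apply/nondecreasing_seqP => m; rewrite big_ord_recr/= lerDl.
  by rewrite mulr_ge0 ?invr_ge0// exprn_ge0.
by apply/cvg_ex; eexists; exact: (@cvg_expc x).
Qed.

Lemma exp_series_bound (c : nat -> R) x n : (forall k, `|c k| <= k`!%:R^-1) ->
  `|\sum_(k < n) c k * x ^+ k| <= expR `|x|.
Proof.
move=> hc; apply: le_trans (expc_le n (normr_ge0 x)).
rewrite (le_trans (ler_norm_sum _ _ _))//; apply: ler_sum => k _.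
by rewrite normrM normrX ler_wpM2r// exprn_ge0.
Qed.

(** One term of the series of exp(t |s|) is at most its sum. *)
Lemma power_le_exp j s t : 0 < t ->
  `|s| ^+ j <= j`!%:R / t ^+ j * expR (t * `|s|).
Proof.
move=> t0; have tj : 0 < t ^+ j by exact: exprn_gt0.
have f0 : j`!%:R != 0 :> R by rewrite pnatr_eq0 -lt0n fact_gt0.
rewrite (_ : `|s| ^+ j = j`!%:R / t ^+ j * (j`!%:R^-1 * (t * `|s|) ^+ j)); last first.
  by rewrite exprMn; field; rewrite f0 gt_eqF.
rewrite ler_wpM2l ?divr_ge0 ?(ltW tj)//.
have h0 : 0 <= t * `|s| by rewrite mulr_ge0// ltW.
apply: le_trans (expc_le j.+1 h0).
rewrite big_ord_recr/= lerDr; apply: sumr_ge0 => k _.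
by rewrite mulr_ge0 ?invr_ge0// exprn_ge0.
Qed.

Lemma expR_sub1_le x : expR x - 1 <= x * expR x.
Proof.
have := expR_ge1Dx (- x); rewrite expRN => h.
have e := expR_gt0 x.
have : (1 - x) * expR x <= 1 by rewrite -ler_pdivlMr// div1r.
by lra.
Qed.

Lemma expR_sub1_norm x : `|expR x - 1| <= `|x| * expR `|x|.
Proof.
have [x0|x0] := lerP 0 x.
  by rewrite (ger0_norm x0) ger0_norm ?subr_ge0 ?expR_sub1_le// -expR0 ler_expR.
rewrite ler0_norm; last by rewrite subr_le0 -expR0 ler_expR ltW.
rewrite opprB (ltr0_norm x0).
have h1 := expR_ge1Dx x.
have : 1 <= expR (- x) by rewrite -expR0 ler_expR lerNr oppr0 ltW.
by nra.
Qed.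

End exponential_series.

Section two_sided_laplace.
Context d (Z : measurableType d) (R : realType).
Variables (m : {measure set Z -> \bar R}) (w s1 s2 : Z -> R) (eta : R).
Hypothesis mw : measurable_fun setT w.
Hypothesis ms1 : measurable_fun setT s1.
Hypothesis ms2 : measurable_fun setT s2.
Hypothesis eta0 : 0 < eta.
Hypothesis lw : L1 m (fun z => `|w z| * (expR (3 * eta * `|s1 z|) + expR (3 * eta * `|s2 z|))).
Local Notation RT := (measurableTypeR R).
Implicit Types (phi psi : RT -> R).

(** A linear functional on test functions of growth at most exp(3 eta |s|). It vanishes on exp(t s)
    for small [t >= 0]; the aim is to show that it vanishes on products of cosines. *)
Let Lam phi := \int[m]_z (w z * (phi (s1 z) - phi (s2 z))).

Let dom phi := measurable_fun setT phi /\
  exists C, forall s, `|phi s| <= C * expR (3 * eta * `|s|).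

Let dom_L1 phi : dom phi -> L1 m (fun z => w z * (phi (s1 z) - phi (s2 z))).
Proof.
move=> [mp [C hC]]; have := L1Z C lw; apply: L1_le.
  apply: measurable_funM => //; apply: measurable_funB; exact: measurableT_comp.
move=> z; rewrite normrM mulrCA ler_wpM2l//.
by rewrite (le_trans (ler_normB _ _))// mulrDr lerD.
Qed.

Let dom_lin (a b : R) phi psi : dom phi -> dom psi ->
  dom (fun s => a * phi s + b * psi s).
Proof.
move=> [mp [C hC]] [mq [D hD]]; split; first by apply: measurable_funD; exact: measurable_funM.
exists (`|a| * C + `|b| * D) => s; rewrite (le_trans (ler_normD _ _))// !normrM.
move: (hC s) (hD s); set E := expR _ => hCs hDs.
by rewrite mulrDl -!mulrA lerD// ler_wpM2l.
Qed.

Let Lam_lin (a b : R) phi psi : dom phi -> dom psi ->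
  Lam (fun s => a * phi s + b * psi s) = a * Lam phi + b * Lam psi.
Proof.
move=> dp dq; have lp := dom_L1 dp; have lq := dom_L1 dq.
rewrite /Lam -(RintegralZl a measurableT lp) -(RintegralZl b measurableT lq).
rewrite -(RintegralD measurableT (L1Z a lp) (L1Z b lq)).
by apply: eq_Rintegral => z _; ring.
Qed.

Let Lam_cvg (phi : nat -> RT -> R) psi (C : R) :
  (forall n, measurable_fun setT (phi n)) -> measurable_fun setT psi ->
  (forall n s, `|phi n s| <= C * expR (3 * eta * `|s|)) ->
  (forall s, phi n s @[n --> \oo] --> psi s) ->
  (forall n, Lam (phi n) = 0) -> Lam psi = 0.
Proof.
move=> mp mq hC cp L0.
have mm phi' : measurable_fun setT phi' -> measurable_fun setT (fun z => w z * (phi' (s1 z) - phi' (s2 z))).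
  by move=> mp'; apply: measurable_funM => //; apply: measurable_funB; exact: measurableT_comp.
have [|||||_ c] := @cvg_Rintegral _ Z _ m (fun n z => w z * (phi n (s1 z) - phi n (s2 z)))
  (fun z => w z * (psi (s1 z) - psi (s2 z)))
  (fun z => C * (`|w z| * (expR (3 * eta * `|s1 z|) + expR (3 * eta * `|s2 z|)))).
- by move=> n; exact: mm.
- exact: mm.
- by apply: aeW => z; apply: cvgM; [exact: cvg_cst|apply: cvgB].
- exact: L1Z.
- move=> n z; rewrite normrM mulrCA ler_wpM2l//.
  by rewrite (le_trans (ler_normB _ _))// mulrDr lerD.
apply: (cvg_unique _ c) => //.
by rewrite (_ : (fun n => _) = cst 0); [exact: cvg_cst|apply/funext => n; exact: L0].
Qed.

Hypothesis L0 : forall t, 0 <= t < eta -> \int[m]_z (w z * (expR (t * s1 z) - expR (t * s2 z))) = 0.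

Let mpow j : measurable_fun setT (fun s : RT => s ^+ j).
Proof. exact: measurable_funX. Qed.

Let mexp t : measurable_fun setT (fun s : RT => expR (t * s)).
Proof. by apply: measurableT_comp => //; exact: measurable_funM. Qed.

(** One of the three [eta] of the weight absorbs the power, which leaves two for exponentials. *)
Let pow_dom j : exists C, 0 <= C /\
  forall s : R, `|s ^+ j| * expR (2 * eta * `|s|) <= C * expR (3 * eta * `|s|).
Proof.
exists (j`!%:R / eta ^+ j); split; first by rewrite divr_ge0// exprn_ge0// ltW.
move=> s; rewrite (_ : 3 * eta * `|s| = eta * `|s| + 2 * eta * `|s|); last by ring.
rewrite expRD mulrA ler_wpM2r ?expR_ge0// normrX; exact: power_le_exp.
Qed.

Let powexp_dom j t : 0 <= t < eta -> dom (fun s => s ^+ j * expR (t * s)).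
Proof.
move=> /andP[t0 te]; split; first exact: measurable_funM.
have [C [C0 hC]] := pow_dom j; exists C => s; apply: le_trans (hC s).
rewrite normrM ler_wpM2l// ger0_norm ?expR_ge0// ler_expR.
rewrite (le_trans (ler_norm _))// normrM (ger0_norm t0) ler_wpM2r//.
by lra.
Qed.

(** Each further power of [s] is a derivative in [t], obtained as a limit of difference quotients by
    dominated convergence. *)
Let moment_exp j t : 0 <= t < eta -> Lam (fun s => s ^+ j * expR (t * s)) = 0.
Proof.
elim: j t => [|j IH] t te.
  by rewrite -(L0 te); apply: eq_Rintegral => z _; rewrite !mul1r.
have /andP[t0 t1] := te.
(* Positive increments only, because [t] may be 0; with [n.+2] the point [t + h n] stays strictly
   below [eta]. *)
pose h n : R := (eta - t) / n.+2%:R.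
have h0 n : 0 < h n by rewrite divr_gt0// subr_gt0.
have hn n : h n < eta - t.
  by rewrite ltr_pdivrMr// ltr_pMr ?subr_gt0// ltr1n.
have [C [C0 hC]] := pow_dom j.+1.
apply: (@Lam_cvg (fun n s => (h n)^-1 * (s ^+ j * expR ((t + h n) * s)) +
  (- (h n)^-1) * (s ^+ j * expR (t * s))) _ C).
- by move=> n; apply: measurable_funD; apply: measurable_funM => //; exact: measurable_funM.
- exact: measurable_funM.
- move=> n s; apply: le_trans (hC s).
  rewrite (_ : _ + _ = s ^+ j * expR (t * s) * ((expR (h n * s) - 1) / h n)); last first.
    by rewrite mulrDl expRD; field; rewrite gt_eqF.
  rewrite !normrM normfV (gtr0_norm (h0 n)).
  apply: (@le_trans _ _ (`|s ^+ j| * expR (t * `|s|) * (`|s| * expR (h n * `|s|)))).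
    rewrite ler_pM ?mulr_ge0 ?invr_ge0 ?(ltW (h0 n))//.
      rewrite ler_wpM2l// ger0_norm ?expR_ge0// ler_expR ler_wpM2l//; exact: ler_norm.
    rewrite ler_pdivrMr// (le_trans (expR_sub1_norm _))// normrM (gtr0_norm (h0 n)).
    by rewrite le_eqVlt; apply/orP; left; apply/eqP; ring.
  rewrite exprSr normrM (_ : _ * _ = `|s ^+ j| * `|s| * expR ((t + h n) * `|s|)); last first.
    by rewrite mulrDl expRD; ring.
  rewrite ler_wpM2l ?mulr_ge0// ler_expR ler_wpM2r//.
  by have := hn n; lra.
- move=> s.
  rewrite (_ : (fun n => _) = (fun n => s ^+ j * expR (t * s) * ((expR (h n * s) - 1) / h n))); last first.
    by apply/funext => n; rewrite mulrDl expRD; field; rewrite gt_eqF.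
  rewrite (_ : s ^+ j.+1 * expR (t * s) = s ^+ j * expR (t * s) * s); last by rewrite exprS; ring.
  apply: cvgM; first exact: cvg_cst.
  have ch : h n @[n --> \oo] --> 0.
    rewrite -(mulr0 (eta - t)); apply: cvgM; first exact: cvg_cst.
    by have := @cvg_harmonic R; rewrite -cvg_shiftS.
  apply: (@squeeze_cvgr _ _ _ _ (cst s) (fun n => s * expR (h n * s))).
  + apply: nearW => n; rewrite /= ler_pdivlMr// ler_pdivrMr//; apply/andP; split.
      by have := expR_ge1Dx (h n * s); lra.
    by have := expR_sub1_le (h n * s); lra.
  + exact: cvg_cst.
  + rewrite -[X in _ --> X]mulr1; apply: cvgM; first exact: cvg_cst.
    have c0 : h n * s @[n --> \oo] --> 0.
      by rewrite -[X in _ --> X](mul0r s); apply: cvgM => //; exact: cvg_cst.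
    have := cvg_comp _ _ c0 (@continuous_expR R 0); rewrite expR0; exact.
- move=> n.
  have hth : 0 <= t + h n < eta.
    by apply/andP; split; [rewrite addr_ge0// ltW|have := hn n; lra].
  rewrite Lam_lin; [|exact: powexp_dom|exact: powexp_dom].
  by rewrite !IH// !mulr0 addr0.
Qed.

(** Asking for all powers [s ^+ j] at once makes the class stable under multiplication by the power
    series of cosine and sine. *)
Let good phi := [/\ measurable_fun setT phi, forall s, `|phi s| <= 1 &
  forall j, Lam (fun s => phi s * s ^+ j) = 0].

Let good1 : good (cst 1).
Proof.
split; [exact: measurable_cst|by move=> s; rewrite normr1|move=> j].
have h : 0 <= (0 : R) < eta by rewrite lexx eta0.
rewrite -(moment_exp j h); apply: eq_Rintegral => z _.
by rewrite !mul0r expR0 !mulr1 !mul1r.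
Qed.

Let good_dom phi j : measurable_fun setT phi -> (forall s, `|phi s| <= 1) ->
  dom (fun s => phi s * s ^+ j).
Proof.
move=> mp p1; split; first exact: measurable_funM.
have [C [C0 hC]] := pow_dom j; exists C => s; apply: le_trans (hC s).
rewrite normrM (@le_trans _ _ (`|s ^+ j|))// ?ler_piMl// ler_peMr//.
by rewrite -expR0 ler_expR !mulr_ge0// ltW.
Qed.

(** Term by term each summand is killed by [good phi]; the partial sums are dominated by exp(eta
    |s|), which is why [t] is limited to [eta] here. *)
Let good_series phi psi (c : nat -> R) t : good phi -> `|t| <= eta ->
  (forall k, `|c k| <= k`!%:R^-1) ->
  (forall x : R, (\sum_(k < n) c k * x ^+ k) @[n --> \oo] --> psi x) ->
  measurable_fun setT psi -> (forall s, `|psi s| <= 1) ->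
  good (fun s => phi s * psi (t * s)).
Proof.
move=> [mp p1 g] te hc cpsi mpsi psi1.
have mpt : measurable_fun setT (fun s : RT => psi (t * s)).
  by apply: measurableT_comp mpsi _; exact: measurable_funM.
split; first exact: measurable_funM.
  by move=> s; rewrite normrM -[leRHS](mulr1 1) ler_pM.
move=> j; have [C [C0 hC]] := pow_dom j.
apply: (@Lam_cvg (fun n s => \sum_(k < n) (c k * t ^+ k) * (phi s * s ^+ (k + j))) _ C).
- by move=> n; apply: measurable_sum => k; apply: measurable_funM => //; exact: measurable_funM.
- by apply: measurable_funM => //; exact: measurable_funM.
- move=> n s; apply: le_trans (hC s).
  rewrite (_ : \sum_(k < n) _ = phi s * s ^+ j * \sum_(k < n) c k * (t * s) ^+ k); last first.
    by rewrite big_distrr/=; apply: eq_bigr => k _; rewrite exprMn exprD; ring.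
  rewrite normrM; apply: ler_pM => //.
    by rewrite normrM ler_piMl.
  apply: le_trans (exp_series_bound _ _ hc) _; rewrite ler_expR normrM.
  by rewrite ler_wpM2r// (le_trans te)// ler_peMl ?(ltW eta0)// ler1n.
- move=> s; rewrite (_ : (fun n => _) =
    (fun n => phi s * s ^+ j * \sum_(k < n) c k * (t * s) ^+ k)); last first.
    apply/funext => n; rewrite big_distrr/=; apply: eq_bigr => k _.
    by rewrite exprMn exprD; ring.
  by rewrite mulrAC; apply: cvgM; [exact: cvg_cst|exact: cpsi].
- move=> n.
  have [//] : dom (fun s => \sum_(k < n) (c k * t ^+ k) * (phi s * s ^+ (k + j))) /\
     Lam (fun s => \sum_(k < n) (c k * t ^+ k) * (phi s * s ^+ (k + j))) = 0.
  elim: n => [|n [IHd IH]].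
    split.
      split; first by under eq_fun do rewrite big_ord0; exact: measurable_cst.
      by exists 0 => s; rewrite big_ord0 normr0 mul0r.
    rewrite /Lam (_ : (fun z => _) = cst 0) ?Rintegral_cst ?mul0r//.
    by apply/funext => z; rewrite !big_ord0 subrr mulr0.
  have E : (fun s => \sum_(k < n.+1) (c k * t ^+ k) * (phi s * s ^+ (k + j))) =
      (fun s => 1 * (\sum_(k < n) (c k * t ^+ k) * (phi s * s ^+ (k + j))) +
         (c n * t ^+ n) * (phi s * s ^+ (n + j))).
    by apply/funext => s; rewrite big_ord_recr/= mul1r.
  have dn := good_dom (n + j) mp p1.
  rewrite E; split; first exact: dom_lin.
  by rewrite Lam_lin// IH g !mulr0 addr0.
Qed.

Let good_lin (a b : R) phi psi : good phi -> good psi ->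
  (forall s, `|a * phi s + b * psi s| <= 1) -> good (fun s => a * phi s + b * psi s).
Proof.
move=> [mp p1 gp] [mq q1 gq] h1; split => //.
  by apply: measurable_funD; exact: measurable_funM.
move=> j.
rewrite (_ : (fun s => _) = (fun s => a * (phi s * s ^+ j) + b * (psi s * s ^+ j))).
  by rewrite Lam_lin; [rewrite gp gq !mulr0 addr0|exact: good_dom|exact: good_dom].
by apply/funext => s; ring.
Qed.

(** The series argument reaches frequencies up to [eta] only. The double-angle formulas express
    frequency [t] through [t / 2], so that [n] doublings reach 2^n eta. *)
Let good_trig n t phi : good phi -> `|t| <= 2 ^+ n * eta ->
  good (fun s => phi s * cos (t * s)) /\ good (fun s => phi s * sin (t * s)).
Proof.
elim: n t phi => [|n IH] t phi gphi te.
  rewrite expr0 mul1r in te; split.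
    apply: (good_series gphi te (@cosc_le R) (@cvg_cosc R)); [exact: measurable_cos|exact: cos_bound].
  apply: (good_series gphi te (@sinc_le R) (@cvg_sinc R)); [exact: measurable_sin|exact: sin_bound].
have te2 : `|t / 2| <= 2 ^+ n * eta.
  by rewrite normrM (@ger0_norm _ 2^-1) ?invr_ge0// ler_pdivrMr// mulrAC -exprSr.
have [gc gs] := IH _ _ gphi te2.
have [gcc _] := IH _ _ gc te2; have [_ gcs] := IH _ _ gc te2.
have cos2 s : phi s * cos (t * s) =
    2 * (phi s * cos (t / 2 * s) * cos (t / 2 * s)) + (-1) * phi s.
  rewrite (_ : t * s = t / 2 * s + t / 2 * s); last by field.
  rewrite cosD; have := cos2Dsin2 (t / 2 * s); rewrite !expr2 => e.
  rewrite (_ : sin _ * sin _ = 1 - cos (t / 2 * s) * cos (t / 2 * s)); last by lra.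
  by ring.
(* The zero term gives the right side the form of [good_lin]. *)
have sin2 s : phi s * sin (t * s) =
    2 * (phi s * cos (t / 2 * s) * sin (t / 2 * s)) + 0 * phi s.
  rewrite (_ : t * s = t / 2 * s + t / 2 * s); last by field.
  by rewrite sinD; ring.
have [_ p1 _] := gphi.
split.
- rewrite (_ : (fun s => _) = (fun s => 2 * (phi s * cos (t / 2 * s) * cos (t / 2 * s)) + (-1) * phi s)).
    apply: good_lin => // s; rewrite -cos2 normrM -[leRHS](mulr1 1) ler_pM//; exact: cos_bound.
  by apply/funext => s; exact: cos2.
- rewrite (_ : (fun s => _) = (fun s => 2 * (phi s * cos (t / 2 * s) * sin (t / 2 * s)) + 0 * phi s)).
    apply: good_lin => // s; rewrite -sin2 normrM -[leRHS](mulr1 1) ler_pM//; exact: sin_bound.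
  by apply/funext => s; exact: sin2.
Qed.

Let good_shift t b phi : good phi -> good (fun s => phi s * cos (t * (s - b))).
Proof.
move=> gphi; have [n hn] : exists n, `|t| <= 2 ^+ n * eta.
  near \oo => n; exists n; rewrite -ler_pdivrMr//.
  apply: (@le_trans _ _ n%:R); first by near: n; exact: nbhs_infty_ger.
  by rewrite -natrX ler_nat ltnW// ltn_expl.
have [gc gs] := good_trig gphi hn; have [_ p1 _] := gphi.
have E s : phi s * cos (t * (s - b)) =
    cos (t * b) * (phi s * cos (t * s)) + sin (t * b) * (phi s * sin (t * s)).
  by rewrite mulrBr cosB; ring.
rewrite (_ : (fun s => _) = (fun s => cos (t * b) * (phi s * cos (t * s)) +
   sin (t * b) * (phi s * sin (t * s)))).
  apply: good_lin => // s; rewrite -E normrM -[leRHS](mulr1 1) ler_pM//; exact: cos_bound.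
by apply/funext => s; exact: E.
Unshelve. all: by end_near. Qed.

(* Only Laplace integrals with real parameter are assumed to vanish; power series
   expansions turn them into Fourier integrals. At an integer [s != b] the product is
   zero as soon as [J] is large. *)
Lemma two_sided_laplace b J :
  let psi := fun s : R => \prod_(i < J) cos (pi / 2 ^+ i.+1 * (s - b)) in
  \int[m]_z (w z * (psi (s1 z) - psi (s2 z))) = 0.
Proof.
move=> psi; suff [_ _ /(_ 0)] : good psi.
  by move=> <-; apply: eq_Rintegral => z _; rewrite !expr0 !mulr1.
rewrite {}/psi; elim: J => [|J IH].
  by rewrite (_ : (fun s => _) = cst 1)//; apply/funext => s; rewrite big_ord0.
have := good_shift (pi / 2 ^+ J.+1) b IH.
rewrite (_ : (fun s => _) = (fun s => \prod_(i < J.+1) cos (pi / 2 ^+ i.+1 * (s - b))))//.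
by apply/funext => s; rewrite big_ord_recr.
Qed.

End two_sided_laplace.

Section counting.
Variable R : realType.
Local Notation count := (@counting nat R).

Lemma measurable_nat (f : nat -> R) : measurable_fun setT f.
Proof. by []. Qed.

Lemma L1_countP (c : nat -> R) (M : R) :
  (forall n, \sum_(k < n) `|c k| <= M) -> L1 count c.
Proof.
move=> h; apply/L1P; first exact: measurable_nat.
rewrite ge0_integral_count//; apply: (@le_lt_trans _ _ M%:E); last exact: ltry.
apply: lime_le; first exact: is_cvg_nneseries.
by apply: nearW => n; rewrite sumEFin lee_fin big_mkord.
Qed.

Lemma Rintegral_count (c : nat -> R) (l : R) : L1 count c ->
  (\sum_(k < n) c k) @[n --> \oo] --> l -> \int[count]_k c k = l.
Proof.
move=> lc cl; rewrite /Rintegral integral_count; last first.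
  have [_] := integrableP _ _ _ lc; rewrite /= ge0_integral_count// => h.
  by rewrite /summable -nneseries_esumT.
rewrite (_ : limn _ = l%:E)//; apply/cvg_lim => //.
rewrite (_ : (fun n => _) = (fun n => (\sum_(k < n) c k)%:E)).
  by apply: cvg_EFin => //; exact: nearW.
by apply/funext => n; rewrite sumEFin big_mkord.
Qed.

Lemma counting1 k : count [set k] = 1%E.
Proof.
have f1 : finite_set [set k] by exact: finite_set1.
by rewrite /counting asboolT// fset_set1 finmap.cardfs1.
Qed.

Lemma cos_odd_pihalf j : cos (pi / 2 * j.*2.+1%:R) = 0 :> R.
Proof.
elim: j => [|j IH]; first by rewrite mulr1 cos_pihalf.
rewrite (_ : pi / 2 * j.+1.*2.+1%:R = pi / 2 * j.*2.+1%:R + pi).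
  by rewrite cosDpi IH oppr0.
by rewrite doubleS -!natr1; field.
Qed.

(** Write n as 2^i times an odd number: the argument is then an odd multiple of pi / 2. *)
Lemma cos_dyadic n : (0 < n)%N -> exists i, cos (pi / 2 ^+ i.+1 * n%:R) = 0 :> R.
Proof.
elim/ltn_ind: n => n IH n0; have [on|en] := boolP (odd n).
  exists 0; rewrite expr1 -(odd_double_half n) on add1n; exact: cos_odd_pihalf.
have n2 : (0 < n./2)%N by rewrite half_gt0; case: n n0 en {IH} => [//|[//|]].
have nlt : (n./2 < n)%N by rewrite -{2}(even_halfK en) -addnn -[ltnLHS]addn0 ltn_add2l.
have [i hi] := IH _ nlt n2; exists i.+1.
rewrite -hi; congr cos; rewrite -{1}(even_halfK en) -muln2 natrM [in LHS]exprS.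
by field; rewrite expf_neq0.
Qed.

(* Stands in for Liouville's theorem on the annulus [1/r < |l| < r], where both sides
   are holomorphic; with [l = expR t] it is a statement on Laplace transforms. *)
Lemma laurent_vanishing (a : nat -> R) (r : R) (d : nat) : 1 < r -> (0 < d)%N ->
  L1 count (fun k => `|a k| * r ^+ k) ->
  (forall l : R, 1 <= l < r -> l ^+ d * \int[count]_k (a k * l ^+ k) =
     \int[count]_k (a k * l^-1 ^+ k)) ->
  forall k, a k = 0.
Proof.
move=> r1 d0 la fe k0; have r0 : 0 < r by lra.
pose eta : R := ln r / 3.
have eta0 : 0 < eta by rewrite divr_gt0// ln_gt0.
have e3 : 3 * eta = ln r by rewrite /eta; field.
have er : expR (ln r) = r by rewrite lnK// posrE.
(* The exponents on the two sides of the functional equation, for l = exp(t). *)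
pose s1 k : R := (k + d)%:R; pose s2 k : R := - k%:R.
have la' (l : R) : 0 <= l <= r -> L1 count (fun k => a k * l ^+ k).
  move=> /andP[l0 lr]; apply: L1_le la => // k; rewrite normrM ler_wpM2l// normrX.
  by rewrite (ger0_norm l0) lerXn2r// nnegrE// ltW.
have lw : L1 count (fun k => `|a k| * (expR (3 * eta * `|s1 k|) + expR (3 * eta * `|s2 k|))).
  have := L1Z (r ^+ d + 1) la; apply: eq_L1 => k.
  rewrite /s1 /s2 normrN !normr_nat e3 !expRM_natr er exprD; ring.
have L0 t : 0 <= t < eta -> \int[count]_k (a k * (expR (t * s1 k) - expR (t * s2 k))) = 0.
  move=> /andP[t0 te].
  have l1 : 1 <= expR t < r.
    rewrite -{1}expR0 ler_expR t0/= -[ltRHS]er ltr_expR -e3; lra.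
  have /andP[l1l l1r] := l1.
  have li : 0 <= (expR t)^-1 <= r.
    rewrite invr_ge0 expR_ge0/= (@le_trans _ _ 1)//; last exact: ltW.
    by rewrite invf_le1 ?expR_gt0.
  have lr : 0 <= expR t <= r by rewrite expR_ge0 ltW.
  have h1 := la' _ lr; have h2 := la' _ li.
  transitivity (\int[count]_k ((expR t) ^+ d * (a k * expR t ^+ k) - a k * (expR t)^-1 ^+ k)).
    apply: eq_Rintegral => k _; rewrite /s1 /s2 mulrN expRN !expRM_natr exprD exprVn; ring.
  by rewrite (RintegralB measurableT (L1Z _ h1) h2) (RintegralZl _ measurableT h1) fe// subrr.
(* The cosine products single out the exponent [b], which is [s1 k] only for [k = k0]. It is never
   [s2 k], because [- k <= 0 < b] by [d > 0]. *)
pose b : R := (k0 + d)%:R.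
have TL := two_sided_laplace (measurable_nat a) (measurable_nat s1) (measurable_nat s2) eta0 lw L0 b.
pose psi J s : R := \prod_(i < J) cos (pi / 2 ^+ i.+1 * (s - b)).
have psi1 J s : `|psi J s| <= 1.
  rewrite /psi; elim: J => [|J IH]; first by rewrite big_ord0 normr1.
  by rewrite big_ord_recr/= normrM -[leRHS](mulr1 1) ler_pM// cos_bound.
have psi0 (n : nat) s : (0 < n)%N -> `|s - b| = n%:R -> psi J s @[J --> \oo] --> 0.
  move=> n0 sb; have [i hi] := cos_dyadic n0.
  apply: cvg_near_cst; near=> J.
  have iJ : (i < J)%N by near: J; exact: nbhs_infty_gt.
  rewrite /psi (bigD1 (Ordinal iJ))//= (_ : cos _ = 0) ?mul0r//.
  rewrite -hi -sb; have [h|h] := lerP 0 (s - b); first by rewrite ger0_norm.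
  by rewrite ltr0_norm// mulrN cosN.
have psib J : psi J b = 1.
  by rewrite /psi big1// => i _; rewrite subrr mulr0 cos0.
pose ind k : R := (k == k0)%:R.
have [|||||_ c] := @cvg_Rintegral _ _ _ count (fun J k => a k * (psi J (s1 k) - psi J (s2 k)))
  (fun k => a k * ind k) (fun k => `|a k| * (1 + 1)).
- by move=> J; exact: measurable_nat.
- exact: measurable_nat.
- apply: aeW => k; apply: cvgM; first exact: cvg_cst.
  rewrite -[X in _ --> X]subr0; apply: cvgB.
    rewrite /ind; have [->|kk0] := eqVneq k k0.
      by rewrite (_ : (fun J => _) = cst 1); [exact: cvg_cst|apply/funext => J; exact: psib].
    apply: (psi0 `|k - k0|%N).
      by rewrite lt0n distn_eq0.
    rewrite /s1 /b !natrD opprD addrACA subrr addr0.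
    by rewrite natr_absz intr_norm rmorphB/= -!pmulrn.
  apply: (psi0 (k + (k0 + d))%N); first by rewrite !addn_gt0 d0 !orbT.
  by rewrite /s2 /b -opprD normrN -natrD normr_nat.
- have l0 : L1 count (fun k => a k).
    have h1 : 0 <= (1 : R) <= r by rewrite ler01 ltW.
    by apply: eq_L1 (la' 1 h1) => k; rewrite expr1n mulr1.
  by have := L1Z (1 + 1) (L1_norm l0); apply: eq_L1 => k; rewrite mulrC.
- by move=> J k; rewrite normrM ler_wpM2l// (le_trans (ler_normB _ _))// lerD.
have z : \int[count]_k (a k * ind k) = 0.
  apply: (cvg_unique _ c) => //.
  by rewrite (_ : (fun J => _) = cst 0); [exact: cvg_cst|apply/funext => J; exact: TL].
have li : L1 count (fun k => \1_[set k0] k : R).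
  apply/L1_ge0P => //; rewrite integral_indic// setIT.
  by rewrite [X in (X < _)%E]counting1 ltry.
move: z; rewrite (_ : (fun k => a k * ind k) = (fun k => a k0 * \1_[set k0] k)); last first.
  apply/funext => k; rewrite /ind indicE; have [->|kk0] := eqVneq k k0; first by rewrite mem_set.
  by rewrite memNset ?mulr0//= => /eqP; rewrite (negbTE kk0).
rewrite (RintegralZl _ measurableT li) /Rintegral integral_indic// setIT.
by rewrite [X in fine X]counting1 mulr1.
Unshelve. all: by end_near. Qed.

End counting.

(** With this instance, exchanging a series and an integral is a case of Fubini's theorem. *)
HB.instance Definition _ (R : realType) :=
  Measure_isSigmaFinite.Build _ _ _ (@counting nat R) (sigma_finite_counting R).

(** * Beurling's theorem *)

Section power_series.
Context d (Z : measurableType d) (R : realType).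
Variables (m : {sigma_finite_measure set Z -> \bar R}) (p q s : Z -> R) (r : R).
Hypothesis mp : measurable_fun setT p.
Hypothesis mq : measurable_fun setT q.
Hypothesis ms : measurable_fun setT s.
Hypothesis r0 : 0 <= r.
Hypothesis lpq : L1 m (fun z => (`|p z| + `|q z|) * expR (r * `|s z|)).
Local Notation count := (@counting nat R).

(** The preimage of a set is a countable union of slices, one for each natural number. *)
Lemma measurable_prod_nat (f : Z * nat -> R) :
  (forall k, measurable_fun setT (fun z => f (z, k))) -> measurable_fun setT f.
Proof.
move=> mf _ B mB; rewrite setTI.
rewrite (_ : _ @^-1` _ = \bigcup_k (((fun z => f (z, k)) @^-1` B) `*` [set k])).
  apply: bigcup_measurable => k _; apply: measurableX => //.
  by rewrite -[X in measurable X]setTI; exact: mf.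
apply/seteqP; split => [[z k] /= fB|[z k] [j _ [/= fB ->]]//].
by exists k.
Qed.

Let coef (l : R) (z : Z) k : R := (p z * cosc R k + q z * sinc R k) * (l * s z) ^+ k.

Let coef_le l z k : `|l| <= r ->
  `|coef l z k| <= (`|p z| + `|q z|) * (k`!%:R^-1 * (r * `|s z|) ^+ k).
Proof.
move=> lr; rewrite /coef normrM [leRHS]mulrA; apply: ler_pM => //.
  rewrite (le_trans (ler_normD _ _))// (normrM (p z)) (normrM (q z)) mulrDl lerD//.
    by apply: ler_wpM2l => //; exact: cosc_le.
  by apply: ler_wpM2l => //; exact: sinc_le.
by rewrite normrX lerXn2r ?nnegrE ?mulr_ge0// normrM ler_wpM2r.
Qed.

(** The exponential series bounds the terms of cosine and sine together, so that [lpq] dominates the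
    whole double family [coef] for |l| <= r. *)
Let sum_coef_le l z n : `|l| <= r ->
  \sum_(k < n) `|coef l z k| <= (`|p z| + `|q z|) * expR (r * `|s z|).
Proof.
move=> lr; apply: (@le_trans _ _ (\sum_(k < n) (`|p z| + `|q z|) * (k`!%:R^-1 * (r * `|s z|) ^+ k))).
  by apply: ler_sum => k _; exact: coef_le.
rewrite -mulr_sumr ler_wpM2l ?addr_ge0// expc_le// mulr_ge0//.
Qed.

Let L1_coef l z : `|l| <= r -> L1 count (coef l z).
Proof. by move=> lr; apply: L1_countP => n; exact: sum_coef_le. Qed.

Let L1_coef2 l : `|l| <= r -> L1 (sigma_product m count) (fun z => coef l z.1 z.2).
Proof.
move=> lr; apply: (L1_iter _ lpq).
  apply: measurable_prod_nat => k /=; apply: measurable_funM.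
    by apply: measurable_funD; apply: measurable_funM.
  by apply: measurable_funX; exact: measurable_funM.
move=> z /=; rewrite ge0_integral_count//; apply: lime_le; first exact: is_cvg_nneseries.
by apply: nearW => n; rewrite sumEFin lee_fin big_mkord; exact: sum_coef_le.
Qed.

Let sum_coef l z : `|l| <= r ->
  \int[count]_k coef l z k = p z * cos (l * s z) + q z * sin (l * s z).
Proof.
move=> lr; apply: Rintegral_count; first exact: L1_coef.
rewrite (_ : (fun n => _) = (fun n => p z * (\sum_(k < n) cosc R k * (l * s z) ^+ k) +
   q z * (\sum_(k < n) sinc R k * (l * s z) ^+ k))).
  by apply: cvgD; apply: cvgM; [exact: cvg_cst|exact: cvg_cosc|exact: cvg_cst|exact: cvg_sinc].
apply/funext => n; rewrite !mulr_sumr -big_split/=; apply: eq_bigr => k _.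
by rewrite /coef; ring.
Qed.

Definition taylor k : R := \int[m]_z ((p z * cosc R k + q z * sinc R k) * s z ^+ k).

Let L1_term k : L1 m (fun z => (p z * cosc R k + q z * sinc R k) * (r * s z) ^+ k).
Proof.
apply: (L1_le _ _ lpq).
  apply: measurable_funM; first by apply: measurable_funD; apply: measurable_funM.
  by apply: measurable_funX; exact: measurable_funM.
have lr : `|r| <= r by rewrite ger0_norm.
move=> z; have := sum_coef_le z k.+1 lr; apply: le_trans.
by rewrite big_ord_recr/= lerDr sumr_ge0.
Qed.

Lemma taylorE l k : 0 < r ->
  taylor k * l ^+ k = \int[m]_z ((p z * cosc R k + q z * sinc R k) * (l * s z) ^+ k).
Proof.
move=> r_gt0; have lt : L1 m (fun z => (p z * cosc R k + q z * sinc R k) * s z ^+ k).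
  have := L1Z (r^-1 ^+ k) (L1_term k); apply: eq_L1 => z.
  rewrite [(r * s z) ^+ k]exprMn exprVn mulrCA [_ * (r ^+ k * _)]mulrA mulVf ?mul1r//.
  by rewrite expf_neq0 ?gt_eqF.
rewrite /taylor -(RintegralZr _ measurableT lt); apply: eq_Rintegral => z _.
by rewrite exprMn; ring.
Qed.

(** Fubini at [l = r]: the integrals of the terms are absolutely summable because the double family
    is integrable. *)
Lemma L1_taylor : 0 < r -> L1 count (fun k => `|taylor k| * r ^+ k).
Proof.
move=> r_gt0; have lr : `|r| <= r by rewrite ger0_norm.
have := L1_norm (L1_Rintegral2 (L1_coef2 lr)); apply: eq_L1 => k /=.
by rewrite -taylorE// normrM normrX (ger0_norm r0).
Qed.

Lemma taylor_series l : 0 < r -> `|l| <= r ->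
  \int[count]_k (taylor k * l ^+ k) = \int[m]_z (p z * cos (l * s z) + q z * sin (l * s z)).
Proof.
move=> r_gt0 lr.
transitivity (\int[count]_k \int[m]_z coef l z k).
  by apply: eq_Rintegral => k _; rewrite taylorE.
rewrite -(Rfubini (L1_coef2 lr)); apply: eq_Rintegral => z _; exact: sum_coef.
Qed.

End power_series.

Section beurling.
Context d (T : measurableType d) (R : realType).
Variables (mu : {sigma_finite_measure set T -> \bar R}).
Variables (add : T -> T -> T) (scl : R -> T -> T) (ip : T -> T -> R) (dim : nat).
Hypothesis eu : euclid mu add scl ip dim.
Hypothesis dim0 : (0 < dim)%N.
Variables (u v : T -> R) (r : R).
Hypothesis r1 : 1 < r.
Hypothesis mU : measurable_fun setT u.
Hypothesis mV : measurable_fun setT v.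
Hypothesis luv : L1 mu (fun x => (`|u x| + `|v x|) * expR (pi * r ^+ 2 * ip x x)).

Local Notation fr := (fre mu ip u v).
Local Notation fi := (fim mu ip u v).
Hypothesis lf : L1 mu (fun y => (`|fr y| + `|fi y|) * expR (pi * ip y y)).

Let r0 : 0 <= r. Proof. by apply: ltW; apply: lt_trans r1. Qed.

Let expR_ip_ge1 (c : R) x : 0 <= c -> 1 <= expR (c * ip x x).
Proof. by move=> c0; rewrite -expR0 ler_expR mulr_ge0// (eu_ip_ge0 eu). Qed.

Let luv1 : L1 mu (fun x => `|u x| + `|v x|).
Proof.
apply: (L1_le _ _ luv).
  by apply: measurable_funD; exact: measurableT_comp.
move=> x; rewrite ger0_norm ?addr_ge0// ler_peMr ?addr_ge0//.
by apply: expR_ip_ge1; rewrite mulr_ge0 ?pi_ge0// sqr_ge0.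
Qed.

Let lu : L1 mu u.
Proof. by apply: (L1_le _ _ luv1) => // x; rewrite lerDl. Qed.

Let lv : L1 mu v.
Proof. by apply: (L1_le _ _ luv1) => // x; rewrite lerDr. Qed.

Let mfr : measurable_fun setT fr. Proof. exact: (measurable_fre eu). Qed.
Let mfi : measurable_fun setT fi. Proof. exact: (measurable_fim eu). Qed.

Let lf1 : L1 mu (fun x => `|fr x| + `|fi x|).
Proof.
apply: (L1_le _ _ lf).
  by apply: measurable_funD; exact: measurableT_comp.
move=> x; rewrite ger0_norm ?addr_ge0// ler_peMr ?addr_ge0//.
by apply: expR_ip_ge1; rewrite pi_ge0.
Qed.

Let lfr : L1 mu fr.
Proof. by apply: (L1_le _ _ lf1) => // x; rewrite lerDl. Qed.

Let lfi : L1 mu fi.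
Proof. by apply: (L1_le _ _ lf1) => // x; rewrite lerDr. Qed.

(** [p + i q] is the conjugate of the transform at [z.1] times [u + i v] at [z.2], so that
    [p cos (l s) + q sin (l s)] is the real part of its product with exp(- i l s). *)
Let p (z : T * T) := fr z.1 * u z.2 + fi z.1 * v z.2.
Let q (z : T * T) := fr z.1 * v z.2 - fi z.1 * u z.2.
Let s (z : T * T) : R := 2 * pi * ip z.1 z.2.
Local Notation mm := (sigma_product mu mu).

Let mfst (f : T -> R) : measurable_fun setT f -> measurable_fun setT (fun z : T * T => f z.1).
Proof. by move=> mf; exact: measurableT_comp mf measurable_fst. Qed.

Let msnd (f : T -> R) : measurable_fun setT f -> measurable_fun setT (fun z : T * T => f z.2).
Proof. by move=> mf; exact: measurableT_comp mf measurable_snd. Qed.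

Let mp : measurable_fun setT p.
Proof.
by apply: measurable_funD; apply: measurable_funM;
  [exact: mfst|exact: msnd|exact: mfst|exact: msnd].
Qed.

Let mq : measurable_fun setT q.
Proof.
by apply: measurable_funB; apply: measurable_funM;
  [exact: mfst|exact: msnd|exact: mfst|exact: msnd].
Qed.

Let ms : measurable_fun setT s.
Proof. by apply: measurable_funM => //; exact: eu_mip eu. Qed.

(** The square of y - e r x is nonnegative, where [e] is the sign of [ip y x]. *)
Let rs_le (y x : T) : r * `|s (y, x)| <= pi * ip y y + pi * r ^+ 2 * ip x x.
Proof.
have h (e : R) : e * e = 1 -> 2 * r * (e * ip y x) <= ip y y + r ^+ 2 * ip x x.
  move=> e1; have := eu_ip_ge0 eu (add y (scl (- (e * r)) x)).
  rewrite !(eu_ipD eu, eu_ipDr eu, eu_ipZ eu, eu_ipZr eu) (eu_ipC eu x y).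
  rewrite (_ : - (e * r) * (- (e * r) * ip x x) = e * e * (r ^+ 2 * ip x x)); last by ring.
  by rewrite e1; lra.
have -> : `|s (y, x)| = 2 * pi * `|ip y x|.
  by rewrite /s /= normrM (@ger0_norm _ (2 * pi))// mulr_ge0// pi_ge0.
have pi0 := @pi_ge0 R.
have h2 : 2 * r * `|ip y x| <= ip y y + r ^+ 2 * ip x x.
  have [i0|i0] := lerP 0 (ip y x).
    by rewrite (ger0_norm i0); have := h 1; rewrite !mul1r; exact.
  by rewrite (ltr0_norm i0); have := h (-1); rewrite !mulN1r opprK; exact.
have := ler_wpM2l pi0 h2; lra.
Qed.

Let lpq : L1 mm (fun z => (`|p z| + `|q z|) * expR (r * `|s z|)).
Proof.
apply: (L1_prod _ (L1Z 2 lf) luv).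
  apply: measurable_funM.
    by apply: measurable_funD; exact: measurableT_comp.
  apply: measurableT_comp => //; apply: measurable_funM => //.
  exact: measurableT_comp.
move=> y x; rewrite ger0_norm; last by rewrite mulr_ge0 ?addr_ge0 ?expR_ge0.
apply: (@le_trans _ _ (2 * ((`|fr y| + `|fi y|) * (`|u x| + `|v x|)) *
   (expR (pi * ip y y) * expR (pi * r ^+ 2 * ip x x)))); last first.
  by rewrite le_eqVlt; apply/orP; left; apply/eqP; ring.
apply: ler_pM; [by rewrite addr_ge0|exact: expR_ge0| |]; last first.
  by rewrite -expRD ler_expR rs_le.
rewrite /p /q /=.
have := ler_normD (fr y * u x) (fi y * v x); have := ler_normB (fr y * v x) (fi y * u x).
rewrite !normrM.
move: `|fr y| `|fi y| `|u x| `|v x| (normr_ge0 (fr y)) (normr_ge0 (fi y)) (normr_ge0 (u x)) (normr_ge0 (v x)).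
move=> A B C D A0 B0 C0 D0 h1 h2; apply: le_trans (lerD h2 h1) _.
have := mulr_ge0 A0 C0; have := mulr_ge0 A0 D0; have := mulr_ge0 B0 C0; have := mulr_ge0 B0 D0.
by rewrite mulrDl !mulrDr; lra.
Qed.

(* [A 1] is the squared norm of the transform. *)
Let A (l : R) := \int[mu]_y (fr y * fr (scl l y) + fi y * fi (scl l y)).

Let L1_pq l : L1 mm (fun z => p z * cos (l * s z) + q z * sin (l * s z)).
Proof.
apply: (L1_le _ _ lpq).
  apply: measurable_funD; apply: measurable_funM => //.
    by apply: measurableT_comp; [exact: measurable_cos|exact: measurable_funM].
  by apply: measurableT_comp; [exact: measurable_sin|exact: measurable_funM].
move=> z; rewrite (le_trans (ler_normD _ _))// !normrM.
apply: (@le_trans _ _ (`|p z| + `|q z|)).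
  by rewrite lerD// ler_piMr// ?cos_bound ?sin_bound.
by rewrite ler_peMr ?addr_ge0// -expR0 ler_expR mulr_ge0.
Qed.

(** Only the transform at [scl l y] is unfolded. As [ip (scl l y) x = l * ip y x], the parameter
    ends up inside cosine and sine, where it can be expanded in powers. *)
Let AE l : A l = \int[mm]_z (p z * cos (l * s z) + q z * sin (l * s z)).
Proof.
rewrite (Rfubini1 (L1_pq l)); apply: eq_Rintegral => y _.
have l1 := L1D (L1_cos eu (scl l y) lu) (L1_sin eu (scl l y) lv).
have l2 := L1B (L1_cos eu (scl l y) lv) (L1_sin eu (scl l y) lu).
rewrite -(RintegralZl (fr y) measurableT l1) -(RintegralZl (fi y) measurableT l2).
rewrite -(RintegralD measurableT (L1Z _ l1) (L1Z _ l2)); apply: eq_Rintegral => x _.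
rewrite /p /q /s /= (eu_ipZ eu) (_ : 2 * pi * (l * ip y x) = l * (2 * pi * ip y x)); last by ring.
by ring.
Qed.

Let A_inv l : 0 < l -> l ^+ dim * A l = A l^-1.
Proof.
move=> l0; have ln0 : l != 0 by rewrite gt_eqF.
have frl y : fr (scl l^-1 (scl l y)) = fr y.
  by apply: eq_Rintegral => x _; rewrite !(eu_ipZ eu) mulKf.
have fil y : fi (scl l^-1 (scl l y)) = fi y.
  by apply: eq_Rintegral => x _; rewrite !(eu_ipZ eu) mulKf.
have lA : L1 mu (fun y => fr y * fr (scl l^-1 y) + fi y * fi (scl l^-1 y)).
  apply: L1D.
    apply: (L1_bounded lfr (M := \int[mu]_x (`|u x| + `|v x|))).
      by apply: measurableT_comp mfr _; exact: eu_mscl eu _.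
    by move=> y; exact: (fre_bound eu).
  apply: (L1_bounded lfi (M := \int[mu]_x (`|u x| + `|v x|))).
    by apply: measurableT_comp mfi _; exact: eu_mscl eu _.
  by move=> y; exact: (fim_bound eu).
have := Rintegral_scale eu ln0 lA; rewrite (gtr0_norm l0) => h.
have -> : A l = (l ^+ dim)^-1 * A l^-1.
  by rewrite -h; apply: eq_Rintegral => y _; rewrite frl fil; ring.
by rewrite mulrA mulfV ?mul1r// expf_neq0.
Qed.

Lemma beurling : {ae mu, forall y, fr y = 0} /\ {ae mu, forall y, fi y = 0}.
Proof.
have rp : 0 < r by exact: lt_trans r1.
have ts l : `|l| <= r -> \int[@counting nat R]_k (taylor mm p q s k * l ^+ k) = A l.
  by move=> lr; rewrite (taylor_series mp mq ms r0 lpq rp lr) AE.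
have a0 := laurent_vanishing r1 dim0 (L1_taylor mp mq ms r0 lpq rp).
have {}a0 : forall k, taylor mm p q s k = 0.
  apply: a0 => l /andP[l1 lr]; have l0 : 0 < l by apply: lt_le_trans l1.
  rewrite !ts ?A_inv// ger0_norm ?invr_ge0 ?(ltW l0) ?(ltW lr)//.
  by rewrite (@le_trans _ _ 1)// ?(ltW r1)// invf_le1.
have A1 : A 1 = 0.
  rewrite -ts ?normr1 ?(ltW r1)//.
  under eq_Rintegral do rewrite a0 mul0r.
  by rewrite Rintegral_cst ?mul0r.
have scl1 y : fr (scl 1 y) = fr y by apply: eq_Rintegral => x _; rewrite (eu_ipZ eu) mul1r.
have scl1' y : fi (scl 1 y) = fi y by apply: eq_Rintegral => x _; rewrite (eu_ipZ eu) mul1r.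
have lsq : L1 mu (fun y => fr y ^+ 2 + fi y ^+ 2).
  apply: L1D; under eq_fun do rewrite expr2.
    apply: (L1_bounded lfr (M := \int[mu]_x (`|u x| + `|v x|))) => //.
    by move=> y; exact: (fre_bound eu).
  apply: (L1_bounded lfi (M := \int[mu]_x (`|u x| + `|v x|))) => //.
  by move=> y; exact: (fim_bound eu).
have h : {ae mu, forall y, fr y ^+ 2 + fi y ^+ 2 = 0}.
  apply: Rintegral_eq0_ae => //; first by move=> y; rewrite addr_ge0 ?sqr_ge0.
  by rewrite -A1; apply: eq_Rintegral => y _; rewrite scl1 scl1' !expr2.
split; apply: filterS h => y /eqP; rewrite paddr_eq0 ?sqr_ge0// => /andP[];
  by rewrite !sqrf_eq0 => /eqP + /eqP.
Qed.

End beurling.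

(** * Complex-valued functions on the Heisenberg group *)

Section complex_modulus.
Variable R : realType.
Implicit Types z w : R[i].
Local Notation Re := (@complex.Re R).
Local Notation Im := (@complex.Im R).

Lemma cabs_sqr z : cabs z ^+ 2 = Re z ^+ 2 + Im z ^+ 2.
Proof. by case: z => a b; rewrite /cabs /= sqr_sqrtr// addr_ge0 ?sqr_ge0. Qed.

Lemma cabs_ge0 z : 0 <= cabs z.
Proof. by case: z => a b; rewrite /cabs /= sqrtr_ge0. Qed.

Lemma Re_le_cabs z : `|Re z| <= cabs z.
Proof.
rewrite -(ler_pXn2r (ltn0Sn 1)) ?nnegrE ?cabs_ge0// cabs_sqr real_normK ?num_real//.
by rewrite lerDl sqr_ge0.
Qed.

Lemma Im_le_cabs z : `|Im z| <= cabs z.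
Proof.
rewrite -(ler_pXn2r (ltn0Sn 1)) ?nnegrE ?cabs_ge0// cabs_sqr real_normK ?num_real//.
by rewrite lerDr sqr_ge0.
Qed.

Lemma cabs_le z : cabs z <= `|Re z| + `|Im z|.
Proof.
rewrite -(ler_pXn2r (ltn0Sn 1)) ?nnegrE ?cabs_ge0 ?addr_ge0// cabs_sqr sqrrD.
by rewrite !real_normK ?num_real// lerD// lerDl mulrn_wge0// mulr_ge0.
Qed.

Lemma cabs_mul_conj_sqr z w : cabs (z * w^*%C) ^+ 2 = cabs z ^+ 2 * cabs w ^+ 2.
Proof. by rewrite !cabs_sqr; case: z w => [a b] [c e] /=; ring. Qed.

Lemma cabs_mul_conj z w : cabs (z * w^*%C) = cabs z * cabs w.
Proof.
apply/eqP; rewrite -(eqrXn2 (ltn0Sn 1)) ?mulr_ge0 ?cabs_ge0//.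
by rewrite cabs_mul_conj_sqr exprMn.
Qed.

Lemma complex_eq0 z : Re z = 0 -> Im z = 0 -> z = 0.
Proof. by case: z => a b /= -> ->. Qed.

Lemma cabs_eq0 z : cabs z ^+ 2 = 0 -> z = 0.
Proof.
rewrite cabs_sqr => /eqP; rewrite paddr_eq0 ?sqr_ge0// !sqrf_eq0 => /andP[/eqP + /eqP].
exact: complex_eq0.
Qed.

Lemma measurable_cabs d (T : measurableType d) (h : T -> R[i]) :
  measurable_fun setT (fun x => Re (h x)) -> measurable_fun setT (fun x => Im (h x)) ->
  measurable_fun setT (fun x => cabs (h x)).
Proof.
move=> m1 m2; rewrite (_ : (fun x => _) = (fun x => Num.sqrt (Re (h x) ^+ 2 + Im (h x) ^+ 2))).
  apply: measurableT_comp.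
    by apply: continuous_measurable_fun; exact: sqrt_continuous.
  by apply: measurable_funD; exact: measurable_funX.
by apply/funext => x; rewrite -cabs_sqr sqrtr_sqr ger0_norm ?cabs_ge0.
Qed.

End complex_modulus.

Section complex_fourier.
Context (R : realType) (n : nat).
Local Notation H := (heis R n).
Local Notation mu := (haar R n).
Local Notation eu := (@euclid_heis R n).
Local Notation Re := (@complex.Re R).
Local Notation Im := (@complex.Im R).
Implicit Types h f g : H -> R[i].

Lemma fourier1E h : fourier1 h = fun Q => Complex
  (fre mu (@inner R n) (fun X => Re (h X)) (fun X => Im (h X)) Q)
  (fim mu (@inner R n) (fun X => Re (h X)) (fun X => Im (h X)) Q).
Proof.
apply/funext => Q; congr Complex; apply: eq_Rintegral => X _; case: (h X) => a b;
  by rewrite /cis cosN sinN /=; ring.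
Qed.

Lemma measurable_fourier1 h : cmeasurable h -> cmeasurable (fourier1 h).
Proof.
move=> [m1 m2]; rewrite fourier1E; split.
  exact: (measurable_fre eu m1 m2).
exact: (measurable_fim eu m1 m2).
Qed.

Lemma norm2sqE h : cmeasurable h ->
  norm2sq h = (sqint mu (fun X => Re (h X)) + sqint mu (fun X => Im (h X)))%E.
Proof.
move=> [m1 m2]; rewrite -sqintD//; apply: eq_integral => X _.
by rewrite cabs_sqr.
Qed.

Lemma inL2P h : inL2 h <-> cmeasurable h /\
  L1 mu (fun X => Re (h X) ^+ 2) /\ L1 mu (fun X => Im (h X) ^+ 2).
Proof.
split=> [[mh]|[mh [l1 l2]]]; have [m1 m2] := mh.
  rewrite norm2sqE// => l; split => //.
  split; apply/L1_sqr => //; apply: le_lt_trans l.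
    by rewrite leeDl// sqint_ge0.
  by rewrite leeDr// sqint_ge0.
split => //; rewrite norm2sqE//; apply: lte_add_pinfty; exact/L1_sqr.
Qed.

Lemma inL1P h : inL1 h <->
  L1 mu (fun X => Re (h X)) /\ L1 mu (fun X => Im (h X)).
Proof.
have lc : cmeasurable h -> (\int[mu]_X (cabs (h X))%:E < +oo)%E <->
    L1 mu (fun X => cabs (h X)).
  move=> mh; rewrite -L1_ge0P//; last by move=> x; exact: cabs_ge0.
  by case: mh => m1 m2; exact: measurable_cabs.
split=> [[mh /(lc mh) l]|[l1 l2]].
  have [m1 m2] := mh.
  by split; [apply: L1_le l => // X; exact: Re_le_cabs|apply: L1_le l => // X; exact: Im_le_cabs].
have mh : cmeasurable h by split; [exact: (L1_measurable l1)|exact: (L1_measurable l2)].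
split => //; apply/(lc mh); apply: L1_le (L1D (L1_norm l1) (L1_norm l2)).
  by case: mh => m1 m2; exact: measurable_cabs.
by move=> X; rewrite ger0_norm ?cabs_ge0// cabs_le.
Qed.

Lemma norm2sqB h f : cmeasurable h -> cmeasurable f ->
  norm2sq (fun X => h X - f X) =
  (sqint mu (fun X => Re (h X) - Re (f X))%R + sqint mu (fun X => Im (h X) - Im (f X))%R)%E.
Proof.
move=> [m1 m2] [m3 m4].
have RB : (fun X => Re (h X - f X)) = (fun X => Re (h X) - Re (f X)).
  by apply/funext => X; case: (h X) (f X) => [? ?] [? ?].
have IB : (fun X => Im (h X - f X)) = (fun X => Im (h X) - Im (f X)).
  by apply/funext => X; case: (h X) (f X) => [? ?] [? ?].
rewrite norm2sqE; first by rewrite -RB -IB.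
split; first by rewrite [X in measurable_fun _ X]RB; exact: measurable_funB.
by rewrite [X in measurable_fun _ X]IB; exact: measurable_funB.
Qed.

Lemma cvge0_le (s t : nat -> \bar R) : (forall k, 0 <= s k <= t k)%E ->
  t k @[k --> \oo] --> 0%E -> s k @[k --> \oo] --> 0%E.
Proof.
move=> st t0; apply: (squeeze_cvge _ (cvg_cst 0%E) t0); exact: nearW.
Qed.

Lemma fourier2_exists f : inL2 f -> exists hf, is_fourier2 f hf.
Proof.
move=> /inL2P[mf [l1 l2]]; have [m1 m2] := mf.
have [U [V [a [b [LUV [[ma la] [mb lb]] [cU cV] [ca cb]]]]]] := fourier_L2_exists eu m1 m2 l1 l2.
have mUV k : cmeasurable (fun X => Complex (U k X) (V k X)).
  by have [[/L1_measurable ? _] [/L1_measurable ? _]] := LUV k.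
exists (fun X => Complex (a X) (b X)); split; first exact/inL2P.
exists (fun k X => Complex (U k X) (V k X)); split.
- move=> k; have [[? ?] [? ?]] := LUV k.
  by split; [exact/inL1P|apply/inL2P; split; [exact: mUV|]].
- rewrite (_ : (fun k => _) = (fun k => sqint mu (fun X => U k X - Re (f X))%R +
    sqint mu (fun X => V k X - Im (f X))%R)%E).
    by rewrite -[0%E]adde0; exact: cvgeD.
  by apply/funext => k; rewrite norm2sqB.
- rewrite (_ : (fun k => _) = (fun k =>
    sqint mu (fun X => fre mu (@inner R n) (U k) (V k) X - a X)%R +
    sqint mu (fun X => fim mu (@inner R n) (U k) (V k) X - b X)%R)%E).
    by rewrite -[0%E]adde0; exact: cvgeD.
  apply/funext => k; rewrite (norm2sqB (measurable_fourier1 (mUV k))); last by split.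
  by rewrite fourier1E.
Qed.

(** [xget] would return its default, the zero function, if there were no transform; existence rules
    this out. *)
Lemma is_fourier2_fourier2 f : inL2 f -> is_fourier2 f (fourier2 f).
Proof. by move=> /fourier2_exists; rewrite /fourier2; exact: xgetPex. Qed.

(** If the limit transform vanishes, the transforms of the approximating sequence tend to 0, and
    [fourier_L2_injective] applies to that sequence. *)
Lemma fourier2_eq0 f : inL2 f -> {ae mu, forall X, fourier2 f X = 0} ->
  {ae mu, forall X, f X = 0}.
Proof.
move=> lf f0; have [l2f [U [LU cU cF]]] := is_fourier2_fourier2 lf.
have [mF _] := l2f; have /inL2P[mf [l1 l2]] := lf.
have [m1 m2] := mf; have [m3 m4] := mF.
pose u k X := Re (U k X); pose v k X := Im (U k X).
have LUV k : L12 mu (u k) /\ L12 mu (v k).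
  by have [/inL1P[? ?] /inL2P[_ [? ?]]] := LU k.
have mUk k : cmeasurable (U k) by have [[]] := LU k.
have mu_ k : measurable_fun setT (u k) by have [] := mUk k.
have mv_ k : measurable_fun setT (v k) by have [] := mUk k.
have cu : sqint mu (fun X => u k X - Re (f X))%R @[k --> \oo] --> 0%E.
  apply: cvge0_le cU => k; rewrite sqint_ge0/= norm2sqB//.
  by rewrite leeDl// sqint_ge0.
have cv : sqint mu (fun X => v k X - Im (f X))%R @[k --> \oo] --> 0%E.
  apply: cvge0_le cU => k; rewrite sqint_ge0/= norm2sqB//.
  by rewrite leeDr// sqint_ge0.
have F1 k : cmeasurable (fourier1 (U k)).
  exact: measurable_fourier1.
have cF' : (sqint mu (fre mu (@inner R n) (u k) (v k)) +
            sqint mu (fim mu (@inner R n) (u k) (v k)))%E @[k --> \oo] --> 0%E.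
  rewrite (_ : (fun k => _) = (fun k => norm2sq (fun Q => fourier1 (U k) Q - fourier2 f Q)))//.
  apply/funext => k; rewrite norm2sqB//; congr (_ + _)%E; apply: ae_eq_integral => //.
  - by apply/measurable_EFinP; apply: measurable_funX; exact: (measurable_fre eu (mu_ k) (mv_ k)).
  - apply/measurable_EFinP; apply: measurable_funX; apply: measurable_funB => //.
    by have [] := F1 k.
  - by apply: filterS f0 => X -> _; rewrite fourier1E subr0.
  - by apply/measurable_EFinP; apply: measurable_funX; exact: (measurable_fim eu (mu_ k) (mv_ k)).
  - apply/measurable_EFinP; apply: measurable_funX; apply: measurable_funB => //.
    by have [] := F1 k.
  - by apply: filterS f0 => X -> _; rewrite fourier1E subr0.
have cr : sqint mu (fre mu (@inner R n) (u k) (v k)) @[k --> \oo] --> 0%E.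
  by apply: cvge0_le cF' => k; rewrite sqint_ge0/= leeDl// sqint_ge0.
have ci : sqint mu (fim mu (@inner R n) (u k) (v k)) @[k --> \oo] --> 0%E.
  by apply: cvge0_le cF' => k; rewrite sqint_ge0/= leeDr// sqint_ge0.
have r0 := fourier_L2_injective eu m1 m2 l1 l2 LUV cu cr ci.
(* The same argument for - i f, that is for the pair ([v], [- u]). *)
have i0 : {ae mu, forall X, Im (f X) = 0}.
  have mN : measurable_fun setT (fun X => - Re (f X)) by exact: measurableT_comp.
  have lN : L1 mu (fun X => (- Re (f X)) ^+ 2) by under eq_fun do rewrite sqrrN.
  apply: (fourier_L2_injective eu m2 mN l2 lN (U := v) (V := fun k X => - u k X) _ cv) => [k||].
  - have [[? ?] [? ?]] := LUV k; split => //; split.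
      by apply: eq_L1 (L1Z (-1) _) => [X|]; [rewrite mulN1r|].
    by under eq_fun do rewrite sqrrN.
  - by under eq_fun do rewrite fre_fim.
  - rewrite (_ : (fun k => _) = (fun k => sqint mu (fre mu (@inner R n) (u k) (v k)))); first exact: cr.
    apply/funext => k; have [[? _] [? _]] := LUV k.
    by apply: eq_integral => X _; rewrite (fim_fre eu)// sqrrN.
by apply: filterS2 r0 i0 => X; exact: complex_eq0.
Qed.

End complex_fourier.

(** * Left invariance of Haar measure and convolution *)

Section heisenberg_translation.
Context (R : realType) (n : nat).
Local Notation RT := (measurableTypeR R).
Local Notation H := (heis R n).
Local Notation mu := (haar R n).
Local Notation eu := (@euclid_heis R n).

Let m11 : measurable_fun setT (fun z : H * H => (z.1.1.1, z.2.1.1)).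
Proof.
apply: measurable_fun_pair.
- exact: measurableT_comp measurable_fst (measurableT_comp measurable_fst measurable_fst).
- exact: measurableT_comp measurable_fst (measurableT_comp measurable_fst measurable_snd).
Qed.

Let m12 : measurable_fun setT (fun z : H * H => (z.1.1.2, z.2.1.2)).
Proof.
apply: measurable_fun_pair.
- exact: measurableT_comp measurable_snd (measurableT_comp measurable_fst measurable_fst).
- exact: measurableT_comp measurable_snd (measurableT_comp measurable_fst measurable_snd).
Qed.

Let mx1 : measurable_fun setT (fun z : H * H => (z.1.1.1, z.2.1.2)).
Proof.
apply: measurable_fun_pair.
- exact: measurableT_comp measurable_fst (measurableT_comp measurable_fst measurable_fst).
- exact: measurableT_comp measurable_snd (measurableT_comp measurable_fst measurable_snd).
Qed.

Let mx2 : measurable_fun setT (fun z : H * H => (z.1.1.2, z.2.1.1)).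
Proof.
apply: measurable_fun_pair.
- exact: measurableT_comp measurable_snd (measurableT_comp measurable_fst measurable_fst).
- exact: measurableT_comp measurable_fst (measurableT_comp measurable_fst measurable_snd).
Qed.

Lemma measurable_heis_mul : measurable_fun setT (fun z : H * H => heis_mul z.1 z.2).
Proof.
have eun := @euclid_tuple R n.
apply: measurable_fun_pair.
  apply: measurable_fun_pair.
  - exact: (measurableT_comp (eu_madd eun) m11).
  - exact: (measurableT_comp (eu_madd eun) m12).
apply: measurable_funD.
  apply: measurable_funD.
  - exact: measurableT_comp measurable_snd measurable_fst.
  - exact: measurableT_comp measurable_snd measurable_snd.
apply: measurable_funM => //; apply: measurable_funB.
- exact: (measurableT_comp (eu_mip eun) mx1).
- exact: (measurableT_comp (eu_mip eun) mx2).
Qed.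

Lemma taddC (p q : n.-tuple RT) : tadd p q = tadd q p.
Proof. by apply: eq_from_tnth => i; rewrite !tnth_mktuple addrC. Qed.

(* In the last coordinate the product is a Euclidean translation, by an amount
   depending on the other coordinates only. *)
Lemma integral_heis_mul X (phi : H -> \bar R) : measurable_fun setT phi ->
  (forall P, 0 <= phi P)%E -> (\int[mu]_P phi (heis_mul X P) = \int[mu]_P phi P)%E.
Proof.
move=> mphi phi0.
pose s (w : n.-tuple RT * n.-tuple RT) := X.2 + 2^-1 * (dot X.1.1 w.2 - dot X.1.2 w.1).
(* [b] accounts for the first two coordinates; the shift [s w] of the last one is made inside the
   inner integral of Tonelli's theorem, where [w] is fixed. *)
pose b : H := (X.1, 0).
have e P : hadd P b = (tadd X.1.1 P.1.1, tadd X.1.2 P.1.2, P.2).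
  by rewrite /hadd /b/= addr0 (taddC P.1.1) (taddC P.1.2).
have mb : measurable_fun setT (fun P => phi (hadd P b)).
  exact: (measurableT_comp mphi (measurable_trans eu b)).
rewrite -(eu_trans eu b mphi phi0).
have mX : measurable_fun setT (fun P => phi (heis_mul X P)).
  exact: (measurableT_comp mphi (measurableT_comp measurable_heis_mul (measurable_pair1 X))).
rewrite [LHS](fubini_tonelli1 _ mX)// [RHS](fubini_tonelli1 _ mb)//.
apply: eq_integral => w _; rewrite /fubini_F.
rewrite -(eu_trans (euclid_line R) (s w) (phi := fun t => phi (hadd (w, t) b)))//.
- apply: eq_integral => t _; rewrite e /heis_mul /s /=; congr (phi (_, _)); ring.
- exact: (measurableT_comp mb (measurable_pair1 w)).
Qed.

End heisenberg_translation.

Lemma L1_le_ae d (T : measurableType d) (R : realType) (mu : {measure set T -> \bar R})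
    (f g : T -> R) : measurable_fun setT f -> {ae mu, forall x, `|f x| <= g x} ->
  L1 mu g -> L1 mu f.
Proof.
move=> mf fg lg; apply/L1P => //; have /integrableP[_] := lg.
apply: le_lt_trans; apply: ae_ge0_le_integral => //.
- by apply/measurable_EFinP; exact: measurableT_comp.
- by apply: measurableT_comp => //; apply/measurable_EFinP; exact: L1_measurable lg.
- by apply: filterS fg => x fg _; rewrite lee_fin (le_trans fg)// ler_norm.
Qed.

Section heisenberg_convolution.
Context (R : realType) (n : nat).
Local Notation H := (heis R n).
Local Notation mu := (haar R n).

Lemma measurable_conv (w k : H -> R) : measurable_fun setT w -> measurable_fun setT k ->
  measurable_fun setT (fun z : H * H => w z.2 * k (heis_mul z.2 z.1)).
Proof.
move=> mw mk; apply: measurable_funM; first exact: measurableT_comp mw measurable_snd.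
apply: (measurableT_comp mk).
exact: measurableT_comp (@measurable_heis_mul R n) (measurable_fun_pair measurable_snd measurable_fst).
Qed.

(** Integrate in [P] first: for fixed [X], left invariance removes [X] from the second factor. *)
Lemma integral_conv (w k : H -> R) : measurable_fun setT w -> measurable_fun setT k ->
  (forall X, 0 <= w X) -> (forall X, 0 <= k X) ->
  (\int[mu]_P \int[mu]_X (w X * k (heis_mul X P))%:E =
   (\int[mu]_X (w X)%:E) * (\int[mu]_P (k P)%:E))%E.
Proof.
move=> mw mk w0 k0.
have mWK : measurable_fun setT (fun z : H * H => (w z.2 * k (heis_mul z.2 z.1))%:E).
  by apply/measurable_EFinP; exact: measurable_conv.
rewrite (fubini_tonelli _ mWK); last by move=> z; rewrite lee_fin mulr_ge0.
have K0 : (0 <= \int[mu]_P (k P)%:E)%E by apply: integral_ge0 => P _; rewrite lee_fin.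
rewrite -ge0_integralZr//; last 2 first.
- exact/measurable_EFinP.
- by move=> X _; rewrite lee_fin.
apply: eq_integral => X _ /=.
under eq_integral do rewrite EFinM.
have mX : measurable_fun setT (fun P => (k (heis_mul X P))%:E).
  apply/measurable_EFinP; apply: (measurableT_comp mk).
  exact: measurableT_comp (@measurable_heis_mul R n) (measurable_pair1 X).
rewrite ge0_integralZl//; [|by move=> P _; rewrite lee_fin|by rewrite lee_fin].
congr (_ * _)%E; apply: (integral_heis_mul X (phi := fun P => (k P)%:E)) => //.
exact/measurable_EFinP.
Qed.

End heisenberg_convolution.

(** * From Gaussian decay to vanishing products *)

Section gaussian_decay.
Context (R : realType) (n : nat).
Local Notation H := (heis R n).
Local Notation mu := (haar R n).
Local Notation eu := (@euclid_heis R n).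
Local Notation Re := (@complex.Re R).
Local Notation Im := (@complex.Im R).
Variables (F G : H -> R[i]) (a C : R).
Hypothesis lF : inL2 F.
Hypothesis lG : inL2 G.
Hypothesis pia : pi < a.
Hypothesis C0 : 0 < C.
Hypothesis decay : {ae mu, forall X, cabs (F X) <= C * expR (- a * sqnorm X)}.

Let h P X := F X * (G (heis_mul X P))^*%C.
Let u P X := Re (h P X).
Let v P X := Im (h P X).

Hypothesis fin : (\int[mu]_P \int[mu]_Q
  (cabs (fourier1 (h P) Q) * expR (pi * (sqnorm Q + sqnorm P)))%:E < +oo)%E.

Let mF1 : measurable_fun setT (fun X => Re (F X)). Proof. by have [[]] := lF. Qed.
Let mF2 : measurable_fun setT (fun X => Im (F X)). Proof. by have [[]] := lF. Qed.
Let mG1 : measurable_fun setT (fun X => Re (G X)). Proof. by have [[]] := lG. Qed.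
Let mG2 : measurable_fun setT (fun X => Im (G X)). Proof. by have [[]] := lG. Qed.

Let uE P X : u P X = Re (F X) * Re (G (heis_mul X P)) + Im (F X) * Im (G (heis_mul X P)).
Proof. by rewrite /u /h; case: (F X) (G _) => [? ?] [? ?] /=; ring. Qed.

Let vE P X : v P X = Im (F X) * Re (G (heis_mul X P)) - Re (F X) * Im (G (heis_mul X P)).
Proof. by rewrite /v /h; case: (F X) (G _) => [? ?] [? ?] /=; ring. Qed.

Let mU : measurable_fun setT (fun z : H * H => u z.1 z.2).
Proof.
under eq_fun do rewrite uE.
apply: measurable_funD; first exact: (measurable_conv mF1 mG1).
exact: (measurable_conv mF2 mG2).
Qed.

Let mV : measurable_fun setT (fun z : H * H => v z.1 z.2).
Proof.
under eq_fun do rewrite vE.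
apply: measurable_funB; first exact: (measurable_conv mF2 mG1).
exact: (measurable_conv mF1 mG2).
Qed.

Let mu_ P : measurable_fun setT (u P).
Proof. exact: (measurableT_comp mU (measurable_pair1 P)). Qed.

Let mv_ P : measurable_fun setT (v P).
Proof. exact: (measurableT_comp mV (measurable_pair1 P)). Qed.

Let mcabs1 : measurable_fun setT (fun z : H * H => cabs (fourier1 (h z.1) z.2)).
Proof.
have mq : measurable_fun setT (fun z : (H * H) * H => (z.1.1, z.2)).
  apply: measurable_fun_pair; last exact: measurable_snd.
  exact: measurableT_comp measurable_fst measurable_fst.
have mq2 : measurable_fun setT (fun z : (H * H) * H => (z.1.2, z.2)).
  apply: measurable_fun_pair; last exact: measurable_snd.
  exact: measurableT_comp measurable_snd measurable_fst.
have mi : measurable_fun setT (fun z : (H * H) * H => 2 * pi * inner z.1.2 z.2).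
  by apply: measurable_funM; [exact: measurable_cst|exact: (measurableT_comp (eu_mip eu) mq2)].
have mc : measurable_fun setT (fun z : (H * H) * H => cos (2 * pi * inner z.1.2 z.2) : R).
  by apply: measurableT_comp mi; exact: measurable_cos.
have ms : measurable_fun setT (fun z : (H * H) * H => sin (2 * pi * inner z.1.2 z.2) : R).
  by apply: measurableT_comp mi; exact: measurable_sin.
have mU3 : measurable_fun setT (fun z : (H * H) * H => u z.1.1 z.2) := measurableT_comp mU mq.
have mV3 : measurable_fun setT (fun z : (H * H) * H => v z.1.1 z.2) := measurableT_comp mV mq.
apply: measurable_cabs; under eq_fun do rewrite fourier1E.
  apply: (measurable_Rintegral1 mu (f := fun z : (H * H) * H =>
    u z.1.1 z.2 * cos (2 * pi * inner z.1.2 z.2) + v z.1.1 z.2 * sin (2 * pi * inner z.1.2 z.2))).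
  by apply: measurable_funD; exact: measurable_funM.
apply: (measurable_Rintegral1 mu (f := fun z : (H * H) * H =>
    v z.1.1 z.2 * cos (2 * pi * inner z.1.2 z.2) - u z.1.1 z.2 * sin (2 * pi * inner z.1.2 z.2))).
by apply: measurable_funB; exact: measurable_funM.
Qed.

(** The inner integral of a finite double integral is finite for almost every [P]. Real and
    imaginary parts are each at most the modulus, whence the factor 2, and exp(pi |P|^2) >= 1. *)
Let spectral_decay : {ae mu, forall P, L1 mu (fun Q =>
  (`|fre mu (@inner R n) (u P) (v P) Q| + `|fim mu (@inner R n) (u P) (v P) Q|) *
  expR (pi * inner Q Q))}.
Proof.
pose J (z : H * H) := cabs (fourier1 (h z.1) z.2) * expR (pi * (sqnorm z.2 + sqnorm z.1)).
have mJ : measurable_fun setT J.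
  apply: measurable_funM => //; apply: measurableT_comp => //; apply: measurable_funM => //.
  have ms := measurable_sq eu.
  apply: measurable_funD; first exact: measurableT_comp ms measurable_snd.
  exact: measurableT_comp ms measurable_fst.
have J0 z : 0 <= J z by rewrite mulr_ge0 ?cabs_ge0 ?expR_ge0.
have mJ1 : measurable_fun setT (fun P => \int[mu]_Q (J (P, Q))%:E)%E.
  apply: (measurable_fun_fubini_tonelli_F (fun z => (J z)%:E)) => //=.
  exact/measurable_EFinP.
have iJ : mu.-integrable setT (fun P => \int[mu]_Q (J (P, Q))%:E)%E.
  apply/integrableP; split => //.
  have J1 P : (0 <= \int[mu]_Q (J (P, Q))%:E)%E by apply: integral_ge0 => Q _; rewrite lee_fin.
  by under eq_integral do rewrite (gee0_abs (J1 _)).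
apply: filterS (integrable_ae measurableT iJ) => P /(_ I) fP.
have lJ : L1 mu (fun Q => J (P, Q)).
  apply/L1_ge0P => //; first exact: measurableT_comp mJ (measurable_pair1 P).
  by rewrite ltey_eq fP.
have mr := measurable_fre eu (mu_ P) (mv_ P); have mi := measurable_fim eu (mu_ P) (mv_ P).
apply: L1_le (L1Z 2 lJ) => [|Q].
  apply: measurable_funM; first by apply: measurable_funD; exact: measurableT_comp.
  apply: measurableT_comp => //; apply: measurable_funM => //; exact: (measurable_sq eu).
rewrite ger0_norm ?mulr_ge0 ?addr_ge0 ?expR_ge0// /J/=.
have h1 : `|fre mu (@inner R n) (u P) (v P) Q| <= cabs (fourier1 (h P) Q).
  by have := Re_le_cabs (fourier1 (h P) Q); rewrite {1}fourier1E.
have h2 : `|fim mu (@inner R n) (u P) (v P) Q| <= cabs (fourier1 (h P) Q).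
  by have := Im_le_cabs (fourier1 (h P) Q); rewrite {1}fourier1E.
rewrite mulrA; apply: ler_pM; rewrite ?addr_ge0 ?expR_ge0//.
  by rewrite mulr_natl mulr2n lerD.
by rewrite ler_expR ler_wpM2l ?pi_ge0// lerDl (eu_ip_ge0 eu).
Qed.

(** r^2 is the midpoint of 1 and a / pi, and e^2 is what remains of a / pi; a > pi makes r > 1 and e
    > 0. *)
Let r : R := Num.sqrt ((1 + a / pi) / 2).
Let e : R := Num.sqrt ((a / pi - 1) / 2).

Let api : 1 < a / pi. Proof. by rewrite ltr_pdivlMr ?pi_gt0// mul1r. Qed.

Let r1 : 1 < r.
Proof. by rewrite -[ltLHS]sqrtr1 ltr_sqrt; have := api; lra. Qed.

Let e0 : e != 0.
Proof. by rewrite gt_eqF// sqrtr_gt0; have := api; lra. Qed.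

Let are : a = pi * r ^+ 2 + pi * e ^+ 2.
Proof.
have api' := api; have p0 : pi != 0 :> R by rewrite gt_eqF// pi_gt0.
have r2 : r ^+ 2 = (1 + a / pi) / 2 by rewrite sqr_sqrtr//; lra.
have e2 : e ^+ 2 = (a / pi - 1) / 2 by rewrite sqr_sqrtr//; lra.
rewrite -mulrDr r2 e2 (_ : _ / 2 + _ = a / pi); last by lra.
by rewrite mulrCA mulfV// mulr1.
Qed.

Let w (X : H) : R := gaussian (@inner R n) (hscale e X).

Let lw : L1 mu w. Proof. exact: (L1_scale eu e0 (L1_gaussian eu)). Qed.

Let wE X : w X = expR (- (pi * e ^+ 2 * inner X X)).
Proof. by rewrite /w /gaussian (eu_ipZ eu) (eu_ipZr eu); congr expR; ring. Qed.

Let mG : measurable_fun setT (fun X => cabs (G X) ^+ 2).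
Proof. by apply: measurable_funX; exact: measurable_cabs. Qed.

Let mF : measurable_fun setT (fun X => cabs (F X) ^+ 2).
Proof. by apply: measurable_funX; exact: measurable_cabs. Qed.

(** By [integral_conv] the integral over [P] of these integrals is the mass of [w] times the squared
    norm of [G], which is finite. *)
Let window_integrable : {ae mu, forall P, L1 mu (fun X => w X * cabs (G (heis_mul X P)) ^+ 2)}.
Proof.
have mw := L1_measurable lw.
have w0 X : 0 <= w X by exact: expR_ge0.
have G0 X : 0 <= cabs (G X) ^+ 2 by exact: sqr_ge0.
have mJ := measurable_conv mw mG.
pose J P := (\int[mu]_X (w X * cabs (G (heis_mul X P)) ^+ 2)%:E)%E.
have J0 P : (0 <= J P)%E by apply: integral_ge0 => X _; rewrite lee_fin mulr_ge0.
have mJ1 : measurable_fun setT J.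
  apply: (measurable_fun_fubini_tonelli_F (fun z : H * H =>
    (w z.2 * cabs (G (heis_mul z.2 z.1)) ^+ 2)%:E)) => //=.
    exact/measurable_EFinP.
  by move=> z; rewrite lee_fin mulr_ge0.
have iJ : mu.-integrable setT J.
  apply/integrableP; split => //.
  under eq_integral do rewrite (gee0_abs (J0 _)).
  rewrite (integral_conv mw mG w0 G0) lte_mul_pinfty//.
  - by apply: integral_ge0 => X _; rewrite lee_fin.
  - by rewrite -Rintegral_EFin.
  - by have [] := lG.
apply: filterS (integrable_ae measurableT iJ) => P /(_ I) fP.
apply/L1_ge0P; [exact: measurableT_comp mJ (measurable_pair1 P)|by move=> X; rewrite mulr_ge0|].
by rewrite ltey_eq fP.
Qed.

(** The bound on [F] leaves C w(X) |G(X.P)|, and w g <= w + w g^2 reduces this to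
    [window_integrable]. *)
Let signal_decay : {ae mu, forall P, L1 mu (fun X =>
  (`|u P X| + `|v P X|) * expR (pi * r ^+ 2 * inner X X))}.
Proof.
apply: filterS window_integrable => P lP.
apply: (L1_le_ae _ _ (L1Z (2 * C) (L1D lw lP))).
  apply: measurable_funM; first by apply: measurable_funD; exact: measurableT_comp.
  by apply: measurableT_comp => //; apply: measurable_funM => //; exact: (measurable_sq eu).
apply: filterS decay => X FX; rewrite ger0_norm ?mulr_ge0 ?addr_ge0 ?expR_ge0//.
set g := cabs (G (heis_mul X P)).
have g0 : 0 <= g by exact: cabs_ge0.
have hE : cabs (h P X) = cabs (F X) * g by exact: cabs_mul_conj.
have huv : `|u P X| + `|v P X| <= 2 * (cabs (F X) * g).
  by rewrite -hE mulr_natl mulr2n lerD ?Re_le_cabs ?Im_le_cabs.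
apply: (@le_trans _ _ (2 * (C * expR (- a * sqnorm X) * g) * expR (pi * r ^+ 2 * inner X X))).
  rewrite ler_wpM2r ?expR_ge0// (le_trans huv)// ler_wpM2l// ler_wpM2r//.
have -> : 2 * (C * expR (- a * sqnorm X) * g) * expR (pi * r ^+ 2 * inner X X) = 2 * C * (w X * g).
  rewrite wE (_ : - (pi * e ^+ 2 * inner X X) = - a * sqnorm X + pi * r ^+ 2 * inner X X).
    by rewrite expRD; ring.
  by rewrite are /sqnorm; ring.
rewrite ler_wpM2l ?mulr_ge0 ?(ltW C0)//.
rewrite -[X in X + _]mulr1 -mulrDr ler_wpM2l ?expR_ge0//.
have := sqr_ge0 (g - 1); nra.
Qed.

Lemma gaussian_decay_vanishing : {ae mu, forall X, F X = 0} \/ {ae mu, forall X, G X = 0}.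
Proof.
have F0 X : 0 <= cabs (F X) ^+ 2 by exact: sqr_ge0.
have G0 X : 0 <= cabs (G X) ^+ 2 by exact: sqr_ge0.
have dim0 : (0 < n + n + 1)%N by rewrite addn1.
have vanish : {ae mu, forall P,
    (\int[mu]_X (cabs (F X) ^+ 2 * cabs (G (heis_mul X P)) ^+ 2)%:E = 0)%E}.
  apply: filterS2 signal_decay spectral_decay => P lP sP.
  (* Beurling's theorem is stated for the transform, so injectivity on integrable functions is still
     required to conclude that h_P vanishes. *)
  have [fr0 fi0] := beurling eu dim0 r1 (mu_ P) (mv_ P) lP sP.
  have w1 (X : H) : 1 <= expR (pi * r ^+ 2 * inner X X).
    rewrite -[leLHS]expR0 ler_expR; apply: mulr_ge0; last exact: (eu_ip_ge0 eu).
    by rewrite mulr_ge0 ?pi_ge0 ?sqr_ge0.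
  have lu : L1 mu (u P).
    apply: L1_le lP => // X; rewrite (@le_trans _ _ (`|u P X| + `|v P X|)) ?lerDl//.
    by rewrite ler_peMr ?addr_ge0.
  have lv : L1 mu (v P).
    apply: L1_le lP => // X; rewrite (@le_trans _ _ (`|u P X| + `|v P X|)) ?lerDr//.
    by rewrite ler_peMr ?addr_ge0.
  have [u0 v0] := fourier_uniqueness eu lu lv fr0 fi0.
  transitivity (\int[mu]_X (cst 0%E) X)%E; last by rewrite integral0.
  apply: ae_eq_integral => //.
    apply/measurable_EFinP.
    exact: measurableT_comp (measurable_conv mF mG) (measurable_pair1 P).
  apply: filterS2 u0 v0 => X uX vX _.
  by rewrite -cabs_mul_conj_sqr cabs_sqr -/(h P X) -/(u P X) -/(v P X) uX vX expr0n addr0.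
(* The convolution identity again, now with |F|^2 and |G|^2. *)
have : (norm2sq F * norm2sq G = 0)%E.
  rewrite /norm2sq -(integral_conv mF mG F0 G0).
  transitivity (\int[mu]_X (cst 0%E) X)%E; last by rewrite integral0.
  apply: ae_eq_integral => //.
    apply: (measurable_fun_fubini_tonelli_F (fun z : H * H =>
      (cabs (F z.2) ^+ 2 * cabs (G (heis_mul z.2 z.1)) ^+ 2)%:E)) => //=.
      by apply/measurable_EFinP; exact: (measurable_conv mF mG).
    by move=> z; rewrite lee_fin mulr_ge0.
  by apply: filterS vanish.
move=> /eqP; rewrite mule_eq0 => /orP[] /eqP z; [left|right].
  by apply: filterS (integral_eq0_ae mF F0 z) => X; exact: cabs_eq0.
by apply: filterS (integral_eq0_ae mG G0 z) => X; exact: cabs_eq0.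
Qed.

End gaussian_decay.

Unset Implicit Arguments.

Theorem theorem7p1 (R : realType) (n : nat) (f g : heis R n -> R[i]) (a : R) :
  (1 <= n)%N ->
  inL2 f -> inL2 g ->
  (\int[haar R n]_P \int[haar R n]_Q
     (cabs (stft g f Q P) * expR (pi * (sqnorm Q + sqnorm P)))%:E < +oo)%E ->
  pi < a ->
  (exists2 C : R, 0 < C &
     {ae haar R n, forall X, cabs (fourier2 f X) <= C * expR (- a * sqnorm X)}) ->
  {ae haar R n, forall X, f X = 0} \/ {ae haar R n, forall X, g X = 0}.
Proof.
move=> _ lf lg fin pia [C C0 decay].
have [lF _] := is_fourier2_fourier2 lf; have [lG _] := is_fourier2_fourier2 lg.
(* [fin] fits as it stands, because [stft g f Q P] unfolds to [fourier1] of the product h_P at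
   [Q]. *)
by have [|] := gaussian_decay_vanishing lF lG pia C0 decay fin;
  [left; exact: fourier2_eq0|right; exact: fourier2_eq0].
Qed.
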